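(* Let $a_1,\ldots,a_n\in C^\infty(\mathbb{T}^n)$ be real-valued, let $X_j=\partial_{t_j}+a_j(t)\partial_x$ for $j\in\{1,\ldots,n\}$ on $\mathbb{T}^{n+1}=\mathbb{T}^n_t\times\mathbb{T}_x$, let $\mathcal{X}=\{X_1,\ldots,X_n\}$ and $P=\sum_{j=1}^nX_j^2$. For each $j$ put $a_{j0}(t)=\frac1{2\pi}\int_0^{2\pi}a_j(t_1,\ldots,t_{j-1},\lambda,t_{j+1},\ldots,t_n)\,d\lambda$, $t\in\mathbb{T}^n$, and let $\mathcal{X}_0=\{\partial_{t_j}+a_{j0}(t)\partial_x:\ j\in\{1,\ldots,n\},\ t\in\mathbb{T}^n\}$, a system of constant-coefficient real vector fields on $\mathbb{T}^{n+1}$. The following properties are equivalent: (1) $P$ is globally solvable; (2) $P$ is almost globally hypoelliptic; (3) $\mathcal{X}$ is globally solvable; (4) $\mathcal{X}$ is almost globally hypoelliptic; (5) $\mathcal{X}_0$ is globally solvable or there is a point $t\in\mathbb{T}^n$ of finite type for $X_1,\ldots,X_n$; (6) $\mathcal{X}_0$ is almost globally hypoelliptic or there is a point $t\in\mathbb{T}^n$ of finite type for $X_1,\ldots,X_n$.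
   Context: $\mathbb{T}=\mathbb{R}/2\pi\mathbb{Z}$. In $\mathcal{X}_0$, the point $t$ in $a_{j0}(t)$ is a parameter: each fixed $j$ and $t$ give one constant-coefficient vector field. $C^\infty(\mathbb{T}^N)$ carries its usual Fréchet topology induced by the Sobolev norms. Global solvability: an operator $Q:C^\infty(\mathbb{T}^N)\to C^\infty(\mathbb{T}^N)$ is globally solvable if it has closed range. The finite system $\mathcal{X}$ is globally solvable if the map $C^\infty(\mathbb{T}^{n+1})\to C^\infty(\mathbb{T}^{n+1})^n$, $u\mapsto(X_1u,\ldots,X_nu)$, has closed range. A (possibly infinite) system $\mathcal{L}$ of constant-coefficient real vector fields on $\mathbb{T}^N$ is globally solvable if there is a basis $(L_1,\ldots,L_d)$ of $\mathrm{span}_{\mathbb{R}}\mathcal{L}$ (a subspace of the Lie algebra of $\mathbb{T}^N$) such that the map $C^\infty(\mathbb{T}^N)\to C^\infty(\mathbb{T}^N)^d$, $u\mapsto(L_1u,\ldots,L_du)$, has closed range. Almost global hypoellipticity: a system $\mathcal{S}$ of operators on $\mathbb{T}^{N}$ is almost globally hypoelliptic if whenever $u\in\mathcal{D}'(\mathbb{T}^{N})$ and $Xu\in C^\infty(\mathbb{T}^{N})$ for every $X\in\mathcal{S}$, there exists $v\in C^\infty(\mathbb{T}^{N})$ such that $X(u-v)=0$ for every $X\in\mathcal{S}$; for a single operator $P$ this is applied to $\{P\}$. A point $t\in\mathbb{T}^n$ is of finite type for $X_1,\ldots,X_n$ if Hörmander's condition holds there, i.e. the Lie algebra generated by $X_1,\ldots,X_n$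 under iterated commutators spans the tangent space of $\mathbb{T}^{n+1}$ at $(t,x)$ (independent of $x\in\mathbb{T}$). *)

(* Defs.v *)
From HB Require Import structures.
From mathcomp Require Import all_boot all_order all_algebra.
From mathcomp Require Import complex.
From mathcomp Require Import all_classical all_reals all_analysis.

Set Implicit Arguments.
Unset Strict Implicit.
Unset Printing Implicit Defensive.

Import Order.TTheory GRing.Theory Num.Theory.
Import numFieldNormedType.Exports.

Local Open Scope classical_set_scope.
Local Open Scope ring_scope.
Local Open Scope complex_scope.

Section real_smooth.
Context {R : realType} {N : nat}.
Implicit Types (f g : 'rV[R]_N -> R) (i : 'I_N) (k : nat).

Definition partial i f : 'rV[R]_N -> R := 'D_(delta_mx 0 i) f.

Fixpoint class_C k f : Prop :=
  continuous f /\
  if k is k'.+1 then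
    forall i, (forall x, derivable f x (delta_mx 0 i)) /\
              class_C k' (partial i f)
  else True.

Definition smooth f : Prop := forall k, class_C k f.

Lemma class_C_continuous k f : class_C k f -> continuous f.
Proof. by case: k => [|k] []. Qed.

Lemma class_CS k f : class_C k.+1 f -> class_C k f.
Proof.
elim: k f => [|k IH] f [cf df]; split => // i.
by have [? ?] := df i; split=> //; exact: IH.
Qed.

Lemma partialD i f g :
  (forall x, derivable f x (delta_mx 0 i)) ->
  (forall x, derivable g x (delta_mx 0 i)) ->
  partial i (fun x => f x + g x) = (fun x => partial i f x + partial i g x).
Proof. by move=> df dg; apply/funext => x; rewrite /partial deriveD. Qed.

Lemma partialM i f g :
  (forall x, derivable f x (delta_mx 0 i)) ->
  (forall x, derivable g x (delta_mx 0 i)) ->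
  partial i (fun x => f x * g x) =
  (fun x => f x * partial i g x + g x * partial i f x).
Proof. by move=> df dg; apply/funext => x; rewrite /partial deriveM. Qed.

Lemma class_C_cst k c : class_C k (fun=> c).
Proof.
elim: k c => [|k IH] c; split => //; try exact: cst_continuous.
move=> i; split; first by move=> x; exact: derivable_cst.
suff -> : partial i (fun=> c) = (fun=> 0) by exact: IH.
by apply/funext => x; rewrite /partial derive_cst.
Qed.

Lemma class_CD k f g :
  class_C k f -> class_C k g -> class_C k (fun x => f x + g x).
Proof.
elim: k f g => [|k IH] f g [cf df] [cg dg];
  (split; first by move=> x; exact: (cvgD (cf x) (cg x))) => // i.
have [fi dfi] := df i; have [gi dgi] := dg i; split.
  by move=> x; exact: derivableD.
by rewrite partialD//; exact: IH.
Qed.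

Lemma class_CM k f g :
  class_C k f -> class_C k g -> class_C k (fun x => f x * g x).
Proof.
elim: k f g => [|k IH] f g Cf Cg; have [cf df] := Cf; have [cg dg] := Cg;
  (split; first by move=> x; exact: (cvgM (cf x) (cg x))) => // i.
have [fi dfi] := df i; have [gi dgi] := dg i; split.
  by move=> x; exact: derivableM.
by rewrite partialM//; apply: class_CD; apply: IH => //; exact: class_CS.
Qed.

Lemma smooth_cst c : smooth (fun=> c).
Proof. by move=> k; exact: class_C_cst. Qed.

Lemma smoothD f g : smooth f -> smooth g -> smooth (fun x => f x + g x).
Proof. by move=> sf sg k; exact: class_CD. Qed.

Lemma smoothM f g : smooth f -> smooth g -> smooth (fun x => f x * g x).
Proof. by move=> sf sg k; exact: class_CM. Qed.

Lemma smoothB f g : smooth f -> smooth g -> smooth (fun x => f x - g x).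
Proof.
move=> sf sg; suff -> : (fun x => f x - g x) = (fun x => f x + (-1) * g x).
  by apply: smoothD => //; apply: smoothM => //; exact: smooth_cst.
by apply/funext => x; rewrite mulN1r.
Qed.

Lemma smooth_partial i f : smooth f -> smooth (partial i f).
Proof. by move=> sf k; have [_ /(_ i)[]] := sf k.+1. Qed.

End real_smooth.

Section real_smooth_lsubmx.
Context {R : realType} {n m : nat}.
Implicit Types (f : 'rV[R]_n -> R).

Let quotient f (x v : 'rV[R]_(n + m)) :
  (fun h : R => h^-1 *: (((fun y => f (lsubmx y)) \o shift x) (h *: v)
                         - f (lsubmx x))) =
  (fun h : R => h^-1 *: ((f \o shift (lsubmx x)) (h *: lsubmx v)
                         - f (lsubmx x))).
Proof.
apply/funext => h /=; congr (_ *: (f _ - _)).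
by apply/rowP => j; rewrite !mxE.
Qed.

Let lsub_lshift (i : 'I_n) :
  lsubmx (delta_mx 0 (lshift m i) : 'rV[R]_(n + m)) = delta_mx 0 i.
Proof. by apply/rowP => j; rewrite !mxE (inj_eq (@lshift_inj _ _)). Qed.

Let lsub_rshift (i : 'I_m) :
  lsubmx (delta_mx 0 (rshift n i) : 'rV[R]_(n + m)) = 0.
Proof. by apply/rowP => j; rewrite !mxE eq_lrshift andbF. Qed.

Lemma smooth_lsubmx f :
  smooth f -> smooth (fun y : 'rV[R]_(n + m) => f (lsubmx y)).
Proof.
move=> sf k; elim: k f sf => [|k IH] f sf;
  have cf := class_C_continuous (sf 0);
  (split; first by move=> x;
    exact: (continuous_comp (@continuous_lsubmx R 1 n m x) (cf _))) => // i.
case: (split_ordP i) => j ->.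
  have df : forall x, derivable f x (delta_mx 0 j).
    by have [_ /(_ j)[]] := sf 1.
  split=> [x|].
    by have := df (lsubmx x); rewrite /derivable quotient lsub_lshift.
  suff -> : partial (lshift m j) (fun y => f (lsubmx y)) =
            (fun y => partial j f (lsubmx y)).
    by apply: IH; exact: smooth_partial.
  by apply/funext => x; rewrite /partial /derive quotient lsub_lshift.
have df0 x : derivable f x 0 by exact: derivable0.
split=> [x|].
  by have := df0 (lsubmx x); rewrite /derivable quotient lsub_rshift.
suff -> : partial (rshift n j) (fun y => f (lsubmx y)) = (fun=> 0).
  exact: class_C_cst.
apply/funext => x; rewrite /partial /derive quotient lsub_rshift.
exact: derive0.
Qed.

End real_smooth_lsubmx.

Section torus_functions.
Context {R : realType} {N : nat}.
Implicit Types (f g : 'rV[R]_N -> R[i]) (i : 'I_N).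

Definition periodic f : Prop :=
  forall i x, f (x + (2 * pi) *: delta_mx 0 i) = f x.

Definition csmooth f : Prop :=
  smooth (fun x => complex.Re (f x)) /\ smooth (fun x => complex.Im (f x)).

Definition torus_smooth : {pred 'rV[R]_N -> R[i]} :=
  [pred f | `[< periodic f /\ csmooth f >]].

Lemma torus_smoothP f : reflect (periodic f /\ csmooth f) (f \in torus_smooth).
Proof. exact: asboolP. Qed.

Definition cpartial i f : 'rV[R]_N -> R[i] := fun x =>
  partial i (fun y => complex.Re (f y)) x +i* partial i (fun y => complex.Im (f y)) x.

Lemma partial_periodic i j (h : 'rV[R]_N -> R) x :
  (forall y, h (y + (2 * pi) *: delta_mx 0 j) = h y) ->
  partial i h (x + (2 * pi) *: delta_mx 0 j) = partial i h x.
Proof.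
move=> hp; rewrite /partial /derive hp.
suff -> : h \o shift (x + (2 * pi) *: delta_mx 0 j) = h \o shift x by [].
by apply/funext => y /=; rewrite addrA hp.
Qed.

Lemma cpartial_subproof i f : f \in torus_smooth -> cpartial i f \in torus_smooth.
Proof.
move=> /torus_smoothP[fp [fr fi]]; apply/torus_smoothP; split.
  by move=> j x; rewrite /cpartial !partial_periodic// => y; rewrite fp.
by split; exact: smooth_partial.
Qed.

Lemma torus_smooth_subring : subring_closed torus_smooth.
Proof.
split.
- by apply/torus_smoothP; split => //; split; exact: smooth_cst.
- move=> f g /torus_smoothP[fp [fr fi]] /torus_smoothP[gp [gr gi]]; apply/torus_smoothP; split.
    by move=> j x; rewrite !fctE fp gp.
  split; [have := smoothB fr gr|have := smoothB fi gi];
    by congr smooth; apply/funext => x; rewrite !fctE; case: (f x) (g x) => ? ? [].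
- move=> f g /torus_smoothP[fp [fr fi]] /torus_smoothP[gp [gr gi]]; apply/torus_smoothP; split.
    by move=> j x; rewrite !fctE fp gp.
  split; [have := smoothB (smoothM fr gr) (smoothM fi gi)
         |have := smoothD (smoothM fr gi) (smoothM fi gr)];
    by congr smooth; apply/funext => x; rewrite !fctE; case: (f x) (g x) => ? ? [].
Qed.

Lemma torus_smooth_cst (c : R[i]) : cst c \in torus_smooth.
Proof. by apply/torus_smoothP; split => //; split; exact: smooth_cst. Qed.

Lemma torus_smooth_scaler : GRing.scaler_closed torus_smooth.
Proof.
move=> c f fs; have [_ _ M] := torus_smooth_subring.
exact: (M _ _ (torus_smooth_cst c) fs).
Qed.

HB.instance Definition _ :=
  GRing.isSubringClosed.Build _ torus_smooth torus_smooth_subring.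
HB.instance Definition _ :=
  GRing.isScaleClosed.Build _ _ torus_smooth torus_smooth_scaler.

End torus_functions.

(* C^infinity(T^N), as complex-valued smooth functions on R^N that are
   2 pi-periodic in each variable. *)
Record torus_fun (R : realType) (N : nat) := TorusFun {
  torus_val :> 'rV[R]_N -> R[i] ;
  _ : torus_val \in torus_smooth }.

HB.instance Definition _ (R : realType) (N : nat) :=
  [isSub for @torus_val R N].
HB.instance Definition _ (R : realType) (N : nat) :=
  [Choice of torus_fun R N by <:].
HB.instance Definition _ (R : realType) (N : nat) :=
  [SubChoice_isSubLmodule of torus_fun R N by <:].
HB.instance Definition _ (R : realType) (N : nat) :=
  GRing.SubZmodule_isSubPzRing.Build _ _ (torus_fun R N) (subringClosedP _).
HB.instance Definition _ (R : realType) (N : nat) :=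
  GRing.SubPzRing_isSubComPzRing.Build _ _ (torus_fun R N).
HB.instance Definition _ (R : realType) (N : nat) :=
  isPointed.Build (torus_fun R N) 0.

Notation vector_field R N := ('I_N -> torus_fun R N) (only parsing).
Notation functional R N := (torus_fun R N -> R[i]) (only parsing).

Section calculus.
Context {R : realType}.

Definition tpartial N (i : 'I_N) (f : torus_fun R N) : torus_fun R N :=
  TorusFun (cpartial_subproof i (valP f)).

Definition mpartial N (alpha : 'I_N -> nat) (f : torus_fun R N) :
  torus_fun R N :=
  foldr (fun i g => iter (alpha i) (tpartial i) g) f (enum 'I_N).

Lemma pullback_subproof n m (f : torus_fun R n) :
  (fun y : 'rV[R]_(n + m) => f (lsubmx y)) \in torus_smooth.
Proof.
have /torus_smoothP[fp [fr fi]] := valP f; apply/torus_smoothP; split; last first.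
  by split; [exact: (smooth_lsubmx fr)|exact: (smooth_lsubmx fi)].
move=> i x; case: (split_ordP i) => j ->.
  rewrite -[RHS](fp j); congr (f _); apply/rowP => k.
  by rewrite !mxE (inj_eq (@lshift_inj _ _)).
congr (f _); apply/rowP => k.
by rewrite !mxE eq_lrshift andbF mulr0 addr0.
Qed.

(* The function (t, x) |-> f t on T^(n + m). *)
Definition pullback n m (f : torus_fun R n) : torus_fun R (n + m) :=
  TorusFun (pullback_subproof m f).

(* Iterated integral over [0, 2 pi]^N. *)
Fixpoint torus_Rint N : ('rV[R]_N -> R) -> R :=
  match N with
  | 0 => fun f => f 0
  | N'.+1 => fun f => \int[lebesgue_measure]_(s in `[0, 2 * pi])
      torus_Rint (fun y : 'rV[R]_N' => f (row_mx s%:M y : 'rV_(1 + N')))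
  end.

Definition torus_int N (f : 'rV[R]_N -> R[i]) : R[i] :=
  torus_Rint (fun x => complex.Re (f x)) +i*
  torus_Rint (fun x => complex.Im (f x)).

(* Norm of the Sobolev space H^k(T^N): multi-indices alpha with |alpha| <= k
   have all entries at most k. *)
Definition sobolev_norm N (k : nat) (f : torus_fun R N) : R :=
  Num.sqrt (\sum_(alpha : {ffun 'I_N -> 'I_k.+1} | (\sum_i alpha i <= k)%N)
    torus_Rint (fun x => let z := mpartial (fun i => alpha i) f x in
                         complex.Re z ^+ 2 + complex.Im z ^+ 2)).

End calculus.

(* The Frechet topology of C^infinity(T^N), generated by all balls of all the
   Sobolev norms. *)
HB.instance Definition _ (R : realType) (N : nat) :=
  @isSubBaseTopological.Build (torus_fun R N) (torus_fun R N * nat * R)%type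
    [set b | 0 < b.2]
    (fun b => [set g | sobolev_norm b.1.2 (g - b.1.1) < b.2]).

Section distributions.
Context {R : realType} {N : nat}.
Implicit Types (u : functional R N).

Definition distribution u : Prop :=
  scalar u /\ continuous (u : torus_fun R N -> R[i]^o).

(* Differential operators act on distributions by transposition, consistently
   with this embedding of smooth functions. *)
Definition dist_of (v : torus_fun R N) : functional R N :=
  fun phi => torus_int (fun x => v x * phi x).

Definition dist_partial (i : 'I_N) u : functional R N :=
  fun phi => - u (tpartial i phi).

Definition dist_mul (f : torus_fun R N) u : functional R N :=
  fun phi => u (f * phi).

End distributions.

Section vector_fields.
Context {R : realType} {N : nat}.
Implicit Types (X Y : vector_field R N).

Definition vf_act X (f : torus_fun R N) : torus_fun R N :=
  \sum_k X k * tpartial k f.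

Definition vf_dist X (u : functional R N) : functional R N :=
  \sum_k dist_mul (X k) (dist_partial k u).

Definition sum_squares_act d (X : 'I_d -> vector_field R N)
    (f : torus_fun R N) : torus_fun R N :=
  \sum_j vf_act (X j) (vf_act (X j) f).

Definition sum_squares_dist d (X : 'I_d -> vector_field R N)
    (u : functional R N) : functional R N :=
  \sum_j vf_dist (X j) (vf_dist (X j) u).

Definition lie_bracket X Y : vector_field R N :=
  fun k => vf_act X (Y k) - vf_act Y (X k).

Inductive lie_algebra (S : set (vector_field R N)) : vector_field R N -> Prop :=
| lie_gen X : S X -> lie_algebra S X
| lie_zero : lie_algebra S 0
| lie_add X Y : lie_algebra S X -> lie_algebra S Y -> lie_algebra S (X + Y)
| lie_scale (r : R) X : lie_algebra S X -> lie_algebra S (r%:C *: X)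
| lie_commutator X Y : lie_algebra S X -> lie_algebra S Y ->
    lie_algebra S (lie_bracket X Y).

Definition hormander_at (S : set (vector_field R N)) (y : 'rV[R]_N) : Prop :=
  forall v : 'rV[R]_N, exists2 Z, lie_algebra S Z &
    forall k, Z k y = (v 0 k)%:C.

(* The Lie algebra of T^N is identified with R^N. *)
Definition constant_field (v : 'rV[R]_N) : vector_field R N :=
  fun k => (v 0 k)%:C *: (1 : torus_fun R N).

End vector_fields.

Section solvability.
Context {R : realType} {N : nat}.

Definition globally_solvable (Q : torus_fun R N -> torus_fun R N) : Prop :=
  closed (range Q).

Definition globally_solvable_family d (Q : 'I_d -> torus_fun R N -> torus_fun R N)
    : Prop :=
  closed (range (fun f => (fun j => Q j f) : {ptws 'I_d -> torus_fun R N})).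

Definition is_span (L : set 'rV[R]_N) (U : {vspace 'rV[R]_N}) : Prop :=
  (forall v, L v -> v \in U) /\
  forall W : {vspace 'rV[R]_N}, (forall v, L v -> v \in W) -> (U <= W)%VS.

Definition globally_solvable_constant (L : set 'rV[R]_N) : Prop :=
  exists U : {vspace 'rV[R]_N}, is_span L U /\
  exists d (B : d.-tuple 'rV[R]_N), basis_of U B /\
    globally_solvable_family (fun j : 'I_d => vf_act (constant_field (tnth B j))).

Definition almost_globally_hypoelliptic
    (S : set (functional R N -> functional R N)) : Prop :=
  forall u, distribution u ->
    (forall Q, S Q -> exists g, Q u = dist_of g) ->
    exists v, forall Q, S Q -> Q (u - dist_of v) = 0.

End solvability.

(* Points of T^(n + 1) = T^n_t x T_x are row vectors whose first n entries are
   the coordinates of t and whose last entry is x. *)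
Section tube.
Context {R : realType} {n : nat}.
Implicit Types (a : 'I_n -> torus_fun R n) (t : 'rV[R]_n).

Definition tube_field a (j : 'I_n) : vector_field R (n + 1) :=
  fun k => match fintype.split k with
           | inl i => (i == j)%:R
           | inr _ => pullback 1 (a j)
           end.

Definition tube_system a : set (vector_field R (n + 1)) := range (tube_field a).

Definition mean a (j : 'I_n) t : R :=
  (2 * pi)^-1 * \int[lebesgue_measure]_(s in `[0, 2 * pi])
    complex.Re (a j (\row_k (if k == j then s else t 0 k))).

Definition mean_system a : set 'rV[R]_(n + 1) :=
  [set v | exists j t, v = row_mx (delta_mx 0 j) (mean a j t)%:M].

Definition finite_type a t : Prop :=
  forall x : R, hormander_at (tube_system a) (row_mx t x%:M).

End tube.

(* Main.v *)
(* Proof idea.  Write D for the derivative in x and b_jk for the functions with [X_j, X_k] = b_jk D.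

   If some b = b_jk is not identically zero, the fields satisfy Hoermander's condition where b does not
   vanish.  Integrating by parts, |b D u|^2 <= C |X u| (|D u| + |X D u|) because b D u is a commutator, and
   c |w|^2 <= |b w|^2 + C |w| |X w| because b^2 minus its mean c is the Laplacian of a function of t.  With
   w = D u this gives |D u| <= C (|X u| + |X D u|).  As D commutes with P, energy identities and elliptic
   regularity of the Laplacian turn it into estimates of every Sobolev norm of u by one of P u, for u of mean
   zero; so P and the system X have closed range.  On each eigenspace of D with nonzero eigenvalue, the
   continuity method from the Laplacian to P shows that P maps onto the functions of mean zero, and testing
   distributions against P phi gives almost global hypoellipticity without any distribution theory.

   If all b_jk vanish, a_j = d_j A + c_j with c_j the mean of a_j, and the functions
   exp(i (k . t + xi (x - A(t)))) are eigenfunctions of every X_j with eigenvalue i (k_j + xi c_j).  Each of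
   the six properties is then equivalent to one Diophantine condition on (c_1, ..., c_n): under it a diagonal
   system has closed range, and without it a lacunary sum of eigenfunctions is a distribution that is not
   smooth modulo the kernel although its images under the X_j are smooth and are limits in the range.  The same
   equivalence with A = 0 handles the constant coefficient system, and no point is of finite type because the
   Lie algebra generated by the X_j is their real span. *)

Require Import Defs.
From HB Require Import structures.
From mathcomp Require Import all_boot all_order all_algebra.
From mathcomp Require Import complex ring lra zify.
From mathcomp Require Import all_classical all_reals all_analysis.

Set Implicit Arguments.
Unset Strict Implicit.
Unset Printing Implicit Defensive.

Import Order.TTheory GRing.Theory Num.Theory.
Import numFieldNormedType.Exports.

Local Open Scope classical_set_scope.
Local Open Scope ring_scope.
Local Open Scope complex_scope.

(** * Integration over the torus *)

(** Fourier coefficients of a general function are never manipulated: inequalities and solvability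
    are checked on finite sums of eigenfunctions and passed to limits by density in every norm
    [nrm k]. The pairing [rip] is only the real part of the Hermitian product, so complex
    orthogonality is tested against all multiples [z *: E x]. Distributions enter only by duality.
    If [u (P phi)] is the pairing of a smooth [g] with [phi], testing on the kernel of [P] shows
    that [g] has no resonant part. Solving [P v = g] then makes [u] and [v] agree on the range of
    [P], which is all that almost global hypoellipticity asks for a single operator. Solving
    [P v = g] in the curved case is the delicate point: the global estimates lose derivatives, so no
    perturbation argument closes on the whole space. At one nonzero frequency in [x] the operator
    [Dx] is a constant multiple of the identity. There [P] differs from the Laplacian by an operator
    of order one, the estimates gain two derivatives uniformly along the path, and the continuity
    method applies. The closed range then glues the frequencies together. *)

Section bounded_functional.
Context {R : realType}.

(** These are the properties of an iterated integral that reproduce themselves under one more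
    integration. Linearity is confined to continuous integrands because the integral of a
    non-integrable function is a default value, and the bound sees [f] only on the compact set of
    integration. *)
Record bounded_functional (T : topologicalType) (K : set T) (C : R)
    (L : (T -> R) -> R) : Prop := BoundedFunctional {
  bfunD : forall f g : T -> R, continuous f -> continuous g ->
    L (fun y => f y + g y) = L f + L g ;
  bfunZ : forall (c : R) (f : T -> R), continuous f -> L (fun y => c * f y) = c * L f ;
  bfun_le : forall (f : T -> R) (M : R), continuous f -> (forall y, K y -> `|f y| <= M) ->
    `|L f| <= C * M }.

Context {T : topologicalType} {K : set T} {C : R} {L : (T -> R) -> R}.
Hypotheses (cK : compact K) (LP : bounded_functional K C L) (C0 : 0 <= C).

Lemma bfunB (f g : T -> R) : continuous f -> continuous g ->
  L (fun y => f y - g y) = L f - L g.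
Proof.
move=> cf cg.
have -> : (fun y => f y - g y) = (fun y => f y + (-1) * g y).
  by apply/funext => y; rewrite mulN1r.
rewrite (bfunD LP)//; first by rewrite (bfunZ LP)// mulN1r.
by move=> x; apply: cvgM; [exact: cvg_cst|exact: cg].
Qed.

Lemma continuous_section (S U : topologicalType) (g : S -> T -> U) (s : S) :
  continuous (fun p : S * T => g p.1 p.2) -> continuous (g s).
Proof.
move=> cg y; apply: (continuous_comp (f := fun y => (s, y)) (g := fun p => g p.1 p.2)).
  by apply: cvg_pair => //=; exact: cvg_cst.
exact: cg.
Qed.

(** Tube lemma: joint continuity gives a neighbourhood of [s0] around each point of [K], and
    compactness keeps finitely many of them. *)
Lemma uniform_near (S : topologicalType) (g : S -> T -> R) (s0 : S) (e : R) :
  continuous (fun p : S * T => g p.1 p.2) -> 0 < e ->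
  \forall s \near s0, forall y, K y -> `|g s y - g s0 y| <= e.
Proof.
move=> cg e0.
have := (compact_near_coveringP K).1 cK S (nbhs s0)
  (fun s y => `|g s y - g s0 y| <= e).
apply => y Ky.
have e2 : 0 < e / 2 by rewrite divr_gt0.
have /cvgrPdist_lt/(_ _ e2) [[/= U V] [Us Vy] UV] := cg (s0, y).
exists (V, U) => //= -[y' s] [/= Vy' Us'].
have h1 := UV (s, y') (conj Us' Vy').
have h2 := UV (s0, y') (conj (nbhs_singleton Us) Vy').
rewrite /= in h1 h2.
rewrite (_ : g s y' - g s0 y' = (g s0 y - g s0 y') - (g s0 y - g s y')); last by ring.
rewrite (splitr e) (le_trans (ler_normB _ _))// lerD// ltW//.
Qed.

Lemma bfun_continuous (S : topologicalType) (g : S -> T -> R) :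
  continuous (fun p : S * T => g p.1 p.2) -> continuous (fun s => L (g s)).
Proof.
move=> cg s0; apply/cvgrPdist_le => e e0.
have cgs s : continuous (g s).
  exact: (continuous_section (g := g)).
have C1 : 0 < C + 1 by rewrite ltr_wpDl.
have H := uniform_near s0 cg (divr_gt0 e0 C1).
near=> s; rewrite -bfunB//.
rewrite (le_trans (bfun_le LP (M := e / (C + 1)) _ _))//.
- by move=> y; apply: cvgB; exact: cgs.
- by move=> y Ky; rewrite distrC; move: y Ky; near: s.
- by rewrite mulrCA ler_piMr ?(ltW e0)// ler_pdivrMr// mul1r lerDl.
Unshelve. all: by end_near. Qed.

(** Mean value theorem for [f s - s * df s0]: the error of linear approximation is controlled by the
    oscillation of the derivative. It serves differentiation under the integral, limits of
    derivatives, constancy along lines and Lipschitz bounds. *)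
Lemma derivative_quotient_le (f df : R -> R) (s0 h e d : R) :
  (forall s : R, is_derive s 1 f (df s)) -> `|h| < d ->
  (forall s, `|s - s0| < d -> `|df s - df s0| <= e) ->
  `|f (s0 + h) - f s0 - h * df s0| <= `|h| * e.
Proof.
move=> Hf hd He.
have d0 : 0 < d by rewrite (le_lt_trans _ hd).
pose k s := f s - s * df s0.
have dk (s : R) : is_derive s 1 k (df s - df s0).
  rewrite /k; apply: is_deriveB => //.
  have -> : (fun s => s * df s0) = (fun s => df s0 *: s) by apply/funext => x; rewrite mulrC.
  have := is_deriveZ (df s0) (is_derive_id s (1 : R)).
  by rewrite [_ *: _]mulr1.
have ck A : {within A, continuous k}.
  apply: continuous_subspaceT => s; apply: differentiable_continuous.
  by apply/derivable1_diffP; case: (dk s).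
have E : f (s0 + h) - f s0 - h * df s0 = k (s0 + h) - k s0 by rewrite /k; ring.
rewrite E; case: (leP 0 h) => h0.
  have [|c + ->] := @MVT_segment _ k (fun s => df s - df s0) s0 (s0 + h) _ (fun s _ => dk s) (ck _).
    by rewrite lerDl.
  rewrite in_itv/= => /andP[c1 c2].
  rewrite normrM addrAC subrr add0r mulrC ler_wpM2l// He//.
  rewrite ger0_norm ?subr_ge0//; move: hd; rewrite ger0_norm// => hd.
  by rewrite (le_lt_trans _ hd)// lerBlDl.
have [|c + kE] := @MVT_segment _ k (fun s => df s - df s0) (s0 + h) s0 _ (fun s _ => dk s) (ck _).
  by rewrite gerDl ltW.
rewrite in_itv/= => /andP[c1 c2].
rewrite distrC kE normrM.
have -> : s0 - (s0 + h) = - h by ring.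
rewrite normrN mulrC ler_wpM2l// He//.
rewrite ler0_norm ?subr_le0//; move: hd; rewrite ltr0_norm// => hd.
by rewrite (le_lt_trans _ hd)// opprB lerBlDl -lerBlDr opprK.
Qed.

(** Differentiation under the integral: by [derivative_quotient_le] the difference quotients tend to
    [dg] uniformly on [K], and [L] is bounded for the sup norm on [K]. *)
Lemma bfun_is_derive (g dg : R -> T -> R) :
  (forall s, continuous (g s)) ->
  (forall y (s : R), is_derive s 1 (g^~ y) (dg s y)) ->
  continuous (fun p : R * T => dg p.1 p.2) ->
  forall s : R, is_derive s 1 (fun s => L (g s)) (L (dg s)).
Proof.
move=> cg Hd cdg s0.
have cdgs s : continuous (dg s).
  exact: (continuous_section (g := dg)).
have C1 : 0 < C + 1 by rewrite ltr_wpDl.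
have H : h^-1 *: (((fun s => L (g s)) \o shift s0) (h *: (1:R)) - L (g s0)) @[h --> 0^']
    --> L (dg s0).
  apply/cvgrPdist_le => e e0.
  have := uniform_near s0 cdg (divr_gt0 e0 C1).
  move=> /nbhs_ballP [d /= d0 Hd'].
  near=> h.
  have hn0 : h != 0 by near: h; exact: nbhs_dnbhs_neq.
  have hd : `|h| < d.
    near: h; exact: dnbhs0_lt.
  rewrite /= /GRing.scale/= mulr1 (addrC h s0) distrC.
  have cgh : continuous (fun y => g (s0 + h) y - g s0 y).
    by move=> y; apply: cvgB; exact: cg.
  rewrite -[X in _ * X - _]bfunB// -(bfunZ LP)// -bfunB//; last first.
    by move=> y; apply: cvgM; [exact: cvg_cst|exact: cgh].
  rewrite (le_trans (bfun_le LP (M := e / (C + 1)) _ _))//.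
  - move=> y; apply: cvgB; last exact: cdgs.
    by apply: cvgM; [exact: cvg_cst|exact: cgh].
  - move=> y Ky.
    have -> : h^-1 * (g (s0 + h) y - g s0 y) - dg s0 y =
        h^-1 * (g (s0 + h) y - g s0 y - h * dg s0 y) by field.
    rewrite normrM normfV ler_pdivrMl ?normr_gt0//.
    apply: (derivative_quotient_le (d := d)) => // s sd.
    by apply: Hd' => //=; rewrite /ball/= distrC.
  - by rewrite mulrCA ler_piMr ?(ltW e0)// ler_pdivrMr// mul1r lerDl.
apply: DeriveDef; first by apply/cvg_ex; eexists; exact: H.
exact: cvg_lim H.
Unshelve. all: by end_near. Qed.

End bounded_functional.

Section matrix_continuity.
Context {R : realType}.

Lemma continuous_mx (S : topologicalType) m k (F : S -> 'M[R]_(m, k)) :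
  (forall i j, continuous (fun x => F x i j)) -> continuous F.
Proof.
move=> cF x A [P PF PA].
have : \forall y \near x, forall i j, P i j (F y i j).
  by apply: filter_forall => i; apply: filter_forall => j; exact: cF.
by apply: filterS => y Py; exact: PA.
Qed.

Definition cons_rV N (s : R) (y : 'rV[R]_N) : 'rV[R]_(1 + N) := row_mx s%:M y.

Lemma cons_rV_l N s (y : 'rV[R]_N) (i : 'I_1) : cons_rV s y 0 (lshift N i) = s.
Proof. by rewrite /cons_rV row_mxEl mxE eq_sym ord1 eqxx mulr1n. Qed.

Lemma cons_rV_r N s (y : 'rV[R]_N) (i : 'I_N) : cons_rV s y 0 (rshift 1 i) = y 0 i.
Proof. by rewrite /cons_rV row_mxEr. Qed.

Lemma cons_rV_continuous N :
  continuous (fun p : R * 'rV[R]_N => cons_rV p.1 p.2).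
Proof.
apply: continuous_mx => i j; rewrite ord1.
case: (split_ordP j) => k -> p.
  under eq_fun do rewrite cons_rV_l; exact: cvg_fst.
under eq_fun do rewrite cons_rV_r.
apply: (continuous_comp (f := snd) (g := fun y : 'rV[R]_N => y 0 k)); first exact: cvg_snd.
exact: coord_continuous.
Qed.

Lemma slice_continuous N (f : 'rV[R]_(1 + N) -> R) s :
  continuous f -> continuous (fun y => f (cons_rV s y)).
Proof.
move=> cf; apply: (continuous_section (g := fun s y => f (cons_rV s y))) => p.
by apply: continuous_comp; [exact: cons_rV_continuous|exact: cf].
Qed.

Lemma slice2_continuous N (f : 'rV[R]_(1 + N) -> R) :
  continuous f -> continuous (fun p => f (cons_rV p.1 p.2)).
Proof.
move=> cf p.
by apply: (continuous_comp (@cons_rV_continuous N p)); exact: cf.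
Qed.

End matrix_continuity.

Section circle_integral.
Context {R : realType}.
Notation mu := (@lebesgue_measure R).

Lemma twopi_gt0 : 0 < 2 * pi :> R.
Proof. by rewrite mulr_gt0// pi_gt0. Qed.

Definition circle_int (f : R -> R) : R := \int[mu]_(s in `[0, 2 * pi]) f s.

Lemma circle_integrable (f : R -> R) : continuous f ->
  mu.-integrable `[0, 2 * pi] (EFin \o f).
Proof.
move=> cf; apply: continuous_compact_integrable; first exact: segment_compact.
exact: continuous_subspaceT.
Qed.

Lemma circle_int_cst (c : R) : circle_int (fun=> c) = c * (2 * pi).
Proof.
rewrite /circle_int Rintegral_cst//; congr (_ * _).
rewrite -[fine _]/(fine (lebesgue_measure _)) lebesgue_measure_itv/= lte_fin twopi_gt0/=. by rewrite subr0.
Qed.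

Lemma circle_int_le (f g : R -> R) : continuous f -> continuous g ->
  (forall s, `[0, 2 * pi]%classic s -> f s <= g s) -> circle_int f <= circle_int g.
Proof. by move=> cf cg fg; apply: le_Rintegral => //; exact: circle_integrable. Qed.

Lemma circle_int_bounded :
  bounded_functional `[0, 2 * pi]%classic (2 * pi) circle_int.
Proof.
split.
- by move=> f g cf cg; apply: RintegralD => //; exact: circle_integrable.
- by move=> c f cf; apply: RintegralZl => //; exact: circle_integrable.
- move=> f M cf fM; rewrite (le_trans (le_normr_Rintegral _ _))//.
    exact: circle_integrable.
  rewrite (mulrC _ M) -circle_int_cst; apply: circle_int_le => //; last exact: cst_continuous.
  by move=> s; apply: (continuous_comp (cf s)); exact: norm_continuous.
Qed.

Lemma circle_int_ge0 (f : R -> R) :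
  (forall s, `[0, 2 * pi]%classic s -> 0 <= f s) -> 0 <= circle_int f.
Proof. by move=> f0; exact: (@Rintegral_ge0 _ _ _ mu). Qed.

Lemma circle_FTC (F f : R -> R) : continuous f ->
  (forall s : R, is_derive s 1 F (f s)) -> circle_int f = F (2 * pi) - F 0.
Proof.
move=> cf dF.
have cF : continuous F.
  by move=> s; apply: differentiable_continuous; apply/derivable1_diffP; case: (dF s).
rewrite /circle_int /Rintegral (@continuous_FTC2 _ f F).
- by [].
- exact: twopi_gt0.
- exact: continuous_subspaceT.
- split; first by move=> s _; case: (dF s).
  + exact: (cvg_at_right_filter (cF 0)).
  + exact: (cvg_at_left_filter (cF _)).
- by move=> s _; rewrite derive1E; exact: derive_val.
Qed.

End circle_integral.

Section torus_integral.
Context {R : realType}.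

Definition box N : set 'rV[R]_N := [set x | forall i, `[0, 2 * pi]%classic (x ord0 i)].

Lemma box_compact N : compact (@box N).
Proof.
by apply: (@rV_compact R N (fun=> `[0, 2 * pi]%classic)) => i; exact: segment_compact.
Qed.

Lemma box_cons N s (y : 'rV[R]_N) :
  `[0, 2 * pi]%classic s -> box y -> box (cons_rV s y).
Proof.
move=> sb yb i; case: (split_ordP i) => j ->; first by rewrite cons_rV_l.
by rewrite cons_rV_r.
Qed.

Lemma torus_RintS N (f : 'rV[R]_N.+1 -> R) :
  torus_Rint f = circle_int (fun s => torus_Rint (fun y : 'rV[R]_N => f (cons_rV s y))).
Proof. by []. Qed.

Lemma twopiX_ge0 N : 0 <= (2 * pi) ^+ N :> R.
Proof. by rewrite exprn_ge0// ltW// twopi_gt0. Qed.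

(** The inner integral must be continuous in the outer variable before the one-variable rules apply
    to it; [bfun_continuous] extracts this continuity from the induction hypothesis itself. *)
Lemma torus_Rint_bounded N :
  bounded_functional (@box N) ((2 * pi) ^+ N) (@torus_Rint R N).
Proof.
elim: N => [|N IH].
  by split => //= f M _ fM; rewrite expr0 mul1r; apply: fM => -[].
have cs (f : 'rV[R]_N.+1 -> R) : continuous f ->
    continuous (fun s => torus_Rint (fun y : 'rV[R]_N => f (cons_rV s y))).
  move=> cf; apply: (bfun_continuous (@box_compact N) IH (twopiX_ge0 N)
    (g := fun s y => f (cons_rV s y))).
  exact: (slice2_continuous (f := f : 'rV[R]_(1 + N) -> R)).
have [CD CZ Cle] := @circle_int_bounded R.
have [ID IZ Ile] := IH.
split.
- move=> f g cf cg; rewrite !torus_RintS -CD; [|exact: cs..].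
  by congr circle_int; apply/funext => s; rewrite -ID//; exact: (slice_continuous (N := N)).
- move=> c f cf; rewrite !torus_RintS -CZ; [|exact: cs..].
  by congr circle_int; apply/funext => s; rewrite -IZ//; exact: (slice_continuous (N := N)).
- move=> f M cf fM; rewrite torus_RintS exprS -mulrA; apply: Cle; first exact: cs.
  move=> s sb; apply: Ile; first exact: (slice_continuous (N := N)).
  by move=> y yb; apply: fM; exact: (box_cons (N := N)).
Qed.

Lemma torus_Rint_slice_continuous N (f : 'rV[R]_N.+1 -> R) : continuous f ->
  continuous (fun s => torus_Rint (fun y : 'rV[R]_N => f (cons_rV s y))).
Proof.
move=> cf; apply: (bfun_continuous (@box_compact N) (torus_Rint_bounded N) (twopiX_ge0 N)
    (g := fun s y => f (cons_rV s y))).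
exact: (slice2_continuous (f := f : 'rV[R]_(1 + N) -> R)).
Qed.

Lemma torus_Rint_ge0 N (f : 'rV[R]_N -> R) :
  (forall x, 0 <= f x) -> 0 <= torus_Rint f.
Proof.
elim: N f => [|N IH] f f0; first exact: f0.
by rewrite torus_RintS; apply: circle_int_ge0 => s _; apply: IH.
Qed.

Lemma torus_RintD N (f g : 'rV[R]_N -> R) : continuous f -> continuous g ->
  torus_Rint (fun x => f x + g x) = torus_Rint f + torus_Rint g.
Proof. exact: (bfunD (torus_Rint_bounded N)). Qed.

Lemma torus_RintZ N c (f : 'rV[R]_N -> R) : continuous f ->
  torus_Rint (fun x => c * f x) = c * torus_Rint f.
Proof. exact: (bfunZ (torus_Rint_bounded N)). Qed.

Lemma torus_RintB N (f g : 'rV[R]_N -> R) : continuous f -> continuous g ->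
  torus_Rint (fun x => f x - g x) = torus_Rint f - torus_Rint g.
Proof. exact: (bfunB (torus_Rint_bounded N)). Qed.

Lemma torus_Rint_le N (f g : 'rV[R]_N -> R) : continuous f -> continuous g ->
  (forall x, f x <= g x) -> torus_Rint f <= torus_Rint g.
Proof.
move=> cf cg fg; rewrite -subr_ge0 -torus_RintB//; apply: torus_Rint_ge0 => x.
by rewrite subr_ge0.
Qed.

Lemma torus_Rint_cst N (c : R) : torus_Rint (fun _ : 'rV[R]_N => c) = c * (2 * pi) ^+ N.
Proof.
elim: N => [|N IH]; first by rewrite /= expr0 mulr1.
rewrite torus_RintS; under eq_fun do rewrite IH.
by rewrite circle_int_cst -mulrA -exprSr.
Qed.

Lemma is_derive_line N (f : 'rV[R]_N -> R) (v x : 'rV[R]_N) (s : R) :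
  (forall y, derivable f y v) ->
  is_derive s (1 : R) (fun s => f (x + s *: v)) ('D_v f (x + s *: v)).
Proof.
move=> df.
have E : (fun h : R => h^-1 *: (((fun s => f (x + s *: v)) \o shift s) (h *: (1:R)) - f (x + s *: v)))
   = (fun h : R => h^-1 *: ((f \o shift (x + s *: v)) (h *: v) - f (x + s *: v))).
  apply/funext => h /=; rewrite [h *: 1]mulr1.
  by congr (_ *: (f _ - _)); rewrite scalerDl; rewrite addrCA.
by apply: DeriveDef; rewrite /derivable /derive E//; exact: df.
Qed.

Lemma cons_rV_shift N (s : R) (y : 'rV[R]_N) (i : 'I_1) :
  cons_rV s y = cons_rV 0 y + s *: delta_mx 0 (lshift N i).
Proof.
apply/rowP => j; case: (split_ordP j) => k ->.
  by rewrite [in RHS]mxE !cons_rV_l add0r !mxE !ord1 !eqxx mulr1.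
by rewrite [in RHS]mxE !cons_rV_r !mxE eq_rlshift andbF mulr0 addr0.
Qed.

Lemma cons_rV_shiftr N (s : R) (y : 'rV[R]_N) c (i : 'I_N) :
  cons_rV s (y + c *: delta_mx 0 i) = cons_rV s y + c *: delta_mx 0 (rshift 1 i).
Proof.
apply/rowP => j; case: (split_ordP j) => k ->.
  by rewrite [in RHS]mxE !cons_rV_l !mxE eq_lrshift andbF mulr0 addr0.
by rewrite [in RHS]mxE !cons_rV_r !mxE (inj_eq (@rshift_inj _ _)).
Qed.

Lemma slice_is_derive N (f : 'rV[R]_(1 + N) -> R) (i : 'I_1) (y : 'rV[R]_N) (s : R) :
  (forall x, derivable f x (delta_mx 0 (lshift N i))) ->
  is_derive s (1 : R) (fun s => f (cons_rV s y)) (partial (lshift N i) f (cons_rV s y)).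
Proof.
move=> df; have := is_derive_line (cons_rV 0 y) s df; rewrite -cons_rV_shift.
suff -> : (fun s => f (cons_rV 0 y + s *: delta_mx 0 (lshift N i)))
  = (fun s => f (cons_rV s y)) by [].
by apply/funext => t; rewrite -cons_rV_shift.
Qed.

Let slice_quotient N (f : 'rV[R]_(1 + N) -> R) (i : 'I_N) s y :
  (fun h : R => h^-1 *: (((fun y => f (cons_rV s y)) \o shift y) (h *: delta_mx 0 i) - f (cons_rV s y)))
  = (fun h : R => h^-1 *: ((f \o shift (cons_rV s y)) (h *: delta_mx 0 (rshift 1 i)) - f (cons_rV s y))).
Proof.
apply/funext => h /=; congr (_ *: (f _ - _)).
by rewrite addrC cons_rV_shiftr addrC.
Qed.

Lemma slice_derivable N (f : 'rV[R]_(1 + N) -> R) (i : 'I_N) s y :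
  derivable f (cons_rV s y) (delta_mx 0 (rshift 1 i)) ->
  derivable (fun y => f (cons_rV s y)) y (delta_mx 0 i).
Proof. by rewrite /derivable slice_quotient. Qed.

Lemma slice_partial N (f : 'rV[R]_(1 + N) -> R) (i : 'I_N) s :
  partial i (fun y => f (cons_rV s y)) =
  (fun y => partial (rshift 1 i) f (cons_rV s y)).
Proof. by apply/funext => y; rewrite /partial /derive slice_quotient. Qed.

(** A derivative in the first variable passes out of the inner integral and is killed by periodicity
    through the fundamental theorem of calculus; a derivative in another variable vanishes slice by
    slice, by induction. *)
Lemma torus_Rint_partial N (f : 'rV[R]_N -> R) (i : 'I_N) :
  continuous f -> (forall x, derivable f x (delta_mx 0 i)) -> continuous (partial i f) ->
  (forall x, f (x + (2 * pi) *: delta_mx 0 i) = f x) ->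
  torus_Rint (partial i f) = 0.
Proof.
elim: N f i => [f []//|N IH] f i cf df cdf fper; rewrite torus_RintS.
case: (split_ordP (i : 'I_(1 + N))) => j ij; rewrite {}ij in df cdf fper *; last first.
  under eq_fun do rewrite -(slice_partial (N := N)).
  under eq_fun => s.
    rewrite IH; first over.
    - exact: (slice_continuous (N := N)).
    - by move=> x; exact: (slice_derivable (N := N)).
    - by rewrite slice_partial; exact: (slice_continuous (N := N)).
    - by move=> x; rewrite -[RHS]fper; congr f; exact: (cons_rV_shiftr s x (2 * pi) j).
  by rewrite circle_int_cst mul0r.
have F' (s : R) : is_derive s (1 : R)
    (fun s => torus_Rint (fun y : 'rV[R]_N => f (cons_rV s y)))
    (torus_Rint (fun y : 'rV[R]_N => partial (lshift N j) (f : 'rV[R]_(1 + N) -> R) (cons_rV s y))).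
  apply: (bfun_is_derive (@box_compact N) (torus_Rint_bounded N) (twopiX_ge0 N)
    (g := fun s y => f (cons_rV s y))
    (dg := fun s y => partial (lshift N j) (f : 'rV[R]_(1 + N) -> R) (cons_rV s y))).
  + by move=> t; exact: (slice_continuous (N := N)).
  + by move=> y t; exact: (slice_is_derive (N := N)).
  + exact: (slice2_continuous (N := N)).
rewrite (circle_FTC _ F'); last exact: (torus_Rint_slice_continuous (N := N)).
apply/eqP; rewrite subr_eq0; apply/eqP; congr torus_Rint; apply/funext => y.
by rewrite -[RHS]fper; congr f; exact: (cons_rV_shift (2 * pi) y j).
Qed.

End torus_integral.

(** * Calculus in the algebra of smooth functions *)

Section torus_algebra.
Context {R : realType} {N : nat}.
Notation T := (torus_fun R N).
Implicit Types (f g h : T) (c : R[i]) (x : 'rV[R]_N).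

Lemma tfun_ext f g : (forall x, f x = g x) -> f = g.
Proof. by move=> fg; apply/val_inj/funext. Qed.

Lemma tfunD f g x : (f + g) x = f x + g x. Proof. by []. Qed.
Lemma tfunN f x : (- f) x = - f x. Proof. by []. Qed.
Lemma tfunB f g x : (f - g) x = f x - g x. Proof. by []. Qed.
Lemma tfunM f g x : (f * g) x = f x * g x. Proof. by []. Qed.
Lemma tfunZ c f x : (c *: f) x = c * f x. Proof. by []. Qed.
Lemma tfun0 x : (0 : T) x = 0. Proof. by []. Qed.
Lemma tfun1 x : (1 : T) x = 1. Proof. by []. Qed.

Lemma tfun_sum I (r : seq I) (P : pred I) (F : I -> T) x :
  (\sum_(i <- r | P i) F i) x = \sum_(i <- r | P i) F i x.
Proof. by elim/big_rec2: _ => // i y z _ <-. Qed.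

Lemma tscalerAl c f g : c *: (f * g) = c *: f * g.
Proof. by apply: tfun_ext => x; rewrite !(tfunZ, tfunM) mulrA. Qed.

Lemma tscalerAr c f g : c *: (f * g) = f * (c *: g).
Proof. by rewrite mulrC tscalerAl mulrC. Qed.

Lemma tscale1E c f : c *: f = (c *: (1 : T)) * f.
Proof. by rewrite -tscalerAl mul1r. Qed.

Lemma tconj_subproof f : (fun x => conjc (f x)) \in torus_smooth.
Proof.
have /torus_smoothP[fp [fr fi]] := valP f; apply/torus_smoothP; split.
  by move=> i x; rewrite fp.
split.
  suff -> : (fun x => complex.Re (conjc (f x))) = (fun x => complex.Re (f x)) by [].
  by apply/funext => x; case: (f x).
suff -> : (fun x => complex.Im (conjc (f x))) = (fun x => 0 - complex.Im (f x)).
  exact: smoothB (smooth_cst 0) fi.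
by apply/funext => x; case: (f x) => a b; rewrite /= sub0r.
Qed.

End torus_algebra.

HB.lock Definition tconj {R : realType} {N : nat} (f : torus_fun R N) : torus_fun R N :=
  TorusFun (tconj_subproof f).

Section torus_derivations.
Context {R : realType} {N : nat}.
Notation T := (torus_fun R N).
Implicit Types (f g h : T) (c : R[i]) (x : 'rV[R]_N).

Lemma tconjE f x : tconj f x = conjc (f x). Proof. by rewrite tconj.unlock. Qed.

Lemma tconjK f : tconj (tconj f) = f.
Proof. by apply: tfun_ext => x; rewrite !tconjE conjcK. Qed.
Lemma tconjD f g : tconj (f + g) = tconj f + tconj g.
Proof. by apply: tfun_ext => x; rewrite tfunD !tconjE tfunD rmorphD. Qed.
Lemma tconjM f g : tconj (f * g) = tconj f * tconj g.
Proof. by apply: tfun_ext => x; rewrite tfunM !tconjE tfunM rmorphM. Qed.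
Lemma tconjZ c f : tconj (c *: f) = conjc c *: tconj f.
Proof. by apply: tfun_ext => x; rewrite tfunZ !tconjE tfunZ rmorphM. Qed.
Lemma tconj1 : tconj (1 : T) = 1.
Proof. by apply: tfun_ext => x; rewrite tconjE tfun1; apply/eqP; rewrite eq_complex/= oppr0 !eqxx. Qed.
Lemma tconjN f : tconj (- f) = - tconj f.
Proof. by apply: tfun_ext => x; rewrite tfunN !tconjE tfunN; case: (f x) => a b; apply/eqP; rewrite eq_complex/= !eqxx. Qed.
Lemma tconjB f g : tconj (f - g) = tconj f - tconj g.
Proof. by rewrite tconjD tconjN. Qed.
Lemma tconj0 : tconj (0 : T) = 0.
Proof. by apply: (addrI (tconj 0)); rewrite -tconjD !addr0. Qed.
Lemma tconj_sum I (r : seq I) (P : pred I) (F : I -> T) :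
  tconj (\sum_(i <- r | P i) F i) = \sum_(i <- r | P i) tconj (F i).
Proof. by rewrite (big_morph tconj tconjD tconj0). Qed.

Lemma tRe_smooth f : smooth (fun x => complex.Re (f x)).
Proof. by have /torus_smoothP[_ []] := valP f. Qed.
Lemma tIm_smooth f : smooth (fun x => complex.Im (f x)).
Proof. by have /torus_smoothP[_ []] := valP f. Qed.
Lemma tRe_continuous f : continuous (fun x => complex.Re (f x)).
Proof. exact: (class_C_continuous (tRe_smooth f 0%N)). Qed.
Lemma tIm_continuous f : continuous (fun x => complex.Im (f x)).
Proof. exact: (class_C_continuous (tIm_smooth f 0%N)). Qed.
Lemma tperiodic f (i : 'I_N) x : f (x + (2 * pi) *: delta_mx 0 i) = f x.
Proof. by have /torus_smoothP[p _] := valP f; exact: p. Qed.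

Lemma smooth_derivable (u : 'rV[R]_N -> R) (i : 'I_N) x :
  smooth u -> derivable u x (delta_mx 0 i).
Proof. by move=> /(_ 1%N)[_ /(_ i)[]]. Qed.

Lemma tRe_derivable f (i : 'I_N) x : derivable (fun x => complex.Re (f x)) x (delta_mx 0 i).
Proof. by apply: smooth_derivable; exact: tRe_smooth. Qed.
Lemma tIm_derivable f (i : 'I_N) x : derivable (fun x => complex.Im (f x)) x (delta_mx 0 i).
Proof. by apply: smooth_derivable; exact: tIm_smooth. Qed.

Lemma tpartialE i f x : tpartial i f x =
  partial i (fun y => complex.Re (f y)) x +i* partial i (fun y => complex.Im (f y)) x.
Proof. by []. Qed.

Lemma tpartialD i f g : tpartial i (f + g) = tpartial i f + tpartial i g.
Proof.
apply: tfun_ext => x; rewrite tfunD !tpartialE.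
have -> : (fun y => complex.Re ((f + g) y)) = (fun y => complex.Re (f y) + complex.Re (g y)).
  by apply/funext => y; rewrite tfunD; case: (f y) (g y) => a b [].
have -> : (fun y => complex.Im ((f + g) y)) = (fun y => complex.Im (f y) + complex.Im (g y)).
  by apply/funext => y; rewrite tfunD; case: (f y) (g y) => a b [].
by rewrite (partialD (@tRe_derivable f i) (@tRe_derivable g i))
  (partialD (@tIm_derivable f i) (@tIm_derivable g i)).
Qed.

Lemma tpartialM i f g : tpartial i (f * g) = tpartial i f * g + f * tpartial i g.
Proof.
have dM (u v : 'rV[R]_N -> R) : (forall x, derivable u x (delta_mx 0 i)) ->
    (forall x, derivable v x (delta_mx 0 i)) ->
    forall x, derivable (fun x => u x * v x) x (delta_mx 0 i).
  by move=> du dv y; exact: derivableM.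
have dN (u : 'rV[R]_N -> R) : (forall x, derivable u x (delta_mx 0 i)) ->
    forall x, derivable (fun x => - u x) x (delta_mx 0 i).
  by move=> du y; exact: derivableN.
apply: tfun_ext => x; rewrite tfunD !tfunM !tpartialE.
have -> : (fun y => complex.Re ((f * g) y)) = (fun y => complex.Re (f y) * complex.Re (g y)
    + - (complex.Im (f y) * complex.Im (g y))).
  by apply/funext => y; rewrite tfunM; case: (f y) (g y) => a b [c d].
have -> : (fun y => complex.Im ((f * g) y)) = (fun y => complex.Re (f y) * complex.Im (g y) + complex.Im (f y) * complex.Re (g y)).
  by apply/funext => y; rewrite tfunM; case: (f y) (g y) => a b [].
have RR := dM _ _ (@tRe_derivable f i) (@tRe_derivable g i).
have II := dM _ _ (@tIm_derivable f i) (@tIm_derivable g i).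
have IR := dM _ _ (@tIm_derivable f i) (@tRe_derivable g i).
have RI := dM _ _ (@tRe_derivable f i) (@tIm_derivable g i).
rewrite (partialD RR (dN _ II)) (partialD RI IR).
have -> : partial i (fun x => - (complex.Im (f x) * complex.Im (g x))) =
    (fun x => - partial i (fun x => complex.Im (f x) * complex.Im (g x)) x).
  by apply/funext => y; rewrite /partial deriveN.
rewrite (partialM (@tRe_derivable f i) (@tRe_derivable g i)).
rewrite (partialM (@tIm_derivable f i) (@tIm_derivable g i)).
rewrite (partialM (@tIm_derivable f i) (@tRe_derivable g i)).
rewrite (partialM (@tRe_derivable f i) (@tIm_derivable g i)).
apply/eqP; rewrite eq_complex; case: (f x) (g x) => a b [c d] /=.
by apply/andP; split; apply/eqP; ring.
Qed.

Lemma tpartialZ i c f : tpartial i (c *: f) = c *: tpartial i f.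
Proof.
have -> : c *: f = (c *: (1 : T)) * f by rewrite -tscale1E.
rewrite tpartialM (_ : tpartial i (c *: (1 : T)) = 0) ?mul0r ?add0r -?tscale1E//.
apply: tfun_ext => x; rewrite tpartialE.
have -> : (fun y => complex.Re ((c *: (1 : T)) y)) = fun=> complex.Re c.
  by apply/funext => y; rewrite tfunZ tfun1 mulr1.
have -> : (fun y => complex.Im ((c *: (1 : T)) y)) = fun=> complex.Im c.
  by apply/funext => y; rewrite tfunZ tfun1 mulr1.
by rewrite /partial !derive_cst.
Qed.

Lemma tpartialN i f : tpartial i (- f) = - tpartial i f.
Proof. by rewrite -scaleN1r tpartialZ scaleN1r. Qed.
Lemma tpartialB i f g : tpartial i (f - g) = tpartial i f - tpartial i g.
Proof. by rewrite tpartialD tpartialN. Qed.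
Lemma tpartial0 i : tpartial i (0 : T) = 0.
Proof. by apply: (addrI (tpartial i 0)); rewrite -tpartialD !addr0. Qed.
Lemma tpartial1 i : tpartial i (1 : T) = 0.
Proof.
have /eqP := tpartialM i 1 1; rewrite !mulr1 mul1r.
by rewrite -subr_eq0 opprD addrA subrr sub0r oppr_eq0 => /eqP.
Qed.
Lemma tpartial_sum i I (r : seq I) (P : pred I) (F : I -> T) :
  tpartial i (\sum_(k <- r | P k) F k) = \sum_(k <- r | P k) tpartial i (F k).
Proof. by rewrite (big_morph (tpartial i) (tpartialD i) (tpartial0 i)). Qed.

Lemma tpartial_conj i f : tpartial i (tconj f) = tconj (tpartial i f).
Proof.
apply: tfun_ext => x; rewrite tconjE !tpartialE /=.
have -> : (fun y => complex.Re (tconj f y)) = (fun y => complex.Re (f y)).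
  by apply/funext => y; rewrite tconjE; case: (f y).
have -> : (fun y => complex.Im (tconj f y)) = (fun y => - complex.Im (f y)).
  by apply/funext => y; rewrite tconjE; case: (f y).
have -> : partial i (fun y => - complex.Im (f y)) x = - partial i (fun y => complex.Im (f y)) x.
  by rewrite /partial deriveN//; exact: tIm_derivable.
by [].
Qed.

End torus_derivations.

HB.lock Definition pd {R : realType} {N : nat} (i : 'I_N) (f : torus_fun R N) : torus_fun R N :=
  tpartial i f.

HB.lock Definition RI {R : realType} {N : nat} (f : torus_fun R N) : R :=
  torus_Rint (fun x => complex.Re (f x)).

Section torus_integration.
Context {R : realType} {N : nat}.
Notation T := (torus_fun R N).
Implicit Types (f g h : T) (c : R[i]) (x : 'rV[R]_N).

Lemma pdE i f x : pd i f x =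
  partial i (fun y => complex.Re (f y)) x +i* partial i (fun y => complex.Im (f y)) x.
Proof. by rewrite pd.unlock. Qed.
Lemma Re_pd i f : partial i (fun y => complex.Re (f y)) = (fun x => complex.Re (pd i f x)).
Proof. by apply/funext => x; rewrite pdE. Qed.
Lemma Im_pd i f : partial i (fun y => complex.Im (f y)) = (fun x => complex.Im (pd i f x)).
Proof. by apply/funext => x; rewrite pdE. Qed.
Lemma pdD i f g : pd i (f + g) = pd i f + pd i g.
Proof. by rewrite pd.unlock tpartialD. Qed.
Lemma pdM i f g : pd i (f * g) = pd i f * g + f * pd i g.
Proof. by rewrite pd.unlock tpartialM. Qed.
Lemma pdZ i c f : pd i (c *: f) = c *: pd i f.
Proof. by rewrite pd.unlock tpartialZ. Qed.
Lemma pdN i f : pd i (- f) = - pd i f.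
Proof. by rewrite pd.unlock tpartialN. Qed.
Lemma pdB i f g : pd i (f - g) = pd i f - pd i g.
Proof. by rewrite pd.unlock tpartialB. Qed.
Lemma pd0 i : pd i (0 : T) = 0.
Proof. by rewrite pd.unlock tpartial0. Qed.
Lemma pd1 i : pd i (1 : T) = 0.
Proof. by rewrite pd.unlock tpartial1. Qed.
Lemma pd_sum i I (r : seq I) (P : pred I) (F : I -> T) :
  pd i (\sum_(k <- r | P k) F k) = \sum_(k <- r | P k) pd i (F k).
Proof. by rewrite pd.unlock tpartial_sum. Qed.
Lemma pd_conj i f : pd i (tconj f) = tconj (pd i f).
Proof. by rewrite pd.unlock tpartial_conj. Qed.

Lemma RIE f : RI f = torus_Rint (fun x => complex.Re (f x)). Proof. by rewrite RI.unlock. Qed.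

Lemma RID f g : RI (f + g) = RI f + RI g.
Proof.
rewrite !RIE -torus_RintD; [|exact: tRe_continuous..].
by congr torus_Rint; apply/funext => x; rewrite tfunD; case: (f x) (g x) => a b [].
Qed.

Lemma RIZ (r : R) f : RI (r%:C *: f) = r * RI f.
Proof.
rewrite !RIE -torus_RintZ; last exact: tRe_continuous.
by congr torus_Rint; apply/funext => x; rewrite tfunZ; case: (f x) => a b /=; rewrite mul0r subr0.
Qed.

Lemma RIN f : RI (- f) = - RI f.
Proof.
have -> : - f = (-1)%:C *: f by rewrite rmorphN scaleN1r.
by rewrite (RIZ (-1)) mulN1r.
Qed.

Lemma RI0 : RI (0 : T) = 0. Proof. by apply: (addrI (RI (0:T))); rewrite -RID !addr0. Qed.

Lemma RI_conj f : RI (tconj f) = RI f.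
Proof. by rewrite !RIE; congr torus_Rint; apply/funext => x; rewrite tconjE; case: (f x). Qed.

Lemma RI1 : RI (1 : T) = (2 * pi) ^+ N.
Proof.
rewrite RIE -[RHS]mul1r -torus_Rint_cst.
by congr torus_Rint; apply/funext => x.
Qed.

Lemma RI_partial i f : RI (pd i f) = 0.
Proof.
rewrite RIE pd.unlock.
apply: (@torus_Rint_partial _ _ (fun x => complex.Re (f x))).
- exact: tRe_continuous.
- by move=> x; apply: smooth_derivable; exact: tRe_smooth.
- exact: (class_C_continuous (smooth_partial i (tRe_smooth f) 0%N)).
- by move=> x; rewrite tperiodic.
Qed.

Lemma RI_le f g : (forall x, complex.Re (f x) <= complex.Re (g x)) -> RI f <= RI g.
Proof. by move=> fg; rewrite !RIE; apply: torus_Rint_le => //; exact: tRe_continuous. Qed.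

Lemma torus_intE f : torus_int f = RI f +i* RI (- 'i *: f).
Proof.
rewrite /torus_int !RIE; congr (_ +i* _); congr torus_Rint.
by apply/funext => x; rewrite tfunZ; case: (f x) => a b /=; rewrite oppr0 mul0r sub0r mulN1r opprK.
Qed.

Lemma tperiodic_int f (k : int) (i : 'I_N) x :
  f (x + (2 * pi * k%:~R) *: delta_mx 0 i) = f x.
Proof.
have P (m : nat) y : f (y + (2 * pi * m%:R) *: delta_mx 0 i) = f y.
  elim: m y => [|m IH] y; first by rewrite mulr0 scale0r addr0.
  rewrite -(natr1 m) mulrDr mulr1 scalerDl addrA.
  by rewrite tperiodic.
case: k => m; first exact: P.
rewrite -(P m.+1 (x + _)); congr (f _).
by rewrite -addrA -scalerDl NegzE mulrNz mulrN addNr scale0r addr0.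
Qed.

(** Translation by whole periods, counted by the floor of each coordinate over [2 pi], turns bounds
    on the compact box into bounds everywhere. *)
Lemma box_reduce x : exists y, box y /\ forall f, f x = f y.
Proof.
pose k i : int := - Num.floor (x 0 i / (2 * pi)).
pose y := x + \sum_i (2 * pi * (k i)%:~R) *: delta_mx 0 i.
exists y; split; last first.
  move=> f; rewrite /y; elim/big_rec: _ => [|i z _ IH]; first by rewrite addr0.
  by rewrite [X in x + X]addrC addrA tperiodic_int.
move=> i.
have -> : y ord0 i = x 0 i + 2 * pi * (k i)%:~R.
  rewrite /y mxE summxE (bigD1 i)//= big1 ?addr0; last first.
    by move=> j ji; rewrite !mxE [i == j]eq_sym (negbTE ji) andbF mulr0.
  by rewrite !mxE !eqxx mulr1.
have p0 := @twopi_gt0 R.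
have /andP[h1 h2] := floor_itv (x 0 i / (2 * pi)).
rewrite /k mulrNz mulrN /= in_itv/= subr_ge0 lerBlDl mulrC -ler_pdivlMr// h1/=.
move: h2; rewrite intrD ltr_pdivrMr// => h2.
by rewrite ltW// (lt_le_trans h2)// mulrDl mul1r addrC mulrC.
Qed.

Lemma tfun_bounded f : exists2 M : R, 0 <= M &
  forall x, complex.Re (f x) ^+ 2 + complex.Im (f x) ^+ 2 <= M ^+ 2.
Proof.
have B (u : 'rV[R]_N -> R) : continuous u -> exists2 M : R, 0 <= M & forall x, box x -> `|u x| <= M.
  move=> cu; have /compact_bounded[M [_ mrt]] :=
    continuous_compact (continuous_subspaceT cu) (@box_compact R N).
  exists (`|M| + 1); first by rewrite addr_ge0.
  move=> x bx; apply: mrt; first by rewrite ltr_pwDr// ler_norm.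
  by exists x.
have [M1 M10 H1] := B _ (@tRe_continuous _ _ f).
have [M2 M20 H2] := B _ (@tIm_continuous _ _ f).
exists (M1 + M2); first by rewrite addr_ge0.
move=> x; have [y [yb ->]] := box_reduce x.
have := H1 _ yb; have := H2 _ yb.
move: (complex.Re _) (complex.Im _) => a b; rewrite !ler_norml => /andP[b1 b2] /andP[a1 a2]; nra.
Qed.

End torus_integration.

Notation normc := ComplexField.Normc.normc.

(** * Energy norms and completeness *)

(** The real part makes the pairing symmetric and real bilinear, so energy identities stay real
    equations. Complex scalars move across it by conjugation ([ripZ]). *)
HB.lock Definition rip {R : realType} {N : nat} (f g : torus_fun R N) : R :=
  RI (f * tconj g).

HB.lock Definition n2 {R : realType} {N : nat} (f : torus_fun R N) : R :=
  Num.sqrt (rip f f).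

Section inner_product.
Context {R : realType} {N : nat}.
Notation T := (torus_fun R N).
Implicit Types (a f g h : T) (c : R[i]).

Lemma ripE f g : rip f g = RI (f * tconj g). Proof. by rewrite rip.unlock. Qed.
Lemma n2E f : n2 f = Num.sqrt (rip f f). Proof. by rewrite n2.unlock. Qed.

Lemma ripC f g : rip f g = rip g f.
Proof. by rewrite !ripE -RI_conj tconjM tconjK mulrC. Qed.
Lemma ripDl f g h : rip (f + g) h = rip f h + rip g h.
Proof. by rewrite !ripE mulrDl RID. Qed.
Lemma ripDr f g h : rip f (g + h) = rip f g + rip f h.
Proof. by rewrite ripC ripDl !(ripC f). Qed.
Lemma ripNl f g : rip (- f) g = - rip f g.
Proof. by rewrite !ripE mulNr RIN. Qed.
Lemma ripNr f g : rip f (- g) = - rip f g.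
Proof. by rewrite ripC ripNl ripC. Qed.
Lemma ripBl f g h : rip (f - g) h = rip f h - rip g h.
Proof. by rewrite ripDl ripNl. Qed.
Lemma ripBr f g h : rip f (g - h) = rip f g - rip f h.
Proof. by rewrite ripDr ripNr. Qed.
Lemma rip0l f : rip 0 f = 0. Proof. by rewrite !ripE mul0r RI0. Qed.
Lemma rip0r f : rip f 0 = 0. Proof. by rewrite ripC rip0l. Qed.
Lemma ripZrl (r : R) f g : rip (r%:C *: f) g = r * rip f g.
Proof. by rewrite !ripE -tscalerAl RIZ. Qed.
Lemma ripZrr (r : R) f g : rip f (r%:C *: g) = r * rip f g.
Proof. by rewrite ripC ripZrl ripC. Qed.
Lemma ripZ c f g : rip (c *: f) g = rip f (conjc c *: g).
Proof. by rewrite !ripE tconjZ conjcK -tscalerAl -tscalerAr. Qed.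
Lemma ripM a f g : rip (a * f) g = rip f (tconj a * g).
Proof. by rewrite !ripE tconjM tconjK; congr RI; ring. Qed.
Lemma rip_suml I (r : seq I) (P : pred I) (F : I -> T) g :
  rip (\sum_(k <- r | P k) F k) g = \sum_(k <- r | P k) rip (F k) g.
Proof. by rewrite (big_morph (rip^~ g) (fun x y => ripDl x y g) (rip0l g)). Qed.
Lemma rip_sumr I (r : seq I) (P : pred I) (F : I -> T) g :
  rip g (\sum_(k <- r | P k) F k) = \sum_(k <- r | P k) rip g (F k).
Proof. by rewrite ripC rip_suml; apply: eq_bigr => i _; rewrite ripC. Qed.

Lemma rip_partial i f g : rip (pd i f) g = - rip f (pd i g).
Proof.
apply/eqP; rewrite -addr_eq0 !ripE -RID -pd_conj -pdM.
by rewrite RI_partial.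
Qed.

Lemma mul_conjE (z : R[i]) : z * conjc z = (complex.Re z ^+ 2 + complex.Im z ^+ 2)%:C.
Proof. by case: z => x y; apply/eqP; rewrite eq_complex/=; apply/andP; split; apply/eqP; ring. Qed.

Lemma rip_ge0 f : 0 <= rip f f.
Proof.
rewrite ripE -[leLHS](@RI0 R N); apply: RI_le => x.
by rewrite tfunM tconjE mul_conjE/= addr_ge0// sqr_ge0.
Qed.

Lemma rip_mul_le f a (M : R) :
  (forall x, complex.Re (a x) ^+ 2 + complex.Im (a x) ^+ 2 <= M ^+ 2) ->
  rip (a * f) (a * f) <= M ^+ 2 * rip f f.
Proof.
move=> aM; rewrite !ripE -RIZ; apply: RI_le => x.
rewrite tfunZ !tfunM !tconjE tfunM rmorphM.
have -> : a x * f x * (conjc (a x) * conjc (f x)) = (a x * conjc (a x)) * (f x * conjc (f x)) by ring.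
rewrite !mul_conjE -!rmorphM/= ler_wpM2r//.
by rewrite addr_ge0// sqr_ge0.
Qed.

Lemma rip_sqr_le f g : rip f g ^+ 2 <= rip f f * rip g g.
Proof.
have H t : 0 <= rip f f - 2 * t * rip f g + t ^+ 2 * rip g g.
  have := rip_ge0 (f - t%:C *: g).
  by rewrite ripBl !ripBr !ripZrl !ripZrr (ripC g f); congr (_ <= _); ring.
have g0 := rip_ge0 g; have [gz|gn] := eqVneq (rip g g) 0.
  rewrite gz mulr0; have [->|fg] := eqVneq (rip f g) 0; first by rewrite expr0n.
  (* When [rip g g = 0] the quadratic in [t] is affine, and this [t] gives it the value -1.
     Definiteness of [rip] cannot be used here: it is obtained later, from the sup bounds. *)
  have := H ((rip f f + 1) / (2 * rip f g)).
  rewrite gz mulr0 addr0.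
  have -> : 2 * ((rip f f + 1) / (2 * rip f g)) * rip f g = rip f f + 1 by field.
  by rewrite opprD addrA subrr sub0r lerNr oppr0 ler10.
have gp : 0 < rip g g by rewrite lt_neqAle eq_sym gn.
have := H (rip f g / rip g g).
have -> : rip f f - 2 * (rip f g / rip g g) * rip f g + (rip f g / rip g g) ^+ 2 * rip g g
  = rip f f - rip f g ^+ 2 / rip g g by field.
by rewrite subr_ge0 ler_pdivrMr.
Qed.

Lemma n2_ge0 f : 0 <= n2 f. Proof. by rewrite n2E sqrtr_ge0. Qed.
Lemma n2_sqr f : n2 f ^+ 2 = rip f f. Proof. by rewrite n2E sqr_sqrtr// rip_ge0. Qed.
Lemma n20 : n2 (0 : T) = 0. Proof. by rewrite !n2E rip0l sqrtr0. Qed.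

Lemma rip_norm_le f g : `|rip f g| <= n2 f * n2 g.
Proof.
rewrite -(@ler_pXn2r _ 2)// ?nnegrE ?mulr_ge0 ?n2_ge0//.
rewrite exprMn !n2_sqr -normrX ger0_norm; first exact: rip_sqr_le.
exact: sqr_ge0.
Qed.

Lemma rip_le f g : rip f g <= n2 f * n2 g.
Proof. exact: le_trans (ler_norm _) (rip_norm_le f g). Qed.

Lemma ripN_le f g : - rip f g <= n2 f * n2 g.
Proof. by rewrite -ripNl; apply: le_trans (rip_le _ _) _; rewrite !n2E ripNl ripNr opprK. Qed.

Lemma n2D f g : n2 (f + g) <= n2 f + n2 g.
Proof.
rewrite -(@ler_pXn2r _ 2)// ?nnegrE ?addr_ge0 ?n2_ge0//.
rewrite n2_sqr ripDl !ripDr (ripC g f) sqrrD !n2_sqr.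
have := rip_le f g; lra.
Qed.

Lemma n2Z c f : n2 (c *: f) = normc c * n2 f.
Proof.
rewrite !n2E ripZ scalerA mulrC mul_conjE ripZrr sqrtrM ?addr_ge0 ?sqr_ge0//.
by case: c.
Qed.

Lemma normc_real (r : R) : normc r%:C = `|r|.
Proof. by rewrite /= expr0n addr0 sqrtr_sqr. Qed.

Lemma normc_ge0 c : 0 <= normc c. Proof. by case: c => a b; exact: sqrtr_ge0. Qed.

Lemma n2N f : n2 (- f) = n2 f. Proof. by rewrite !n2E ripNl ripNr opprK. Qed.
Lemma n2B f g : n2 (f - g) <= n2 f + n2 g.
Proof. by rewrite (le_trans (n2D _ _))// n2N. Qed.
Lemma n2_distC f g : n2 (f - g) = n2 (g - f).
Proof. by rewrite -n2N opprB. Qed.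

Lemma n2M_bounded a : exists2 M : R, 0 <= M & forall f, n2 (a * f) <= M * n2 f.
Proof.
have [M M0 aM] := tfun_bounded a; exists M => // f.
rewrite -(@ler_pXn2r _ 2)// ?nnegrE ?mulr_ge0 ?n2_ge0//.
by rewrite exprMn !n2_sqr; exact: rip_mul_le.
Qed.

Lemma n2_conj f : n2 (tconj f) = n2 f.
Proof. by rewrite !n2E !ripE tconjK mulrC. Qed.

Section iterated_norm.
Context {d : nat} (Y : 'I_d -> T -> T).

(** The operators are a parameter because two families occur: the coordinate derivatives, giving
    [nrm], and the frame made of the [X_j] and [Dx], for which the eigenfunctions of the commuting
    case are diagonal. *)
Fixpoint gn (k : nat) f : R :=
  if k is k'.+1 then gn k' f + \sum_i gn k' (Y i f) else n2 f.

Lemma gnS k f : gn k.+1 f = gn k f + \sum_i gn k (Y i f). Proof. by []. Qed.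

Lemma gn_ge0 k f : 0 <= gn k f.
Proof.
elim: k f => [|k IH] f; first exact: n2_ge0.
by rewrite gnS addr_ge0// sumr_ge0.
Qed.

Lemma gn_leS k f : gn k f <= gn k.+1 f.
Proof. by rewrite gnS lerDl sumr_ge0// => i _; exact: gn_ge0. Qed.

Lemma gn_le k m f : (k <= m)%N -> gn k f <= gn m f.
Proof.
elim: m => [|m IH]; first by rewrite leqn0 => /eqP->.
rewrite leq_eqVlt => /predU1P[->//|km].
by rewrite (le_trans _ (gn_leS _ _))// IH.
Qed.

Lemma n2_le_gn k f : n2 f <= gn k f. Proof. exact: (@gn_le 0). Qed.

Lemma gn_Y k i f : gn k (Y i f) <= gn k.+1 f.
Proof.
rewrite gnS (bigD1 i)//= addrCA lerDl addr_ge0 ?gn_ge0// sumr_ge0// => j _.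
exact: gn_ge0.
Qed.

Hypothesis YD : forall i, {morph Y i : f g / f + g}.

Lemma gnD k f g : gn k (f + g) <= gn k f + gn k g.
Proof.
elim: k f g => [|k IH] f g; first exact: n2D.
rewrite !gnS addrACA lerD// -big_split/= ler_sum// => i _.
by rewrite YD.
Qed.

Hypothesis YZ : forall i c, {morph Y i : f / c *: f}.

Lemma gnZ k c f : gn k (c *: f) = normc c * gn k f.
Proof.
elim: k f => [|k IH] f; first exact: n2Z.
rewrite !gnS mulrDr IH mulr_sumr; congr (_ + _); apply: eq_bigr => i _.
by rewrite YZ.
Qed.

Lemma gnN k f : gn k (- f) = gn k f.
Proof. by rewrite -scaleN1r gnZ -(rmorphN1 (real_complex R)) normc_real normrN1 mul1r. Qed.

Lemma gnB k f g : gn k (f - g) <= gn k f + gn k g.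
Proof. by rewrite (le_trans (gnD _ _ _))// gnN. Qed.

Lemma gn0 k : gn k 0 = 0.
Proof. by rewrite -(scale0r (0 : T)) gnZ -(rmorph0 (real_complex R)) normc_real normr0 mul0r. Qed.

Lemma gn_sum k I (r : seq I) (P : pred I) (F : I -> T) :
  gn k (\sum_(j <- r | P j) F j) <= \sum_(j <- r | P j) gn k (F j).
Proof.
elim/big_rec2: _ => [|j y x _ IH]; first by rewrite gn0.
by rewrite (le_trans (gnD _ _ _))// lerD2l.
Qed.

Hypothesis YM : forall i f g, Y i (f * g) = Y i f * g + f * Y i g.

Lemma gnM_bounded k a : exists2 C : R, 0 <= C & forall f, gn k (a * f) <= C * gn k f.
Proof.
elim: k a => [|k IH] a; first exact: n2M_bounded.
have [C0 C00 H0] := IH a.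
have /choice[C1 H1] : forall i, exists C : R, 0 <= C /\ forall f, gn k (Y i a * f) <= C * gn k f.
  by move=> i; have [C ? ?] := IH (Y i a); exists C.
exists (C0 + \sum_i C1 i).
  by rewrite addr_ge0// sumr_ge0// => i _; have [] := H1 i.
move=> f; rewrite gnS.
have S0 : 0 <= \sum_i C1 i by rewrite sumr_ge0// => i _; have [] := H1 i.
apply: (@le_trans _ _ (C0 * gn k f + \sum_i (C1 i * gn k f + C0 * gn k (Y i f)))).
  rewrite lerD// ler_sum// => i _; rewrite YM (le_trans (gnD _ _ _))// lerD//.
  by have [_] := H1 i.
rewrite big_split/= -mulr_suml -mulr_sumr addrCA -mulrDr.
rewrite [leRHS]mulrDl addrC lerD2l ler_wpM2l// lerDl sumr_ge0// => i _.
exact: gn_ge0.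
Qed.

End iterated_norm.

Definition nrm := gn (@pd R N).

Lemma nrmD k f g : nrm k (f + g) <= nrm k f + nrm k g.
Proof. by apply: gnD => i u v; rewrite pdD. Qed.
Lemma nrmZ k c f : nrm k (c *: f) = normc c * nrm k f.
Proof. by apply: gnZ => i r u; rewrite pdZ. Qed.
Lemma nrmN k f : nrm k (- f) = nrm k f.
Proof. by apply: gnN => i r u; rewrite pdZ. Qed.
Lemma nrmB k f g : nrm k (f - g) <= nrm k f + nrm k g.
Proof. by rewrite (le_trans (nrmD _ _ _))// nrmN. Qed.
Lemma nrm_distC k f g : nrm k (f - g) = nrm k (g - f).
Proof. by rewrite -nrmN opprB. Qed.
Lemma nrm0 k : nrm k 0 = 0.
Proof. by apply: gn0 => i r u; rewrite pdZ. Qed.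
Lemma nrm_sum k I (r : seq I) (P : pred I) (F : I -> T) :
  nrm k (\sum_(j <- r | P j) F j) <= \sum_(j <- r | P j) nrm k (F j).
Proof.
apply: gn_sum; first by move=> i u v; rewrite pdD.
by move=> i c u; rewrite pdZ.
Qed.
Lemma nrm_ge0 k f : 0 <= nrm k f. Proof. exact: gn_ge0. Qed.
Lemma nrm_le k m f : (k <= m)%N -> nrm k f <= nrm m f. Proof. exact: gn_le. Qed.
Lemma n2_le_nrm k f : n2 f <= nrm k f. Proof. exact: n2_le_gn. Qed.
Lemma nrm_partial k i f : nrm k (pd i f) <= nrm k.+1 f. Proof. exact: gn_Y. Qed.
Lemma nrmM_bounded k a : exists2 C : R, 0 <= C & forall f, nrm k (a * f) <= C * nrm k f.
Proof.
apply: gnM_bounded; first by move=> i u v; rewrite pdD.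
by move=> i u v; rewrite pdM.
Qed.
Lemma nrmS k f : nrm k.+1 f = nrm k f + \sum_i nrm k (pd i f). Proof. by []. Qed.
Lemma nrm0E f : nrm 0 f = n2 f. Proof. by []. Qed.

(* Loss of finitely many derivatives. *)
Definition tame (A : T -> T) := forall k, exists m (C : R), 0 <= C /\
  forall f, nrm k (A f) <= C * nrm m f.

Lemma tame_id : tame id.
Proof. by move=> k; exists k, 1; split => // f; rewrite mul1r. Qed.

Lemma tame_partial i : tame (pd i).
Proof. by move=> k; exists k.+1, 1; split => // f; rewrite mul1r nrm_partial. Qed.

Lemma tame_mul a : tame ( *%R a).
Proof. by move=> k; have [C C0 H] := nrmM_bounded k a; exists k, C. Qed.

Lemma tame_comp A B : tame A -> tame B -> tame (fun f => A (B f)).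
Proof.
move=> tA tB k; have [m [C [C0 H]]] := tA k; have [m' [C' [C'0 H']]] := tB m.
exists m', (C * C'); split=> [|f]; first by rewrite mulr_ge0.
by rewrite (le_trans (H _))// -mulrA ler_wpM2l.
Qed.

Lemma tame_add A B : tame A -> tame B -> tame (fun f => A f + B f).
Proof.
move=> tA tB k; have [m [C [C0 H]]] := tA k; have [m' [C' [C'0 H']]] := tB k.
exists (maxn m m'), (C + C'); split=> [|f]; first by rewrite addr_ge0.
rewrite (le_trans (nrmD _ _ _))// mulrDl lerD//.
  by rewrite (le_trans (H _))// ler_wpM2l// nrm_le// leq_maxl.
by rewrite (le_trans (H' _))// ler_wpM2l// nrm_le// leq_maxr.
Qed.

Lemma tame_opp A : tame A -> tame (fun f => - A f).
Proof. by move=> tA k; have [m [C [C0 H]]] := tA k; exists m, C; split => // f; rewrite nrmN. Qed.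

Lemma tame_sub A B : tame A -> tame B -> tame (fun f => A f - B f).
Proof. by move=> tA tB; apply: tame_add => //; exact: tame_opp. Qed.

Lemma tame_sum I (r : seq I) (P : pred I) (A : I -> T -> T) :
  (forall i, P i -> tame (A i)) -> tame (fun f => \sum_(i <- r | P i) A i f).
Proof.
move=> tA; elim: r => [|i r IH].
  move=> k; exists k, 0; split => // f; rewrite big_nil mul0r nrm0//.
have [Pi|Pi] := boolP (P i); last first.
  by move=> k; have [m [C [C0 H]]] := IH k; exists m, C; split => // f; rewrite big_cons (negbTE Pi).
have := tame_add (tA i Pi) IH => tt k.
by have [m [C [C0 H]]] := tt k; exists m, C; split => // f; rewrite big_cons Pi.
Qed.

End inner_product.

(** * Sobolev embedding, uniform limits and completeness *)

Section sobolev_embedding.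
Context {R : realType}.
Notation mu := (@lebesgue_measure R).

Lemma increment_le (g dg : R -> R) (s t : R) : continuous dg ->
  (forall x : R, is_derive x 1 g (dg x)) ->
  `[0, 2 * pi]%classic s -> `[0, 2 * pi]%classic t ->
  `|g s - g t| <= circle_int (fun x => `|dg x|).
Proof.
move=> cdg Hg; wlog ts : s t / t < s => [H sI tI|].
  have [->|/lt_total/orP[st|st]] := eqVneq s t.
  - by rewrite subrr normr0 circle_int_ge0.
  - by rewrite distrC H.
  - by rewrite H.
rewrite /= !in_itv/= => /andP[s0 s1] /andP[t0 t1].
have cg : continuous g.
  by move=> x; apply: differentiable_continuous; apply/derivable1_diffP; case: (Hg x).
have E : \int[mu]_(x in `[t, s]) dg x = g s - g t.
  rewrite /Rintegral (@continuous_FTC2 _ dg g)//.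
  - exact: continuous_subspaceT.
  - split; first by move=> x _; case: (Hg x).
    + exact: (cvg_at_right_filter (cg t)).
    + exact: (cvg_at_left_filter (cg _)).
  - by move=> x _; rewrite derive1E; exact: derive_val.
have ca : continuous (fun x => `|dg x|).
  by move=> x; apply: (continuous_comp (cdg x)); exact: norm_continuous.
have I1 A : compact A -> mu.-integrable A (EFin \o dg).
  by move=> cA; apply: continuous_compact_integrable => //; exact: continuous_subspaceT.
have I2 A : compact A -> mu.-integrable A (EFin \o (fun x => `|dg x|)).
  by move=> cA; apply: continuous_compact_integrable => //; exact: continuous_subspaceT.
rewrite -E (le_trans (le_normr_Rintegral _ _))//; first exact/I1/segment_compact.
rewrite /circle_int /Rintegral fine_le//.
- by apply: integrable_fin_num => //; exact/I2/segment_compact.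
- by apply: integrable_fin_num => //; exact/I2/segment_compact.
- apply: ge0_subset_integral => //.
  + exact: (measurable_int mu (I2 _ (@segment_compact _ 0 (2 * pi)))).
  + by apply: subset_itv; rewrite bnd_simp.
Qed.

(** Averaging [|g s| <= |g t| + int |dg|] over [t] divides the integral of [|g|] by [2 pi >= 1].
    Dropping this factor leaves a single integral of a sum, a form that iterates over the
    variables. *)
Lemma circle_sup_le (g dg : R -> R) (s : R) : continuous dg ->
  (forall x : R, is_derive x 1 g (dg x)) -> `[0, 2 * pi]%classic s ->
  `|g s| <= circle_int (fun x => `|g x| + `|dg x|).
Proof.
move=> cdg Hg sI.
have cg : continuous g.
  by move=> x; apply: differentiable_continuous; apply/derivable1_diffP; case: (Hg x).
have cn (u : R -> R) : continuous u -> continuous (fun x => `|u x|).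
  by move=> cu x; apply: (continuous_comp (cu x)); exact: norm_continuous.
set I := circle_int (fun x => `|dg x|).
have I0 : 0 <= I by apply: circle_int_ge0.
have J0 : 0 <= circle_int (fun x => `|g x|) by apply: circle_int_ge0.
have H : circle_int (fun=> `|g s|) <= circle_int (fun x => `|g x| + I).
  apply: circle_int_le => //; first exact: cst_continuous.
    by move=> x; apply: cvgD; [exact: cn|exact: cvg_cst].
  move=> t tI; rewrite -lerBlDl.
  by apply: le_trans (increment_le cdg Hg sI tI); exact: lerB_dist.
rewrite (bfunD circle_int_bounded) in H; [|exact: cn|exact: cst_continuous].
rewrite !circle_int_cst in H.
rewrite (bfunD circle_int_bounded) -/I; [|exact: cn..].
have p1 : 1 <= 2 * pi :> R.
  by have := @pi_ge2 R; lra.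
have p0 := @twopi_gt0 R.
apply: (@le_trans _ _ (circle_int (fun x => `|g x|) / (2 * pi) + I)).
  by rewrite -(ler_pM2r p0) [leRHS]mulrDl divfK// gt_eqF.
by rewrite lerD2r ler_pdivrMr// ler_peMr.
Qed.

Definition pword N (w : seq 'I_N) (u : 'rV[R]_N -> R) := foldr partial u w.

Lemma smooth_pword N (w : seq 'I_N) (u : 'rV[R]_N -> R) : smooth u -> smooth (pword w u).
Proof. by move=> su; elim: w => [//|i w IH] /=; exact: smooth_partial. Qed.

Lemma smooth_continuous N (u : 'rV[R]_N -> R) : smooth u -> continuous u.
Proof. by move=> su; exact: (class_C_continuous (su 0%N)). Qed.

Lemma pword_slice N (w : seq 'I_N) (u : 'rV[R]_(1 + N) -> R) s :
  pword w (fun y => u (cons_rV s y)) =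
  (fun y => pword (map (@rshift 1 N) w) u (cons_rV s y)).
Proof. by elim: w => [//|i w IH] /=; rewrite IH slice_partial. Qed.

Lemma smooth_slice N (u : 'rV[R]_(1 + N) -> R) s :
  smooth u -> smooth (fun y => u (cons_rV s y)).
Proof.
move=> su k; elim: k u su => [|k IH] u su.
  by split => //; apply: slice_continuous; exact: smooth_continuous.
split=> [|i]; first by apply: slice_continuous; exact: smooth_continuous.
split; first by move=> y; apply: slice_derivable; exact: smooth_derivable.
by rewrite slice_partial; apply: IH; exact: smooth_partial.
Qed.

Lemma continuous_sectionl (S T U : topologicalType) (g : S -> T -> U) (y : T) :
  continuous (fun p : S * T => g p.1 p.2) -> continuous (g^~ y).
Proof.
move=> cg s; apply: (continuous_comp (f := fun s => (s, y)) (g := fun p => g p.1 p.2)).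
  by apply: cvg_pair => //=; exact: cvg_cst.
exact: cg.
Qed.

Lemma sum_continuous (S : topologicalType) I (r : seq I) (F : I -> S -> R) :
  (forall i, continuous (F i)) -> continuous (fun x => \sum_(i <- r) F i x).
Proof.
move=> cF x; elim: r => [|i r IH].
  by under eq_fun do rewrite big_nil; exact: cvg_cst.
by under eq_fun do rewrite big_cons; apply: cvgD; [exact: cF|exact: IH].
Qed.

Lemma abs_continuous (S : topologicalType) (u : S -> R) :
  continuous u -> continuous (fun x => `|u x|).
Proof. by move=> cu x; apply: (continuous_comp (cu x)); exact: norm_continuous. Qed.

(* In one variable |u s| <= int |u| / (2 pi) + int |u'|; iterate over the variables. *)
Lemma sobolev_words N : exists W : seq (seq 'I_N), forall u, smooth u ->
  forall x, box x -> `|u x| <= torus_Rint (fun y => \sum_(w <- W) `|pword w u y|).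
Proof.
elim: N => [|N [W HW]].
  exists [:: [::]] => u _ x _ /=; rewrite big_seq1 /=.
  by rewrite (_ : x = 0)//; apply/rowP => -[].
pose W0 := map (map (@rshift 1 N)) W : seq (seq 'I_(1 + N)).
(* [W0] differentiates in the other variables only. Since [pword] is a right fold, [rcons] puts the
   derivative in the first variable innermost, so that it is taken before slicing. *)
exists (W0 ++ map (rcons^~ (lshift N ord0)) W0) => u su x xb.
pose s := x 0 (lshift N ord0 : 'I_(1 + N)).
pose y := \row_j x 0 (rshift 1 j : 'I_(1 + N)).
have xE : x = cons_rV s y.
  apply/rowP => j; case: (split_ordP (j : 'I_(1 + N))) => l ->.
    by rewrite cons_rV_l ord1.
  by rewrite cons_rV_r mxE.
have sI : `[0, 2 * pi]%classic s by exact: xb.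
have yb : box y by move=> j; rewrite mxE; exact: xb.
pose u' : 'rV[R]_(1 + N) -> R := u.
have su0 : smooth (partial (lshift N ord0) u') by exact: smooth_partial.
have c1 : continuous (fun t => partial (lshift N ord0) u' (cons_rV t y)).
  move=> t; apply: (continuous_comp (f := fun t => cons_rV t y)).
    exact: (continuous_sectionl (g := @cons_rV R N) (@cons_rV_continuous R N)).
  exact: smooth_continuous.
have c0 : continuous (fun t => u' (cons_rV t y)).
  move=> t; apply: (continuous_comp (f := fun t => cons_rV t y)).
    exact: (continuous_sectionl (g := @cons_rV R N) (@cons_rV_continuous R N)).
  exact: smooth_continuous.
have d0 (t : R) : is_derive t 1 (fun t => u' (cons_rV t y)) (partial (lshift N ord0) u' (cons_rV t y)).
  by apply: slice_is_derive => z; exact: smooth_derivable.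
rewrite xE; apply: le_trans (circle_sup_le c1 d0 sI) _.
rewrite torus_RintS; apply: circle_int_le.
- by move=> t; apply: cvgD; [exact: (abs_continuous c0)|exact: (abs_continuous c1)].
- apply: (@torus_Rint_slice_continuous R N (fun y => \sum_(w <- _) `|pword w u y|)).
  apply: sum_continuous => w.
  by apply: abs_continuous; apply: smooth_continuous; exact: smooth_pword.
- move=> t tI.
  apply: (@le_trans _ _ (torus_Rint (fun z => \sum_(w <- W) `|pword w (fun z => u' (cons_rV t z)) z|)
    + torus_Rint (fun z => \sum_(w <- W) `|pword w (fun z => partial (lshift N ord0) u' (cons_rV t z)) z|))).
    by rewrite lerD// HW//; exact: smooth_slice.
  rewrite -torus_RintD; last 2 first.
  - apply: sum_continuous => w; apply: abs_continuous; apply: smooth_continuous.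
    by apply: smooth_pword; exact: smooth_slice.
  - apply: sum_continuous => w; apply: abs_continuous; apply: smooth_continuous.
    by apply: smooth_pword; exact: smooth_slice.
  rewrite le_eqVlt; apply/orP; left; apply/eqP; congr torus_Rint; apply/funext => z.
  rewrite big_cat/= /W0 !big_map; congr (_ + _); apply: eq_bigr => w _.
    by rewrite pword_slice.
  by rewrite pword_slice /pword foldr_rcons.
Qed.

End sobolev_embedding.

Section uniform_limits.
Context {R : realType}.

Definition ulim S (phi_ : nat -> S -> R) (phi : S -> R) :=
  forall e : R, 0 < e -> \forall p \near \oo, forall x, `|phi_ p x - phi x| <= e.

Lemma uniform_cauchy_ulim S (phi_ : nat -> S -> R) :
  (forall e : R, 0 < e -> exists M, forall p q, (M <= p)%N -> (M <= q)%N ->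
     forall x, `|phi_ p x - phi_ q x| <= e) ->
  exists phi, ulim phi_ phi.
Proof.
move=> H.
have C x : cvg (phi_ p x @[p --> \oo]).
  apply/cauchy_cvgP/cauchy_ballP => e e0.
  have [M HM] := H (e / 2) ltac:(by rewrite divr_gt0).
  pose B : set R := [set phi_ p x | p in [set p | (M <= p)%N]].
  exists (B, B); first by split; exists M => // p Mp; exists p.
  move=> [_ _] [/= [p Mp <-] [q Mq <-]]; rewrite /ball/=.
  by rewrite (le_lt_trans (HM p q Mp Mq x))// ltr_pdivrMr// ltr_pMr// ltr1n.
exists (fun x => lim (phi_ p x @[p --> \oo])) => e e0.
have [M HM] := H (e / 2) ltac:(by rewrite divr_gt0).
exists M => // p /= Mp x.
have e2 : 0 < e / 2 by rewrite divr_gt0.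
have /cvgrPdist_lt/(_ _ e2)[M' _ HM'] := C x.
pose q := maxn M M'.
have -> : phi_ p x - lim (phi_ p x @[p --> \oo]) =
  (phi_ p x - phi_ q x) - (lim (phi_ p x @[p --> \oo]) - phi_ q x) by ring.
rewrite (splitr e) (le_trans (ler_normB _ _))// lerD//.
  by rewrite HM// leq_maxl.
by rewrite ltW// HM'//= leq_maxr.
Qed.

Lemma ulim_continuous (S : topologicalType) (phi_ : nat -> S -> R) phi :
  (forall p, continuous (phi_ p)) -> ulim phi_ phi -> continuous phi.
Proof.
move=> c H x; apply/cvgrPdist_le => e e0.
have e3 : 0 < e / 3 by rewrite divr_gt0.
have [M _ /(_ M (leqnn M)) HM] := H _ e3.
have /cvgrPdist_le/(_ _ e3) := c M x; apply: filterS => y Hy.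
have -> : phi x - phi y = (phi_ M x - phi_ M y) - (phi_ M x - phi x) + (phi_ M y - phi y) by ring.
have -> : e = e / 3 + e / 3 + e / 3 by field.
rewrite (le_trans (ler_normD _ _))// lerD// (le_trans (ler_normB _ _))// lerD//.
Qed.

Lemma ulim_eq S (phi_ psi_ : nat -> S -> R) phi psi x y :
  ulim phi_ phi -> ulim psi_ psi -> (forall p, phi_ p x = psi_ p y) -> phi x = psi y.
Proof.
move=> H1 H2 E; apply/eqP; rewrite -subr_eq0 -normr_le0; apply/ler_addgt0Pl => e e0.
rewrite addr0; have e2 : 0 < e / 2 by rewrite divr_gt0.
have [M1 _ /(_ (maxn M1 _) (leq_maxl _ _)) HM1] := H1 _ e2.
have [M2 _ /(_ (maxn M1 M2) (leq_maxr _ _)) HM2] := H2 _ e2.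
have := HM1 M2 x => {HM1} h1; have h2 := HM2 y.
have -> : phi x - psi y = (psi_ (maxn M1 M2) y - psi y) - (phi_ (maxn M1 M2) x - phi x).
  by rewrite E; ring.
by rewrite (splitr e) (le_trans (ler_normB _ _))// lerD.
Qed.

(** The linear approximation error of [phi_ q] over a step [h] is bounded through the oscillation of
    [psi_ q], hence of [psi], with a range of [h] independent of [q]; letting [q] grow with [h]
    fixed transfers the bound to [phi]. *)
Lemma ulim_partial N (phi_ psi_ : nat -> 'rV[R]_N -> R) phi psi (i : 'I_N) x :
  (forall p x, derivable (phi_ p) x (delta_mx 0 i)) ->
  (forall p, partial i (phi_ p) = psi_ p) ->
  continuous psi -> ulim phi_ phi -> ulim psi_ psi ->
  derivable phi x (delta_mx 0 i) /\ partial i phi x = psi x.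
Proof.
move=> dphi Epsi cpsi Hphi Hpsi; set v := delta_mx 0 i.
suff H : h^-1 *: ((phi \o shift x) (h *: v) - phi x) @[h --> 0^'] --> psi x.
  by split; [apply/cvg_ex; eexists; exact: H|exact: cvg_lim H].
apply/cvgrPdist_le => e e0.
have e4 : 0 < e / 4 by rewrite divr_gt0.
have : \forall s \near (0 : R), `|psi x - psi (x + s *: v)| <= e / 4.
  have : {for 0, continuous (fun s : R => psi (x + s *: v))}.
    apply: continuous_comp; last exact: cpsi.
    by apply: cvgD; [exact: cvg_cst|apply: cvgZr_tmp; exact: cvg_id].
  by move=> /cvgrPdist_le/(_ _ e4); rewrite scale0r addr0.
move=> /nbhs_ballP[d /= d0 Hd].
near=> h.
have hn0 : h != 0 by near: h; exact: nbhs_dnbhs_neq.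
have hd : `|h| < d by near: h; exact: dnbhs0_lt.
rewrite /= /GRing.scale/= -/(GRing.scale h v) distrC.
rewrite [h *: v + x]addrC.
have -> : h^-1 * (phi (x + h *: v) - phi x) - psi x =
  h^-1 * (phi (x + h *: v) - phi x - h * psi x) by field.
rewrite normrM normfV ler_pdivrMl ?normr_gt0//.
(* The slack [eta] pays for replacing [phi], [psi] by [phi_ q], [psi_ q] at fixed [h]: two values of
   [phi] and [h] times one of [psi], whence the factor [3 * (1 + |h|)]. *)
apply/ler_addgt0Pl => eta eta0.
have eta3 : 0 < eta / (3 * (1 + `|h|)) by rewrite divr_gt0// mulr_gt0// ltr_pwDl.
near \oo => q.
have P1 y : `|phi_ q y - phi y| <= eta / (3 * (1 + `|h|)).
  by move: y; near: q; exact: Hphi.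
have P2 y : `|psi_ q y - psi y| <= eta / (3 * (1 + `|h|)).
  by move: y; near: q; exact: Hpsi.
have P3 y : `|psi_ q y - psi y| <= e / 4.
  by move: y; near: q; exact: Hpsi.
have Hq : `|phi_ q (x + (0 + h) *: v) - phi_ q (x + 0 *: v) - h * psi_ q (x + 0 *: v)| <= `|h| * (3 * (e / 4)).
  apply: (@derivative_quotient_le R (fun s => phi_ q (x + s *: v)) (fun s => psi_ q (x + s *: v)) 0 h _ d) => // s.
    rewrite -Epsi; exact: is_derive_line.
  rewrite subr0 => sd; have := Hd s; rewrite /ball/= sub0r normrN => /(_ sd) Hs.
  rewrite scale0r addr0.
  have -> : psi_ q (x + s *: v) - psi_ q x = (psi_ q (x + s *: v) - psi (x + s *: v))
    - (psi x - psi (x + s *: v)) - (psi_ q x - psi x) by ring.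
  have -> : 3 * (e / 4) = e / 4 + e / 4 + e / 4 by ring.
  by rewrite (le_trans (ler_normB _ _))// lerD// (le_trans (ler_normB _ _))// lerD.
move: Hq; rewrite add0r scale0r addr0 => Hq.
have -> : phi (x + h *: v) - phi x - h * psi x =
  (phi_ q (x + h *: v) - phi_ q x - h * psi_ q x) +
  (- (phi_ q (x + h *: v) - phi (x + h *: v)) + (phi_ q x - phi x) + h * (psi_ q x - psi x)) by ring.
rewrite addrC (le_trans (ler_normD _ _))// lerD//; last first.
  rewrite (le_trans Hq)// ler_wpM2l// ; lra.
set K := eta / _ in P1 P2 *.
have : `|- (phi_ q (x + h *: v) - phi (x + h *: v)) + (phi_ q x - phi x) + h * (psi_ q x - psi x)| <= K + K + `|h| * K.
  rewrite (le_trans (ler_normD _ _))// lerD//; last by rewrite normrM ler_wpM2l.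
  by rewrite (le_trans (ler_normD _ _))// lerD// normrN.
move=> /le_trans; apply.
have K0 : 0 < K by [].
have -> : eta = 3 * (1 + `|h|) * K by rewrite /K mulrC divfK// mulf_neq0// gt_eqF// ltr_pwDl.
have := normr_ge0 h; nra.
Unshelve. all: by end_near. Qed.

End uniform_limits.

Lemma half_pow_small (R : realType) (B e : R) : 0 <= B -> 0 < e -> exists m : nat, B * 2^-1 ^+ m < e.
Proof.
move=> B0 e0; have Hm := archi_boundP (divr_ge0 B0 (ltW e0)).
exists (Num.bound (B / e)); move: Hm; set m := Num.bound _ => Hm.
have p2 : 0 < 2 ^+ m :> R by rewrite exprn_gt0.
rewrite exprVn ltr_pdivrMr// [e * _]mulrC -ltr_pdivrMr// (lt_le_trans Hm)//.
by rewrite -natrX ler_nat ltnW// ltn_expl.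
Qed.

Section continuity.
Context {R : realType} {S : topologicalType}.
Lemma mulc_continuous (c : R) (u : S -> R) : continuous u -> continuous (fun x => c * u x).
Proof. by move=> cu x; apply: cvgM; [exact: cvg_cst|exact: cu]. Qed.
Lemma addc_continuous (c : R) (u : S -> R) : continuous u -> continuous (fun x => c + u x).
Proof. by move=> cu x; apply: cvgD; [exact: cvg_cst|exact: cu]. Qed.
End continuity.

Section sup_norms.
Context {R : realType} {N : nat}.
Notation T := (torus_fun R N).
Implicit Types (f g : T).

Definition tword (w : seq 'I_N) f : T := foldr (@pd R N) f w.

Lemma tRe_word w f : (fun x => complex.Re (tword w f x)) = pword w (fun x => complex.Re (f x)).
Proof. by elim: w => [//|i w IH] /=; rewrite -IH pd.unlock. Qed.

Lemma twordB w f g : tword w (f - g) = tword w f - tword w g.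
Proof. by elim: w => [//|i w IH] /=; rewrite IH pdB. Qed.

Lemma nrm_word k w f : nrm k (tword w f) <= nrm (size w + k) f.
Proof.
elim: w k => [//|i w IH] k /=.
by rewrite (le_trans (nrm_partial _ _ _))// (le_trans (IH _))// addnS.
Qed.

Definition vol : R := (2 * pi) ^+ N.
Lemma vol_gt0 : 0 < vol. Proof. by rewrite exprn_gt0// twopi_gt0. Qed.

(** The absolute value is not smooth, so Cauchy-Schwarz for [rip] does not apply. Young's inequality
    [|a| <= (d + a^2 / d) / 2] with [d = n2 f] replaces it, and [d] tending to 0 settles the case of
    zero norm. *)
Lemma int_abs_le f : torus_Rint (fun x => `|complex.Re (f x)|) <= (vol + 1) * n2 f.
Proof.
have ca : continuous (fun x => `|complex.Re (f x)|).
  by apply: abs_continuous; exact: tRe_continuous.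
have H (d : R) : 0 < d ->
  torus_Rint (fun x => `|complex.Re (f x)|) <= (d * vol + d^-1 * n2 f ^+ 2) / 2.
  move=> d0; rewrite n2_sqr ripE RIE -torus_Rint_cst.
  have c1 := @tRe_continuous R N (f * tconj f).
  rewrite -torus_RintZ; last exact: tRe_continuous.
  rewrite -torus_RintD; [|exact: cst_continuous|exact: mulc_continuous].
  rewrite mulrC -torus_RintZ; last by apply: addc_continuous; exact: mulc_continuous.
  apply: torus_Rint_le => //.
    by apply: mulc_continuous; apply: addc_continuous; exact: mulc_continuous.
  move=> x; rewrite tfunM tconjE mul_conjE/=.
  move: (complex.Re _) (complex.Im _) => a b.
  have -> : 2^-1 * (d + d^-1 * (a ^+ 2 + b ^+ 2)) = d^-1 * ((d ^+ 2 + a ^+ 2 + b ^+ 2) / 2).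
    by field; rewrite gt_eqF.
  rewrite ler_pdivlMl// ler_pdivlMr//.
  have := sqr_ge0 (d - `|a|); rewrite sqrrB real_normK ?num_real//.
  have := sqr_ge0 b; lra.
have [n0|n0] := eqVneq (n2 f) 0.
  rewrite n0 mulr0; apply/ler_addgt0Pl => e e0; rewrite addr0.
  have e1 : 0 < e / vol by rewrite divr_gt0// vol_gt0.
  have := H _ e1; rewrite n0 expr0n mulr0 addr0 divfK ?gt_eqF ?vol_gt0//.
  by move=> /le_trans; apply; rewrite ler_pdivrMr// ler_peMr ?ler1n// ltW.
have np : 0 < n2 f by rewrite lt_neqAle eq_sym n0 n2_ge0.
have := H _ np; have -> : (n2 f)^-1 * n2 f ^+ 2 = n2 f by rewrite expr2 mulKf.
have := vol_gt0; nra.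
Qed.

Lemma sup_le_nrm : exists m (C : R), 0 <= C /\ forall f x,
  `|complex.Re (f x)| <= C * nrm m f /\ `|complex.Im (f x)| <= C * nrm m f.
Proof.
have [W HW] := @sobolev_words R N.
pose m := \max_(w <- W) size w.
pose C : R := \sum_(w <- W) (vol + 1).
have C0 : 0 <= C by apply: sumr_ge0 => w _; rewrite addr_ge0// ltW// vol_gt0.
have H f x : `|complex.Re (f x)| <= C * nrm m f.
  have [y [yb ->]] := box_reduce x.
  apply: le_trans (HW _ (tRe_smooth f) _ yb) _.
  rewrite /C mulr_suml.
  have -> : torus_Rint (fun y0 => \sum_(w <- W) `|pword w (fun x0 => complex.Re (f x0)) y0|)
    = \sum_(w <- W) torus_Rint (fun y => `|complex.Re (tword w f y)|).
    elim: W {HW m C C0} => [|w W IH].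
      by under eq_fun do rewrite big_nil; rewrite big_nil torus_Rint_cst mul0r.
    under eq_fun do rewrite big_cons; rewrite big_cons -IH -tRe_word torus_RintD//.
    - by apply: abs_continuous; exact: tRe_continuous.
    - apply: sum_continuous => w'; apply: abs_continuous; rewrite -tRe_word.
      exact: tRe_continuous.
  rewrite big_seq [leRHS]big_seq; apply: ler_sum => w wW.
  rewrite (le_trans (int_abs_le _))// ler_wpM2l//.
    by rewrite addr_ge0// ltW// vol_gt0.
  rewrite -nrm0E (le_trans (nrm_word _ _ _))// nrm_le// addn0.
  exact: (leq_bigmax_seq _ wW).
exists m, C; split => // f x; split => //.
have := H (- 'i *: f) x.
have -> : complex.Re ((- 'i *: f) x) = complex.Im (f x).
  rewrite tfunZ; case: (f x) => a b /=; ring.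
by rewrite nrmZ /= oppr0 expr0n/= add0r sqrrN expr1n sqrtr1 mul1r.
Qed.

Lemma n2_le_sup f (M : R) : 0 <= M ->
  (forall x, `|complex.Re (f x)| <= M) -> (forall x, `|complex.Im (f x)| <= M) ->
  n2 f <= 2 * (vol + 1) * M.
Proof.
move=> M0 HR HI; rewrite -(@ler_pXn2r _ 2)// ?nnegrE ?n2_ge0//; last first.
  by rewrite !mulr_ge0// addr_ge0// ltW// vol_gt0.
have : rip f f <= (2 * M ^+ 2) * vol.
  rewrite ripE /vol -(@RI1 R N) -RIZ; apply: RI_le => x.
  rewrite tfunM tconjE mul_conjE tfunZ tfun1 mulr1/=.
  have := HR x; have := HI x.
  move: (complex.Re _) (complex.Im _) => a b; rewrite !ler_norml => /andP[? ?] /andP[? ?]; nra.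
rewrite n2_sqr => /le_trans; apply; have := vol_gt0 => v0.
rewrite [leRHS]exprMn mulrAC; apply: ler_wpM2r; first exact: sqr_ge0.
nra.
Qed.

(** Integration by parts bounds the square of [n2 (pd i g)] by [n2 g] times a norm of a second
    derivative, so a zero norm spreads to all derivatives; the Sobolev embedding then forces [f = 0]
    pointwise. *)
Lemma n2_eq0 f : n2 f = 0 -> f = 0.
Proof.
have D i g : n2 g = 0 -> n2 (pd i g) = 0.
  move=> g0; apply/eqP; rewrite -sqrf_eq0 n2_sqr rip_partial oppr_eq0 -normr_le0.
  by rewrite (le_trans (rip_norm_le _ _))// g0 mul0r.
have E k g : n2 g = 0 -> nrm k g = 0.
  elim: k g => [//|k IH] g g0; rewrite nrmS IH// add0r big1// => i _.
  by rewrite IH// D.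
move=> f0; apply: tfun_ext => x.
have [m [C [C0 H]]] := sup_le_nrm.
have [] := H f x; rewrite E// mulr0 !normr_le0 tfun0.
by case: (f x) => a b /= /eqP -> /eqP ->.
Qed.

Lemma rip_eq0 f : rip f f = 0 -> f = 0.
Proof. by rewrite -n2_sqr => /eqP; rewrite sqrf_eq0 => /eqP/n2_eq0. Qed.

Lemma nrm_eq0 k f : nrm k f = 0 -> f = 0.
Proof.
move=> f0; apply: n2_eq0; apply: le_anti; rewrite n2_ge0 andbT.
by rewrite -f0 n2_le_nrm.
Qed.

Definition tcauchy (u : nat -> T) := forall k (e : R), 0 < e ->
  exists M, forall p q, (M <= p)%N -> (M <= q)%N -> nrm k (u p - u q) <= e.

Definition tcvg (u : nat -> T) (v : T) := forall k (e : R), 0 < e ->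
  \forall p \near \oo, nrm k (u p - v) <= e.

(** By the Sobolev embedding every iterated derivative of the sequence is uniformly Cauchy. The
    limits [Gr w], [Gi w], indexed by words, are derivatives of one another by [ulim_partial], so
    the limit of the empty word is smooth. *)
Theorem torus_complete u : tcauchy u -> exists v, tcvg u v.
Proof.
move=> cu; have [m [C [C0 HC]]] := sup_le_nrm.
have cw w (e : R) : 0 < e -> exists M, forall p q, (M <= p)%N -> (M <= q)%N ->
   C * nrm m (tword w (u p) - tword w (u q)) <= e.
  move=> e0; have C1 : 0 < C + 1 by rewrite ltr_pwDr.
  have [M HM] := cu (size w + m)%N _ (divr_gt0 e0 C1).
  exists M => p q Mp Mq; rewrite -twordB.
  apply: (@le_trans _ _ ((C + 1) * nrm (size w + m) (u p - u q))).
    by rewrite ler_pM// ?nrm_ge0 ?lerDl// nrm_word.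
  by rewrite mulrC -ler_pdivlMr// HM.
have ReB (f g : T) x : complex.Re (f x) - complex.Re (g x) = complex.Re ((f - g) x).
  by rewrite tfunB; case: (f x) (g x) => ? ? [].
have ImB (f g : T) x : complex.Im (f x) - complex.Im (g x) = complex.Im ((f - g) x).
  by rewrite tfunB; case: (f x) (g x) => ? ? [].
have /choice[Gr HGr] : forall w, exists phi, ulim (fun p x => complex.Re (tword w (u p) x)) phi.
  move=> w; apply: uniform_cauchy_ulim => e e0; have [M HM] := cw w e e0.
  exists M => p q Mp Mq x; rewrite ReB; have [h _] := HC (tword w (u p) - tword w (u q)) x.
  exact: le_trans h (HM _ _ Mp Mq).
have /choice[Gi HGi] : forall w, exists phi, ulim (fun p x => complex.Im (tword w (u p) x)) phi.
  move=> w; apply: uniform_cauchy_ulim => e e0; have [M HM] := cw w e e0.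
  exists M => p q Mp Mq x; rewrite ImB; have [_ h] := HC (tword w (u p) - tword w (u q)) x.
  exact: le_trans h (HM _ _ Mp Mq).
have cGr w : continuous (Gr w).
  by apply: ulim_continuous (HGr w) => p; exact: tRe_continuous.
have cGi w : continuous (Gi w).
  by apply: ulim_continuous (HGi w) => p; exact: tIm_continuous.
have dGr w i x : derivable (Gr w) x (delta_mx 0 i) /\ partial i (Gr w) x = Gr (i :: w) x.
  exact: (ulim_partial x (fun p y => @tRe_derivable R N (tword w (u p)) i y)
    (fun p => Re_pd i _) (cGr (i :: w)) (HGr w) (HGr (i :: w))).
have dGi w i x : derivable (Gi w) x (delta_mx 0 i) /\ partial i (Gi w) x = Gi (i :: w) x.
  exact: (ulim_partial x (fun p y => @tIm_derivable R N (tword w (u p)) i y)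
    (fun p => Im_pd i _) (cGi (i :: w)) (HGi w) (HGi (i :: w))).
have sG (G : seq 'I_N -> 'rV[R]_N -> R) : (forall w, continuous (G w)) ->
  (forall w i x, derivable (G w) x (delta_mx 0 i) /\ partial i (G w) x = G (i :: w) x) ->
  forall w, smooth (G w).
  move=> cG dG w k; elim: k w => [|k IH] w; first by split.
  split=> // i; split; first by move=> x; have [] := dG w i x.
  have -> : partial i (G w) = G (i :: w) by apply/funext => x; have [] := dG w i x.
  exact: IH.
have vs : (fun x => Gr [::] x +i* Gi [::] x) \in (@torus_smooth R N).
  apply/torus_smoothP; split.
    move=> i x; congr (_ +i* _).
      by apply: (ulim_eq (HGr [::]) (HGr [::])) => p; rewrite /= tperiodic.
    by apply: (ulim_eq (HGi [::]) (HGi [::])) => p; rewrite /= tperiodic.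
  by split => /=; exact: sG.
pose v : T := TorusFun vs.
have wv w x : tword w v x = Gr w x +i* Gi w x.
  elim: w x => [//|i w IH] x; rewrite -[tword (i :: w) v]/(pd i (tword w v)) pdE.
  have -> : (fun y => complex.Re (tword w v y)) = Gr w by apply/funext => y; rewrite IH.
  have -> : (fun y => complex.Im (tword w v y)) = Gi w by apply/funext => y; rewrite IH.
  by have [_ ->] := dGr w i x; have [_ ->] := dGi w i x.
exists v => k.
(* All words are carried along because [nrm k.+1] of a function involves [nrm k] of its
   derivatives. *)
suff H w (e : R) : 0 < e -> \forall p \near \oo, nrm k (tword w (u p - v)) <= e by exact: (H [::]).
elim: k w e => [|k IH] w e e0.
  have V0 : 0 < 2 * (vol + 1) by rewrite mulr_gt0// addr_gt0// vol_gt0.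
  have e1 := divr_gt0 e0 V0.
  have := HGr w _ e1; have := HGi w _ e1.
  apply: filterS2 => p h2 h1; rewrite nrm0E.
  rewrite (le_trans (@n2_le_sup _ (e / (2 * (vol + 1))) _ _ _))//.
  - exact: ltW.
  - by move=> x; have := h1 x; rewrite twordB tfunB wv; case: (tword w (u p) x).
  - by move=> x; have := h2 x; rewrite twordB tfunB wv; case: (tword w (u p) x).
  - by rewrite mulrC divfK// gt_eqF.
have e1 : 0 < e / (N.+1)%:R by rewrite divr_gt0// ltr0n.
have h0 := IH w _ e1.
have : \forall p \near \oo, forall i, nrm k (tword (i :: w) (u p - v)) <= e / (N.+1)%:R.
  by apply: filter_forall => i; exact: IH.
apply: filterS2 h0 => p h0 h1; rewrite nrmS.
apply: (@le_trans _ _ (e / (N.+1)%:R + \sum_(i < N) e / (N.+1)%:R)).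
  by apply: lerD; [exact: h0|apply: ler_sum => i _; exact: h1].
by rewrite sumr_const card_ord -mulrS -[leLHS]mulr_natr divfK// pnatr_eq0.
Qed.

Lemma tcvg_unique u v w : tcvg u v -> tcvg u w -> v = w.
Proof.
move=> hv hw; apply/eqP; rewrite -subr_eq0; apply/eqP/(@nrm_eq0 0)/le_anti.
rewrite nrm_ge0 andbT; apply/ler_addgt0Pl => e e0; rewrite addr0.
have e2 : 0 < e / 2 by rewrite divr_gt0.
near \oo => p.
have -> : v - w = (u p - w) - (u p - v) by ring.
rewrite (le_trans (nrmB _ _ _))// (splitr e) lerD//; near: p; [exact: hw|exact: hv].
Unshelve. all: by end_near. Qed.

End sup_norms.

(** * Exponentials and their density *)

Section phase.
Context {R : realType} {N : nat}.
Notation T := (torus_fun R N).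
Implicit Types (theta : 'rV[R]_N -> R).

Lemma line_is_derive (f : 'rV[R]_N -> R) (v x : 'rV[R]_N) (d : R) :
  is_derive (0 : R) (1 : R) (fun s => f (x + s *: v)) d ->
  derivable f x v /\ 'D_v f x = d.
Proof.
case; rewrite /derivable /derive.
have -> : (fun h : R => h^-1 *: (((fun s => f (x + s *: v)) \o shift (0:R)) (h *: (1:R)) - f (x + 0 *: v)))
   = (fun h : R => h^-1 *: ((f \o shift x) (h *: v) - f x)).
  apply/funext => h /=; rewrite [h *: 1]mulr1 addr0 scale0r addr0.
  by congr (_ *: (f _ - _)); rewrite addrC.
by [].
Qed.

Lemma comp_partial (F dF : R -> R) theta (i : 'I_N) :
  (forall s : R, is_derive s 1 F (dF s)) -> smooth theta ->
  (forall x, derivable (fun x => F (theta x)) x (delta_mx 0 i)) /\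
  partial i (fun x => F (theta x)) = (fun x => dF (theta x) * partial i theta x).
Proof.
move=> HF st.
have H x : derivable (fun x => F (theta x)) x (delta_mx 0 i) /\
    partial i (fun x => F (theta x)) x = dF (theta x) * partial i theta x.
  apply: line_is_derive.
  have h1 := is_derive_line (f := theta) (v := delta_mx 0 i) x 0
     (fun y => @smooth_derivable R N theta i y st).
  have := is_derive1_comp (HF (theta (x + 0 *: delta_mx 0 i))) h1.
  by rewrite !scale0r !addr0.
by split=> [x|]; [have [] := H x|apply/funext => x; have [] := H x].
Qed.

Lemma smooth_cos_sin theta : smooth theta ->
  smooth (fun x => cos (theta x)) /\ smooth (fun x => sin (theta x)).
Proof.
move=> st.
have cc F : (forall s : R, derivable F s 1) -> continuous (fun x => F (theta x)).
  move=> dF x; apply: continuous_comp; first exact: (smooth_continuous st).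
  by apply: differentiable_continuous; apply/derivable1_diffP.
have dcos (s : R) : is_derive s 1 cos (- sin s) by exact: is_derive_cos.
have dsin (s : R) : is_derive s 1 sin (cos s) by exact: is_derive_sin.
suff H k : class_C k (fun x => cos (theta x)) /\ class_C k (fun x => sin (theta x)).
  by split=> k; have [] := H k.
have ccos : continuous (fun x => cos (theta x)) by apply: cc => s; case: (dcos s).
have csin : continuous (fun x => sin (theta x)) by apply: cc => s; case: (dsin s).
elim: k => [|k [IHc IHs]]; first by split.
split; split => // i.
  have [dd ->] := comp_partial (F := cos) i dcos st; split => //.
  have -> : (fun x => - sin (theta x) * partial i theta x) =
     (fun x => sin (theta x) * ((-1) * partial i theta x)).
    by apply/funext => x; rewrite mulN1r mulrN mulNr.
  apply: class_CM => //; apply: class_CM; first exact: class_C_cst.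
  exact: smooth_partial.
have [dd ->] := comp_partial (F := sin) i dsin st; split => //.
by apply: class_CM => //; exact: smooth_partial.
Qed.

Lemma cosD2piz (z : int) (x : R) : cos (x + 2 * pi * z%:~R) = cos x.
Proof.
have P (m : nat) y : cos (y + 2 * pi * m%:R) = cos y :> R.
  elim: m y => [|m IH] y; first by rewrite mulr0 addr0.
  by rewrite -(natr1 m) mulrDr mulr1 addrA mulr_natl cosD2pi -mulr_natl IH.
case: z => m; first exact: P.
by rewrite -(P m.+1 (x + _)) NegzE mulrNz mulrN subrK.
Qed.

Lemma sinD2piz (z : int) (x : R) : sin (x + 2 * pi * z%:~R) = sin x.
Proof.
have P (m : nat) y : sin (y + 2 * pi * m%:R) = sin y :> R.
  elim: m y => [|m IH] y; first by rewrite mulr0 addr0.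
  by rewrite -(natr1 m) mulrDr mulr1 addrA mulr_natl sinD2pi -mulr_natl IH.
case: z => m; first exact: P.
by rewrite -(P m.+1 (x + _)) NegzE mulrNz mulrN subrK.
Qed.

(** Only the exponential of the phase has to be periodic, so a period may add an integer multiple of
    [2 pi]; this admits the linear phases [k . x]. *)
Definition is_phase theta := smooth theta /\
  forall i, exists z : int, forall x,
    theta (x + (2 * pi) *: delta_mx 0 i) = theta x + 2 * pi * z%:~R.

Lemma cis_subproof theta (ht : is_phase theta) :
  (fun x => cos (theta x) +i* sin (theta x)) \in (@torus_smooth R N).
Proof.
have [st pt] := ht; apply/torus_smoothP; split.
  by move=> i x; have [z ->] := pt i; rewrite cosD2piz sinD2piz.
by have [] := smooth_cos_sin st.
Qed.

Definition tcis theta (ht : is_phase theta) : T := TorusFun (cis_subproof ht).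

Lemma tcisE theta (ht : is_phase theta) x :
  tcis ht x = cos (theta x) +i* sin (theta x).
Proof. by []. Qed.

Lemma tcis_partial theta (ht : is_phase theta) i (f : T) :
  (forall x, f x = (partial i theta x)%:C) ->
  pd i (tcis ht) = 'i *: (f * tcis ht).
Proof.
move=> Hf; apply: tfun_ext => x; rewrite pdE tfunZ tfunM tcisE Hf.
have [st _] := ht.
have [_ /(congr1 (fun g => g x))] := comp_partial i (@is_derive_cos R) st.
have [_ /(congr1 (fun g => g x))] := comp_partial i (@is_derive_sin R) st.
rewrite /= => -> ->; apply/eqP; rewrite eq_complex/=.
by apply/andP; split; apply/eqP; ring.
Qed.

Lemma tcis_conj theta (ht : is_phase theta) : tcis ht * tconj (tcis ht) = 1.
Proof.
apply: tfun_ext => x; rewrite tfunM tconjE mul_conjE tcisE/=.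
by rewrite cos2Dsin2.
Qed.

Lemma grad0_const (f : T) : (forall i, pd i f = 0) -> exists c : R[i], f = c *: (1 : T).
Proof.
move=> f0.
have line (u : 'rV[R]_N -> R) i x s : smooth u -> (forall x, partial i u x = 0) ->
    u (x + s *: delta_mx 0 i) = u x.
  move=> su u0; set v := delta_mx 0 i.
  have H := @derivative_quotient_le R (fun s => u (x + s *: v)) (fun=> 0) 0 s 0 (`|s| + 1).
  have h1 (t : R) : is_derive t 1 (fun s => u (x + s *: v)) 0.
    rewrite -(u0 (x + t *: v)); apply: is_derive_line => y; exact: smooth_derivable.
  have h2 : `|s| < `|s| + 1 by rewrite ltrDl.
  have h3 (t : R) : `|t - 0| < `|s| + 1 -> `|0 - 0 : R| <= 0 by rewrite subrr normr0.
  by have := H h1 h2 h3; rewrite add0r !mulr0 subr0 scale0r addr0 normr_le0 subr_eq0 => /eqP.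
have const (u : 'rV[R]_N -> R) : smooth u -> (forall i x, partial i u x = 0) ->
    forall x, u x = u 0.
  move=> su u0 x; rewrite [x in LHS]matrix_sum_delta big_ord1.
  elim/big_rec: _ => [//|i y _ IH]; by rewrite addrC line.
exists (f 0); apply: tfun_ext => x; rewrite tfunZ tfun1 mulr1.
have E i x' : partial i (fun y => complex.Re (f y)) x' = 0 /\
    partial i (fun y => complex.Im (f y)) x' = 0.
  by have /(congr1 (fun g : T => g x')) := f0 i; rewrite pdE tfun0 => -[].
have hr := const _ (tRe_smooth f) (fun i y => (E i y).1) x.
have hi := const _ (tIm_smooth f) (fun i y => (E i y).2) x.
by move: hr hi; case: (f x) (f 0) => a b [c d] /= -> ->.
Qed.

Definition linear_phase (k : 'I_N -> R) (x : 'rV[R]_N) : R := \sum_i k i * x 0 i.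

Lemma coord_smooth (i : 'I_N) : smooth (fun x : 'rV[R]_N => x 0 i) /\
  forall j x, partial j (fun x : 'rV[R]_N => x 0 i) x = (i == j)%:R.
Proof.
have D (j : 'I_N) (x : 'rV[R]_N) : derivable (fun x : 'rV[R]_N => x 0 i) x (delta_mx 0 j) /\
    'D_(delta_mx 0 j) (fun x : 'rV[R]_N => x 0 i) x = (i == j)%:R.
  apply: line_is_derive.
  have -> : (fun s : R => (x + s *: delta_mx 0 j) 0 i) = (fun s => x 0 i + (i == j)%:R * s).
    by apply/funext => s; rewrite !mxE eqxx/= mulrC.
  have h := is_deriveD (is_derive_cst (x 0 i) (0:R) (1:R))
     (is_deriveZ (i == j)%:R (is_derive_id (0:R) (1:R))).
  by rewrite add0r [_%:R *: _]mulr1 in h.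
split; last by move=> j x; have [] := D j x.
move=> k; case: k => [|k]; split; try exact: coord_continuous; first by [].
move=> j; split; first by move=> x; have [] := D j x.
suff -> : partial j (fun x : 'rV[R]_N => x 0 i) = fun=> (i == j)%:R by exact: class_C_cst.
by apply/funext => x; have [] := D j x.
Qed.

Lemma smooth_sum I (r : seq I) (F : I -> 'rV[R]_N -> R) :
  (forall i, smooth (F i)) -> smooth (fun x => \sum_(i <- r) F i x).
Proof.
move=> sF; elim: r => [|i r IH].
  by under eq_fun do rewrite big_nil; exact: smooth_cst.
by under eq_fun do rewrite big_cons; apply: smoothD.
Qed.

Lemma linear_phase_smooth k : smooth (linear_phase k).
Proof.
apply: smooth_sum => i; apply: smoothM; first exact: smooth_cst.
by have [] := coord_smooth i.
Qed.

Lemma linear_phaseD k x y : linear_phase k (x + y) = linear_phase k x + linear_phase k y.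
Proof. by rewrite /linear_phase -big_split; apply: eq_bigr => i _; rewrite mxE mulrDr. Qed.

Lemma linear_phaseZ k (c : R) y : linear_phase k (c *: y) = c * linear_phase k y.
Proof. by rewrite /linear_phase mulr_sumr; apply: eq_bigr => i _; rewrite mxE mulrCA. Qed.

Lemma linear_phase_delta k i : linear_phase k (delta_mx 0 i) = k i.
Proof.
rewrite /linear_phase (bigD1 i)//= big1 => [|j ji]; first by rewrite mxE !eqxx mulr1 addr0.
by rewrite mxE (negbTE ji) andbF mulr0.
Qed.

Lemma linear_phase_partial k i x : partial i (linear_phase k) x = k i.
Proof.
suff [] : derivable (linear_phase k) x (delta_mx 0 i) /\
    'D_(delta_mx 0 i) (linear_phase k) x = k i by [].
apply: line_is_derive.
have -> : (fun s : R => linear_phase k (x + s *: delta_mx 0 i)) =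
    (fun s => linear_phase k x + k i * s).
  by apply/funext => s; rewrite linear_phaseD linear_phaseZ linear_phase_delta mulrC.
have h := is_deriveD (is_derive_cst (linear_phase k x) (0:R) (1:R))
     (is_deriveZ (k i) (is_derive_id (0:R) (1:R))).
by rewrite add0r [_ *: _]mulr1 in h.
Qed.

Notation freq := {ffun 'I_N -> int}.

Lemma linear_is_phase (k : freq) : is_phase (linear_phase (fun i => (k i)%:~R)).
Proof.
split; first exact: linear_phase_smooth.
by move=> i; exists (k i) => x; rewrite linear_phaseD linear_phaseZ linear_phase_delta.
Qed.

Definition expo (k : freq) : T := tcis (linear_is_phase k).

Lemma expo_partial k i : pd i (expo k) = ('i * (k i)%:~R) *: expo k.
Proof.
rewrite (@tcis_partial _ _ _ ((k i)%:~R *: (1 : T))); last first.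
  move=> x; rewrite tfunZ tfun1 mulr1 linear_phase_partial.
  by rewrite rmorph_int.
by rewrite -tscalerAl mul1r scalerA.
Qed.

Lemma expo_conj k : expo k * tconj (expo k) = 1.
Proof. exact: tcis_conj. Qed.

(** Multiplying by the conjugate exponential cancels the eigenvalues, so the product has zero
    gradient and is constant. *)
Lemma eigen_expo (f : T) (k : freq) :
  (forall i, pd i f = ('i * (k i)%:~R) *: f) -> exists c : R[i], f = c *: expo k.
Proof.
move=> Hf; have [i|c Hc] := @grad0_const (f * tconj (expo k)).
  rewrite pdM Hf pd_conj expo_partial tconjZ -tscalerAl -tscalerAr -scalerDl.
  suff -> : 'i * (k i)%:~R + conjc ('i * (k i)%:~R) = 0 :> R[i] by rewrite scale0r.
  have -> : ((k i)%:~R : R[i]) = ((k i)%:~R : R)%:C by rewrite rmorph_int.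
  by apply/eqP; rewrite eq_complex/=; apply/andP; split; apply/eqP; ring.
exists c; rewrite [in RHS](tscale1E) -Hc -mulrA [_ * expo k]mulrC expo_conj mulr1//.
Qed.

End phase.

(** * Convolution with Fejér kernels and Fourier modes *)

Section averages.
Context {R : realType} {N : nat}.
Notation T := (torus_fun R N).
Implicit Types (u : 'rV[R]_N -> R) (k : R -> R).

(** Convolution in the [i]-th variable alone, up to reflection of the kernel. Averaging one variable
    at a time keeps the kernels one-dimensional. *)
Definition avgR k (i : 'I_N) u (x : 'rV[R]_N) : R :=
  circle_int (fun s => k s * u (x + s *: delta_mx 0 i)).

Lemma segment_compact2pi : compact (`[0, 2 * pi]%classic : set R).
Proof. exact: segment_compact. Qed.

Lemma line2_continuous (i j : 'I_N) u (x : 'rV[R]_N) : continuous u ->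
  continuous (fun p : R * R => u (x + p.1 *: delta_mx 0 i + p.2 *: delta_mx 0 j)).
Proof.
move=> cu p; apply: continuous_comp; last exact: cu.
apply: cvgD; first apply: cvgD.
- exact: cvg_cst.
- by apply: cvgZr_tmp; exact: cvg_fst.
- by apply: cvgZr_tmp; exact: cvg_snd.
Qed.

Lemma kline_continuous k i u x : continuous k -> continuous u ->
  continuous (fun s : R => k s * u (x + s *: delta_mx 0 i)).
Proof.
move=> ck cu s; apply: cvgM; first exact: ck.
apply: (continuous_comp (f := fun s : R => x + s *: delta_mx 0 i)); last exact: cu.
by apply: cvgD; [exact: cvg_cst|apply: cvgZr_tmp; exact: cvg_id].
Qed.

Lemma avgR_continuous k i u : continuous k -> continuous u -> continuous (avgR k i u).
Proof.
move=> ck cu; apply: (bfun_continuous segment_compact2pi (@circle_int_bounded R) (ltW twopi_gt0)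
  (g := fun (x : 'rV[R]_N) s => k s * u (x + s *: delta_mx 0 i))).
move=> p; apply: cvgM.
  by apply: (continuous_comp (f := snd)); [exact: cvg_snd|exact: ck].
apply: (continuous_comp (f := fun p : 'rV[R]_N * R => p.1 + p.2 *: delta_mx 0 i)); last exact: cu.
by apply: cvgD; [exact: cvg_fst|apply: cvgZr_tmp; exact: cvg_snd].
Qed.

Lemma avgR_partial k i j u : continuous k -> smooth u ->
  (forall x, derivable (avgR k i u) x (delta_mx 0 j)) /\
  partial j (avgR k i u) = avgR k i (partial j u).
Proof.
move=> ck su.
have cu := smooth_continuous su.
have cdu := smooth_continuous (smooth_partial j su).
have H x : derivable (avgR k i u) x (delta_mx 0 j) /\
    partial j (avgR k i u) x = avgR k i (partial j u) x.
  apply: line_is_derive.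
  have := bfun_is_derive segment_compact2pi (@circle_int_bounded R) (ltW twopi_gt0)
    (g := fun h s => k s * u (x + h *: delta_mx 0 j + s *: delta_mx 0 i))
    (dg := fun h s => k s * partial j u (x + h *: delta_mx 0 j + s *: delta_mx 0 i)) _ _ _ 0.
  rewrite /avgR scale0r addr0; apply.
  - by move=> h; exact: kline_continuous.
  - move=> s h.
    have := is_derive_line (f := u) (v := delta_mx 0 j) (x + s *: delta_mx 0 i) h
       (fun y => @smooth_derivable R N u j y su).
    rewrite addrAC.
    have -> : (fun h => k s * u (x + h *: delta_mx 0 j + s *: delta_mx 0 i)) =
       k s \*: (fun h => u (x + s *: delta_mx 0 i + h *: delta_mx 0 j)).
      by apply/funext => h'; rewrite /= addrAC.
    by move=> h1; exact: is_deriveZ.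
  - move=> p; apply: cvgM; last exact: line2_continuous.
    by apply: (continuous_comp (f := snd)); [exact: cvg_snd|exact: ck].
by split=> [x|]; [have [] := H x|apply/funext => x; have [] := H x].
Qed.

Lemma avgR_smooth k i u : continuous k -> smooth u -> smooth (avgR k i u).
Proof.
move=> ck su m; elim: m u su => [|m IH] u su.
  by split => //; apply: avgR_continuous => //; exact: smooth_continuous.
split; first by apply: avgR_continuous => //; exact: smooth_continuous.
move=> j; have [d ->] := avgR_partial i j ck su; split => //.
by apply: IH; exact: smooth_partial.
Qed.

(* Integration by parts in the averaging variable. *)
Lemma avgR_deriv k dk i u : continuous k -> continuous dk ->
  (forall s : R, is_derive s 1 k (dk s)) -> k (2 * pi) = k 0 -> smooth u ->
  (forall x, u (x + (2 * pi) *: delta_mx 0 i) = u x) ->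
  forall x, avgR k i (partial i u) x = - avgR dk i u x.
Proof.
move=> ck cdk Hk k0 su pu x; apply/eqP; rewrite -addr_eq0; apply/eqP.
have cu := smooth_continuous su.
have cdu := smooth_continuous (smooth_partial i su).
rewrite /avgR -(bfunD circle_int_bounded); [|exact: kline_continuous..].
pose F (s : R) := k s * u (x + s *: delta_mx 0 i).
have FT (s : R) : is_derive s 1 F (k s * partial i u (x + s *: delta_mx 0 i)
    + dk s * u (x + s *: delta_mx 0 i)).
  have h := is_derive_line (f := u) (v := delta_mx 0 i) x s
       (fun y => @smooth_derivable R N u i y su).
  have := is_deriveM (Hk s) h; rewrite /GRing.scale/= => h2.
  by rewrite [X in _ + X]mulrC.
rewrite (circle_FTC _ FT); first by rewrite /F k0 pu scale0r addr0 subrr.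
by move=> s; apply: cvgD; exact: kline_continuous.
Qed.

Lemma avg_subproof k (ck : continuous k) i (f : T) :
  (fun x => avgR k i (fun y => complex.Re (f y)) x +i* avgR k i (fun y => complex.Im (f y)) x)
    \in (@torus_smooth R N).
Proof.
apply/torus_smoothP; split; last first.
  by split; apply: avgR_smooth => //; [exact: tRe_smooth|exact: tIm_smooth].
move=> j x; congr (_ +i* _); congr circle_int; apply/funext => s; congr (_ * _).
  by rewrite addrAC tperiodic.
by rewrite addrAC tperiodic.
Qed.

Definition avg k (ck : continuous k) i (f : T) : T := TorusFun (avg_subproof ck i f).

Lemma avg_partial k (ck : continuous k) i j f :
  pd j (avg ck i f) = avg ck i (pd j f).
Proof.
apply: tfun_ext => x; rewrite pdE /= -Re_pd -Im_pd.
have [_ ->] := avgR_partial i j ck (tRe_smooth f).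
by have [_ ->] := avgR_partial i j ck (tIm_smooth f).
Qed.

Lemma avg_deriv k dk (ck : continuous k) (cdk : continuous dk) i f :
  (forall s : R, is_derive s 1 k (dk s)) -> k (2 * pi) = k 0 ->
  avg ck i (pd i f) = - avg cdk i f.
Proof.
move=> Hk k0; apply: tfun_ext => x; rewrite tfunN /= -Re_pd -Im_pd.
rewrite (avgR_deriv ck cdk Hk k0 (tRe_smooth f)); last by move=> y; rewrite tperiodic.
rewrite (avgR_deriv ck cdk Hk k0 (tIm_smooth f)); last by move=> y; rewrite tperiodic.
by [].
Qed.

Lemma avg_kernelD k1 k2 k (c1 : continuous k1) (c2 : continuous k2) (c : continuous k) i f :
  (forall s, k s = k1 s + k2 s) -> avg c i f = avg c1 i f + avg c2 i f.
Proof.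
move=> kE; apply: tfun_ext => x; rewrite tfunD/=.
have E (u : 'rV[R]_N -> R) : continuous u -> avgR k i u x = avgR k1 i u x + avgR k2 i u x.
  move=> cu; rewrite /avgR -(bfunD circle_int_bounded); [|exact: kline_continuous..].
  by congr circle_int; apply/funext => s; rewrite kE mulrDl.
by rewrite (E _ (@tRe_continuous _ _ f)) (E _ (@tIm_continuous _ _ f)).
Qed.

Lemma avg_kernelZ k1 k (r : R) (c1 : continuous k1) (c : continuous k) i f :
  (forall s, k s = r * k1 s) -> avg c i f = r%:C *: avg c1 i f.
Proof.
move=> kE; apply: tfun_ext => x; rewrite tfunZ/=.
have E (u : 'rV[R]_N -> R) : continuous u -> avgR k i u x = r * avgR k1 i u x.
  move=> cu; rewrite /avgR -(bfunZ circle_int_bounded); last exact: kline_continuous.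
  by congr circle_int; apply/funext => s; rewrite kE mulrA.
rewrite (E _ (@tRe_continuous _ _ f)) (E _ (@tIm_continuous _ _ f)).
by apply/eqP; rewrite eq_complex/= !mul0r subr0 addr0 !eqxx.
Qed.

End averages.

Section fejer.
Context {R : realType}.

Definition cosk (l : int) (s : R) := cos (l%:~R * s).
Definition sink (l : int) (s : R) := sin (l%:~R * s).

Lemma cosk_is_derive l (s : R) : is_derive s 1 (cosk l) (- l%:~R * sink l s).
Proof.
have h := is_deriveZ (l%:~R : R) (is_derive_id s (1 : R)).
have := is_derive1_comp (is_derive_cos (l%:~R * s)) h.
by rewrite [_%:~R *: _]mulr1 mulNr -mulrN mulrC.
Qed.

Lemma sink_is_derive l (s : R) : is_derive s 1 (sink l) (l%:~R * cosk l s).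
Proof.
have h := is_deriveZ (l%:~R : R) (is_derive_id s (1 : R)).
have := is_derive1_comp (is_derive_sin (l%:~R * s)) h.
by rewrite [_%:~R *: _]mulr1 mulrC.
Qed.

Lemma is_derive_continuous (F dF : R -> R) :
  (forall s : R, is_derive s 1 F (dF s)) -> continuous F.
Proof.
by move=> H s; apply: differentiable_continuous; apply/derivable1_diffP; case: (H s).
Qed.

Lemma cosk_continuous l : continuous (cosk l).
Proof. exact: is_derive_continuous (cosk_is_derive l). Qed.
Lemma sink_continuous l : continuous (sink l).
Proof. exact: is_derive_continuous (sink_is_derive l). Qed.

Lemma cosk_2pi l : cosk l (2 * pi) = cosk l 0.
Proof. by rewrite /cosk mulr0 -[in RHS](cosD2piz l 0) add0r mulrC. Qed.
Lemma sink_2pi l : sink l (2 * pi) = sink l 0.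
Proof. by rewrite /sink mulr0 -[in RHS](sinD2piz l 0) add0r mulrC. Qed.

Lemma circle_int_cosk l : circle_int (cosk l) = (l == 0)%:R * (2 * pi).
Proof.
have [->|l0] := eqVneq l 0.
  rewrite mul1r -[RHS]mul1r -circle_int_cst; congr circle_int.
  by apply/funext => s; rewrite /cosk mul0r cos0.
have lr : (l%:~R : R) != 0 by rewrite intr_eq0.
rewrite mul0r; apply: (mulfI lr); rewrite mulr0 -(bfunZ circle_int_bounded); last exact: cosk_continuous.
rewrite (circle_FTC _ (sink_is_derive l)); first by rewrite sink_2pi subrr.
exact: (mulc_continuous (@cosk_continuous l)).
Qed.

(** The Fejér kernel [|sum_(j < m) exp(i j s)|^2 / (2 pi m)]. The double sum of cosines displays it
    as a combination of modes; the square form [fejerE] shows that it is nonnegative. *)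
Definition fejer (m : nat) (s : R) : R :=
  (2 * pi * m%:R)^-1 * \sum_(j < m) \sum_(j' < m) cosk (j%:Z - j'%:Z) s.

Lemma fejerE m s : fejer m s = (2 * pi * m%:R)^-1 *
  ((\sum_(j < m) cos (j%:R * s)) ^+ 2 + (\sum_(j < m) sin (j%:R * s)) ^+ 2).
Proof.
congr (_ * _); rewrite !expr2 !mulr_suml -big_split/=; apply: eq_bigr => j _.
rewrite !mulr_sumr -big_split/=; apply: eq_bigr => j' _.
by rewrite /cosk intrB mulrBl cosB.
Qed.

Lemma fejer_ge0 m s : 0 <= fejer m s.
Proof.
rewrite fejerE mulr_ge0 ?addr_ge0 ?sqr_ge0// invr_ge0 mulr_ge0//.
exact: ltW twopi_gt0.
Qed.

Lemma fejer_continuous m : continuous (fejer m).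
Proof.
apply: mulc_continuous; apply: sum_continuous => j; apply: sum_continuous => j'.
exact: cosk_continuous.
Qed.

Lemma fejer_int m : (0 < m)%N -> circle_int (fejer m) = 1.
Proof.
move=> m0; rewrite (bfunZ circle_int_bounded); last first.
  by apply: sum_continuous => j; apply: sum_continuous => j'; exact: cosk_continuous.
have isum n (F : 'I_n -> R -> R) : (forall i, continuous (F i)) ->
    circle_int (fun s => \sum_(i < n) F i s) = \sum_(i < n) circle_int (F i).
  move=> cF; elim: n F cF => [|n IH] F cF.
    under eq_fun do rewrite big_ord0.
    by rewrite big_ord0 circle_int_cst mul0r.
  under eq_fun do rewrite big_ord_recl.
  rewrite (bfunD circle_int_bounded) ?IH ?big_ord_recl//.
  exact: sum_continuous.
rewrite isum => [|j]; last by apply: sum_continuous => j'; exact: cosk_continuous.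
have p0 : (2 * pi : R) != 0 by rewrite gt_eqF// twopi_gt0.
rewrite (eq_bigr (fun=> 2 * pi)) => [|j _]; last first.
  rewrite isum => [|j']; last exact: cosk_continuous.
  rewrite (bigD1 j)//= big1 => [|j' jj]; first by rewrite addr0 circle_int_cosk subrr eqxx mul1r.
  by rewrite circle_int_cosk subr_eq0 eqz_nat eq_sym (_ : (_ == _) = false) ?mul0r//; apply/negbTE.
rewrite sumr_const card_ord -[X in _ * X]mulr_natr mulVf// mulf_neq0//.
by rewrite pnatr_eq0 -lt0n.
Qed.

(** The summed geometric series gives [(1 - cos s) |sum_(j < m) exp(i j s)|^2 = 1 - cos (m s) <= 2],
    a form of the closed formula without division, valid also where [cos s = 1]. *)
Lemma fejer_tail m s : fejer m s * (1 - cos s) <= 2 * (2 * pi * m%:R)^-1.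
Proof.
rewrite fejerE.
pose C p : R := \sum_(j < p) cos (j%:R * s).
pose S p : R := \sum_(j < p) sin (j%:R * s).
have CS : C m.+1 = C m + cos (m%:R * s) /\ S m.+1 = S m + sin (m%:R * s).
  by rewrite /C /S !big_ord_recr.
have cs2 := cos2Dsin2 s.
have pS p : p.+1%:R * s = p%:R * s + s by rewrite -(natr1 p) mulrDl mul1r.
(* [HC] and [HS] are the real and imaginary parts of the geometric sum multiplied by
   [|1 - exp(i s)|^2 = 2 (1 - cos s)]. *)
have HC p : 2 * (1 - cos s) * C p =
    (1 - cos s) * (1 - cos (p%:R * s)) + sin (p%:R * s) * sin s.
  elim: p => [|p IH]; first by rewrite /C big_ord0 mul0r cos0 sin0; ring.
  rewrite /C big_ord_recr/= -/(C p) mulrDr IH pS cosD sinD.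
  set a := cos (p%:R * s); set b := sin (p%:R * s).
  apply/eqP; rewrite -subr_eq0; apply/eqP.
  transitivity (a * (1 - (cos s ^+ 2 + sin s ^+ 2))); last by rewrite cs2 subrr mulr0.
  ring.
have HS p : 2 * (1 - cos s) * S p = sin s + sin (p%:R * s) * cos s
    - cos (p%:R * s) * sin s - sin (p%:R * s).
  elim: p => [|p IH]; first by rewrite /S big_ord0 mul0r cos0 sin0; ring.
  rewrite /S big_ord_recr/= -/(S p) mulrDr IH pS cosD sinD.
  set a := cos (p%:R * s); set b := sin (p%:R * s).
  apply/eqP; rewrite -subr_eq0; apply/eqP.
  transitivity (b * (1 - (cos s ^+ 2 + sin s ^+ 2))); last by rewrite cs2 subrr mulr0.
  ring.
have HD p : (1 - cos s) * (C p ^+ 2 + S p ^+ 2) = 1 - cos (p%:R * s).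
  elim: p => [|p IH].
    by rewrite /C /S !big_ord0 mul0r cos0 expr0n/= addr0 mulr0 subrr.
  have -> : C p.+1 = C p + cos (p%:R * s) by rewrite /C big_ord_recr.
  have -> : S p.+1 = S p + sin (p%:R * s) by rewrite /S big_ord_recr.
  rewrite pS cosD.
  have := cos2Dsin2 (p%:R * s); have := HC p; have := HS p; move: IH.
  move: (C p) (S p) (cos (p%:R * s)) (sin (p%:R * s)) => c d a b IH hs hc ab.
  have -> : (1 - cos s) * ((c + a) ^+ 2 + (d + b) ^+ 2) =
     (1 - cos s) * (c ^+ 2 + d ^+ 2) + a * (2 * (1 - cos s) * c) + b * (2 * (1 - cos s) * d)
     + (1 - cos s) * (a ^+ 2 + b ^+ 2) by ring.
  rewrite IH hc hs ab; apply/eqP; rewrite -subr_eq0; apply/eqP.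
  transitivity ((1 - cos s) * (1 - (a ^+ 2 + b ^+ 2))); last by rewrite ab subrr mulr0.
  ring.
rewrite (mulrC _ (1 - cos s)) mulrCA (HD m) mulrC ler_wpM2r//.
  by rewrite invr_ge0 mulr_ge0// ltW// twopi_gt0.
by have := cos_geN1 (m%:R * s); lra.
Qed.

End fejer.

Section fejer_approximation.
Context {R : realType} {N : nat}.
Notation T := (torus_fun R N).

Lemma increment_bound (u : 'rV[R]_N -> R) (i : 'I_N) (L : R) x s : smooth u ->
  (forall x, `|partial i u x| <= L) ->
  `|u (x + s *: delta_mx 0 i) - u x| <= 3 * L * `|s|.
Proof.
move=> su HL.
have h1 (t : R) : is_derive t 1 (fun s => u (x + s *: delta_mx 0 i))
    (partial i u (x + t *: delta_mx 0 i)).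
  by apply: is_derive_line => y; exact: smooth_derivable.
have h2 : `|s| < `|s| + 1 by rewrite ltrDl.
have h3 (t : R) : `|t - 0| < `|s| + 1 ->
    `|partial i u (x + t *: delta_mx 0 i) - partial i u (x + 0 *: delta_mx 0 i)| <= 2 * L.
  by move=> _; rewrite (le_trans (ler_normB _ _))// mulr_natl mulr2n lerD.
have := derivative_quotient_le h1 h2 h3; rewrite add0r scale0r addr0 => H.
have -> : u (x + s *: delta_mx 0 i) - u x =
  (u (x + s *: delta_mx 0 i) - u x - s * partial i u x) + s * partial i u x by ring.
rewrite (le_trans (ler_normD _ _))//.
have -> : 3 * L * `|s| = `|s| * (2 * L) + `|s| * L by ring.
by rewrite lerD// normrM ler_wpM2l.
Qed.

(** Near the ends of the period the Lipschitz bound applies; elsewhere the trivial bound [2 B] is at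
    most [B' (1 - cos s)]. The majorant [e / 2 + B' (1 - cos s)] covers both cases, and [fejer_tail]
    integrates its second term. *)
Lemma fejer_approx (B L e : R) : 0 < e -> 0 <= B -> 0 <= L ->
  exists M, forall m (u : 'rV[R]_N -> R) i, (M < m)%N -> smooth u ->
  (forall x, u (x + (2 * pi) *: delta_mx 0 i) = u x) ->
  (forall x, `|u x| <= B) -> (forall x, `|partial i u x| <= L) ->
  forall x, `|avgR (fejer m) i u x - u x| <= e.
Proof.
move=> e0 B0 L0.
have L1 : 0 < 2 * (3 * L + 1) by rewrite mulr_gt0// ltr_wpDl// mulr_ge0.
(* The factor 3 is that of [increment_bound], and [3 * L + 1] keeps the divisor positive when
   [L = 0]. The bound by [pi] makes the cosine monotone on the range where it is compared with
   [cos d]. *)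
pose d : R := Num.min pi (e / (2 * (3 * L + 1))).
have d0 : 0 < d by rewrite lt_min pi_gt0/= divr_gt0.
have p0 := @pi_gt0 R.
have dpi : d <= pi by rewrite ge_min lexx.
have dL : 3 * L * d <= e / 2.
  apply: (@le_trans _ _ (3 * L * (e / (2 * (3 * L + 1))))).
    by rewrite ler_wpM2l ?mulr_ge0// ge_min lexx orbT.
  rewrite mulrA ler_pdivrMr// (_ : e / 2 * _ = e * (3 * L + 1)); last by field.
  by nra.
have cd : 0 < 1 - cos d.
  rewrite subr_gt0 -cos0 ltr_cos// !in_itv/= ?lexx ?pi_ge0//.
  by rewrite (ltW d0).
pose B' := 2 * B / (1 - cos d).
have B'0 : 0 <= B' by rewrite divr_ge0 ?mulr_ge0// ltW.
(* Chosen so that the tail, which integrates to [2 * B' / m], stays below [e / 2]. *)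
pose M := Num.trunc (4 * B' / e).
exists M => m u i Mm su pu uB uL x.
have m0 : (0 < m)%N by exact: leq_ltn_trans Mm.
have mr : 4 * B' / e < m%:R.
  rewrite (lt_le_trans (truncnS_gt _))// ler_nat//.
have cu := smooth_continuous su.
pose v : 'rV[R]_N := delta_mx 0 i.
have Dl s : `[0, 2 * pi]%classic s -> `|u (x + s *: v) - u x| <= e / 2 + B' * (1 - cos s).
  rewrite /= in_itv/= => /andP[s0 s2].
  have c0 : 0 <= B' * (1 - cos s) by rewrite mulr_ge0// subr_ge0 cos_le1.
  have near0 t y : `|t| <= d -> `|u (y + t *: v) - u y| <= e / 2.
    move=> td; rewrite (le_trans (increment_bound _ _ su uL))//.
    by rewrite (le_trans _ dL)// ler_wpM2l// mulr_ge0.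
  case: (leP s d) => sd.
    rewrite (le_trans (near0 s x _)) ?lerDl//.
    by rewrite ger0_norm.
  case: (leP (2 * pi - d) s) => sd'.
    have -> : u (x + s *: v) = u (x + (s - 2 * pi) *: v).
      by rewrite -[RHS]pu -addrA -scalerDl subrK.
    rewrite (le_trans (near0 _ x _)) ?lerDl//.
    by rewrite ler_norml; apply/andP; split; lra.
  have cs : cos s <= cos d.
    case: (leP s pi) => spi.
      by apply: ltW; rewrite ltr_cos ?in_itv/= ?sd//; apply/andP; split; lra.
    have -> : cos s = cos (2 * pi - s).
      by rewrite -[LHS]cosN -(cosD2piz 1 (- s)) mulr1 addrC.
    apply: ltW; rewrite ltr_cos ?in_itv/=.
    - by lra.
    - by apply/andP; split; lra.
    - by apply/andP; split; lra.
  apply: (@le_trans _ _ (2 * B)).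
    by rewrite (le_trans (ler_normB _ _))// mulr_natl mulr2n lerD.
  apply: (@le_trans _ _ (B' * (1 - cos s))); last by rewrite lerDr divr_ge0// ltW.
  rewrite /B' mulrAC ler_pdivlMr// ler_wpM2l ?mulr_ge0//.
  by rewrite lerD2l lerN2.
pose F := fejer (R:=R) m.
have cF : continuous F by exact: fejer_continuous.
have c1 : continuous (fun s => F s * u (x + s *: v)) by exact: kline_continuous.
have c2 : continuous (fun s => F s * u x).
  by move=> s; apply: cvgM; [exact: cF|exact: cvg_cst].
have E : avgR F i u x - u x = circle_int (fun s => F s * u (x + s *: v) - F s * u x).
  rewrite (bfunB circle_int_bounded)//; congr (_ - _).
  have -> : (fun s => F s * u x) = (fun s => u x * F s) by apply/funext => s; rewrite mulrC.
  by rewrite (bfunZ circle_int_bounded)// fejer_int// mulr1.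
pose H (s : R) := e / 2 * F s + B' * (2 * (2 * pi * m%:R)^-1).
have cH : continuous H.
  by move=> s; apply: cvgD; [exact: (mulc_continuous cF)|exact: cvg_cst].
have cD : continuous (fun s => F s * u (x + s *: v) - F s * u x).
  by move=> s; apply: cvgB; [exact: c1|exact: c2].
have HF s : `[0, 2 * pi]%classic s -> `|F s * u (x + s *: v) - F s * u x| <= H s.
  move=> sI; rewrite -mulrBr normrM ger0_norm ?fejer_ge0//.
  apply: (@le_trans _ _ (F s * (e / 2 + B' * (1 - cos s)))).
    by rewrite ler_wpM2l ?fejer_ge0// Dl.
  rewrite mulrDr mulrC lerD2l mulrCA ler_wpM2l//.
  exact: fejer_tail.
have -> : e = circle_int H + (e / 2 - B' * 2 / m%:R).
  rewrite (bfunD circle_int_bounded); [|exact: (mulc_continuous cF)|exact: cst_continuous].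
  rewrite (bfunZ circle_int_bounded)// circle_int_cst fejer_int//.
  have mn : (m%:R : R) != 0 by rewrite pnatr_eq0 -lt0n.
  have pn : (pi : R) != 0 by rewrite gt_eqF.
  have alg (a b p q : R) : p != 0 -> q != 0 ->
      a = a / 2 * 1 + b * (2 * (2 * p * q)^-1) * (2 * p) + (a / 2 - b * 2 / q).
    by move=> ? ?; field; apply/andP.
  exact: alg.
rewrite E (@le_trans _ _ (circle_int H))//; last first.
  rewrite lerDl subr_ge0 ler_pdivrMr ?ltr0n//.
  move: mr; rewrite ltr_pdivrMr// => mr; lra.
rewrite ler_norml; apply/andP; split.
  rewrite -mulN1r -(bfunZ circle_int_bounded)//; apply: circle_int_le => //.
    exact: mulc_continuous.
  by move=> s sI; have := HF s sI; rewrite ler_norml mulN1r => /andP[].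
apply: circle_int_le => // s sI.
by have := HF s sI; rewrite ler_norml => /andP[].
Qed.

Definition favg m i (f : T) : T := avg (@fejer_continuous R m) i f.

(** Averages commute with derivatives, so uniform convergence for every smooth function already
    yields convergence in every [nrm k]. *)
Lemma favg_cvg i f : tcvg (fun m => favg m i f) f.
Proof.
have base (g : T) (e : R) : 0 < e -> \forall m \near \oo, n2 (favg m i g - g) <= e.
  move=> e0; have [B B0 HB] := tfun_bounded g; have [L L0 HL] := tfun_bounded (pd i g).
  have V0 : 0 < 2 * (@vol R N + 1) by rewrite mulr_gt0// addr_gt0// vol_gt0.
  have e1 := divr_gt0 e0 V0.
  have sq (a b c : R) : 0 <= c -> a ^+ 2 + b ^+ 2 <= c ^+ 2 -> `|a| <= c /\ `|b| <= c.
    by move=> c0 H; split; rewrite ler_norml; apply/andP; split; nra.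
  have [M HM] := fejer_approx e1 B0 L0.
  exists M.+1 => // m /= Mm.
  rewrite (le_trans (@n2_le_sup _ _ _ (e / (2 * (@vol R N + 1))) _ _ _))//.
  - exact: ltW.
  - move=> x; rewrite tfunB.
    have := HM m (fun x => complex.Re (g x)) i Mm (tRe_smooth g) _ _ _ x.
    rewrite /favg/=; case: (g x) => a b /=; apply.
    + by move=> y; rewrite tperiodic.
    + by move=> y; have [] := sq _ _ _ B0 (HB y).
    + by move=> y; rewrite Re_pd; have [] := sq _ _ _ L0 (HL y).
  - move=> x; rewrite tfunB.
    have := HM m (fun x => complex.Im (g x)) i Mm (tIm_smooth g) _ _ _ x.
    rewrite /favg/=; case: (g x) => a b /=; apply.
    + by move=> y; rewrite tperiodic.
    + by move=> y; have [] := sq _ _ _ B0 (HB y).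
    + by move=> y; rewrite Im_pd; have [] := sq _ _ _ L0 (HL y).
  - by rewrite mulrC divfK// gt_eqF.
move=> k; elim: k f => [|k IH] f e e0; first exact: base.
have e1 : 0 < e / (N.+1)%:R by rewrite divr_gt0// ltr0n.
have h0 := IH f _ e1.
have : \forall p \near \oo, forall j, nrm k (pd j (favg p i f - f)) <= e / (N.+1)%:R.
  apply: filter_forall => j.
  have := IH (pd j f) _ e1; apply: filterS => p.
  by rewrite pdB avg_partial.
apply: filterS2 h0 => p h0 h1; rewrite nrmS.
apply: (@le_trans _ _ (e / (N.+1)%:R + \sum_(i < N) e / (N.+1)%:R)).
  by apply: lerD; [exact: h0|apply: ler_sum => j _; exact: h1].
by rewrite sumr_const card_ord -mulrS -[leLHS]mulr_natr divfK// pnatr_eq0.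
Qed.

Definition subspace (V : T -> Prop) := V 0 /\
  forall (c : R[i]) f g, V f -> V g -> V (c *: f + g).

Definition tcl (V : T -> Prop) f := forall k (e : R), 0 < e ->
  exists g, V g /\ nrm k (f - g) <= e.

Section subspaces.
Variable V : T -> Prop.
Hypothesis sV : subspace V.
Lemma subspaceD f g : V f -> V g -> V (f + g).
Proof. by move=> vf vg; rewrite -[f]scale1r; apply: sV.2. Qed.
Lemma subspaceZ c f : V f -> V (c *: f).
Proof. by move=> vf; rewrite -[_ *: _]addr0; apply: sV.2 => //; exact: sV.1. Qed.
Lemma subspaceN f : V f -> V (- f).
Proof. by rewrite -scaleN1r; exact: subspaceZ. Qed.
Lemma subspaceB f g : V f -> V g -> V (f - g).
Proof. by move=> vf vg; apply: subspaceD => //; exact: subspaceN. Qed.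
Lemma subspace_sum I (r : seq I) (P : pred I) (F : I -> T) :
  (forall i, P i -> V (F i)) -> V (\sum_(i <- r | P i) F i).
Proof. by move=> H; elim/big_ind: _ => //; [exact: sV.1|exact: subspaceD]. Qed.

Lemma tcl_subspace : subspace (tcl V).
Proof.
split; first by move=> k e e0; exists 0; rewrite subrr nrm0 ltW//; split => //; exact: sV.1.
move=> c f g vf vg k e e0.
have c1 : 0 < normc c + 1 by rewrite ltr_wpDl// normc_ge0.
have [f' [vf' hf]] := vf k _ (divr_gt0 (divr_gt0 e0 (@ltr0n R 2)) c1).
have [g' [vg' hg]] := vg k _ (divr_gt0 e0 (@ltr0n R 2)).
exists (c *: f' + g'); split; first exact: sV.2.
have -> : c *: f + g - (c *: f' + g') = c *: (f - f') + (g - g').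
  by rewrite scalerBr opprD addrACA.
rewrite (le_trans (nrmD _ _ _))// (splitr e) lerD// nrmZ.
rewrite ler_pdivlMr// in hf.
by rewrite (le_trans _ hf)// mulrC ler_wpM2l ?nrm_ge0// lerDl.
Qed.

End subspaces.

Lemma sub_tcl (V : T -> Prop) f : V f -> tcl V f.
Proof. by move=> vf k e e0; exists f; rewrite subrr nrm0 ltW. Qed.

Lemma tcl_idem (V W : T -> Prop) f : (forall g, W g -> tcl V g) -> tcl W f -> tcl V f.
Proof.
move=> WV Wf k e e0; have e2 : 0 < e / 2 by rewrite divr_gt0.
have [g [Wg hg]] := Wf k _ e2; have [h [Vh hh]] := WV g Wg k _ e2.
exists h; split => //; have -> : f - h = (f - g) + (g - h) by rewrite addrA subrK.
by rewrite (le_trans (nrmD _ _ _))// (splitr e) lerD.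
Qed.

Lemma tcvg_tcl (V : T -> Prop) u f : (forall m, V (u m)) -> tcvg u f -> tcl V f.
Proof.
move=> Vu uf k e e0; have [M _ /(_ M (leqnn M)) H] := uf k e e0.
by exists (u M); split => //; rewrite nrm_distC.
Qed.

Lemma tcl_tame (A : T -> T) (V W : T -> Prop) f : tame A ->
  {morph A : f g / f - g} -> (forall g, V g -> tcl W (A g)) -> tcl V f -> tcl W (A f).
Proof.
move=> tA AB VW Vf; apply: (tcl_idem (W := fun h => exists2 g, V g & h = A g)).
  by move=> h [g Vg ->]; exact: VW.
move=> k e e0; have [m [C [C0 H]]] := tA k.
have C1 : 0 < C + 1 by rewrite ltr_wpDl.
have [g [Vg hg]] := Vf m _ (divr_gt0 e0 C1).
exists (A g); split; first by exists g.
rewrite -AB (le_trans (H _))//.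
apply: (@le_trans _ _ ((C + 1) * nrm m (f - g))); first by rewrite ler_wpM2r ?nrm_ge0// lerDl.
by rewrite mulrC -ler_pdivlMr.
Qed.

Definition tspan (K : eqType) (E : K -> T) (f : T) := exists (s : seq K) (c : K -> R[i]),
  uniq s /\ f = \sum_(x <- s) c x *: E x.

Lemma tspan_gen (K : eqType) (E : K -> T) x : tspan E (E x).
Proof. by exists [:: x], (fun=> 1); split => //; rewrite big_seq1 scale1r. Qed.

Lemma tspan_subspace (K : eqType) (E : K -> T) : subspace (tspan E).
Proof.
split; first by exists [::], (fun=> 0); rewrite big_nil.
move=> c f g [s [a [us ->]]] [s' [a' [us' ->]]].
exists (undup (s ++ s')), (fun x => c * (if x \in s then a x else 0) + (if x \in s' then a' x else 0)).
split; first exact: undup_uniq.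
have ext (t : seq K) (b : K -> R[i]) (r : seq K) : uniq t -> {subset t <= r} -> uniq r ->
    \sum_(x <- t) b x *: E x = \sum_(x <- r) (if x \in t then b x else 0) *: E x.
  move=> ut tr ur; rewrite [RHS](bigID (fun x => x \in t))/= [X in _ = _ + X]big1 ?addr0; last first.
    by move=> x /negbTE ->; rewrite scale0r.
  have pt : perm_eq t [seq x <- r | x \in t].
    apply: uniq_perm => //; first exact: filter_uniq.
    by move=> x; rewrite mem_filter; apply/idP/andP => [xt|[]//]; split=> //; exact: tr.
  rewrite -[RHS]big_filter -(perm_big _ pt)/=.
  by rewrite big_seq [RHS]big_seq; apply: eq_bigr => x ->.
set r := undup _; have ur : uniq r by exact: undup_uniq.
rewrite (ext s a r us _ ur); last by move=> x xs; rewrite mem_undup mem_cat xs.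
rewrite (ext s' a' r us' _ ur); last by move=> x xs; rewrite mem_undup mem_cat xs orbT.
rewrite scaler_sumr -big_split/=; apply: eq_bigr => x _.
by rewrite scalerDl scalerA.
Qed.

End fejer_approximation.

Section density.
Context {R : realType} {N : nat}.
Notation T := (torus_fun R N).
Notation freq := {ffun 'I_N -> int}.

(** The integral of [exp(- i l s) f(x + s e_i)] in [s], that is, [2 pi] times the projection onto
    the [l]-th Fourier mode in the variable [i]. *)
Definition mode (l : int) i (f : T) : T :=
  avg (@cosk_continuous R l) i f - 'i *: avg (@sink_continuous R l) i f.

Lemma mode_partial l i j f : pd j (mode l i f) = mode l i (pd j f).
Proof. by rewrite /mode pdB pdZ !avg_partial. Qed.

Lemma int_realc (l : int) : (l%:~R : R[i]) = (l%:~R : R)%:C.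
Proof. by rewrite rmorph_int. Qed.

Lemma sqri : 'i * 'i = -1 :> R[i].
Proof. by apply/eqP; rewrite eq_complex/=; apply/andP; split; apply/eqP; ring. Qed.

Lemma mode_eigen l i f : pd i (mode l i f) = ('i * l%:~R) *: mode l i f.
Proof.
rewrite mode_partial /mode.
have cs : continuous (fun s : R => - l%:~R * sink l s) by exact: (mulc_continuous (@sink_continuous R l)).
have cc : continuous (fun s : R => l%:~R * cosk l s) by exact: (mulc_continuous (@cosk_continuous R l)).
rewrite (avg_deriv _ cs i f (@cosk_is_derive R l)); last exact: cosk_2pi.
rewrite (avg_deriv _ cc i f (@sink_is_derive R l)); last exact: sink_2pi.
rewrite (avg_kernelZ (@sink_continuous R l) cs i f (fun s => erefl)).
rewrite (avg_kernelZ (@cosk_continuous R l) cc i f (fun s => erefl)).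
set A := avg _ i f; set B := avg _ i f.
have El : (- l%:~R : R)%:C = - l%:~R :> R[i] by rewrite rmorphN/= -int_realc.
apply: tfun_ext => x; rewrite !(tfunB, tfunN, tfunZ) El -!int_realc.
move: (A x) (B x) (l%:~R) => p q z.
have -> : 'i * z * (q - 'i * p) = 'i * z * q - ('i * 'i) * z * p by ring.
by rewrite sqri; ring.
Qed.

Lemma avg_kernel_sum (V : T -> Prop) I (r : seq I) (F : I -> R -> R) i f : subspace V ->
  (forall x (c : continuous (F x)), V (avg c i f)) -> (forall x, continuous (F x)) ->
  forall c : continuous (fun s => \sum_(x <- r) F x s), V (avg c i f).
Proof.
move=> sV VF cF; elim: r => [|x r IH] c.
  have c0 : continuous (fun _ : R => (0 : R)) by move=> x; exact: cvg_cst.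
  rewrite (@avg_kernelZ _ _ (fun=> 0) _ 0 c0); last by move=> s; rewrite big_nil mul0r.
  by rewrite scale0r; exact: sV.1.
have cr : continuous (fun s => \sum_(x <- r) F x s) by exact: sum_continuous.
rewrite (avg_kernelD (cF x) cr); last by move=> s; rewrite big_cons.
by apply: subspaceD.
Qed.

(** The Fejér kernel is a finite combination of cosines, and averaging against [cosk l] is half the
    sum of the modes [l] and [- l]. *)
Lemma favg_mode (V : T -> Prop) i f m : subspace V -> (forall l, V (mode l i f)) ->
  V (favg m i f).
Proof.
move=> sV Vm.
have Vc l (c : continuous (@cosk R l)) : V (avg c i f).
  have -> : avg c i f = (2^-1 : R)%:C *: (mode l i f + mode (- l) i f).
    rewrite /mode.
    rewrite (@avg_kernelZ _ _ (@cosk R l) (cosk (- l)) 1 c); last first.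
      by move=> s; rewrite /cosk mulrNz mulNr cosN mul1r.
    rewrite (@avg_kernelZ _ _ (@sink R l) (sink (- l)) (-1) (@sink_continuous R l)); last first.
      by move=> s; rewrite /sink mulrNz mulNr sinN mulN1r.
    rewrite (@avg_kernelZ _ _ (@cosk R l) (cosk l) 1 c (@cosk_continuous R l)); last by move=> s; rewrite mul1r.
    apply: tfun_ext => x; rewrite !(tfunZ, tfunD, tfunN).
    set p := avg _ i f x; set q := avg _ i f x.
    have h : (2^-1 : R)%:C * 2 = 1 :> R[i].
      by apply/eqP; rewrite eq_complex/=; apply/andP; split; apply/eqP; field.
    have -> : (-1 : R)%:C = -1 :> R[i] by rewrite rmorphN1.
    have -> : (1 : R)%:C = 1 :> R[i] by [].
    move: (_%:C) h => z h; rewrite !mul1r mulN1r.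
    transitivity ((z * 2) * p); first by rewrite h mul1r.
    by move: p q => p q; ring.
  by apply: subspaceZ => //; apply: subspaceD.
have cs : continuous (fun s : R => \sum_(j < m) \sum_(j' < m) cosk (j%:Z - j'%:Z) s).
  by apply: sum_continuous => j; apply: sum_continuous => j'; exact: cosk_continuous.
rewrite /favg (@avg_kernelZ _ _ _ _ (2 * pi * m%:R)^-1 cs)//.
apply: subspaceZ => //; apply: avg_kernel_sum => //; last first.
  by move=> j; apply: sum_continuous => j'; exact: cosk_continuous.
move=> j; apply: (@avg_kernel_sum _ _ _ (fun j' : 'I_m => cosk (j%:Z - j'%:Z))) => //.
by move=> j'; exact: cosk_continuous.
Qed.

Lemma mode_tcl (V : T -> Prop) i f : subspace V -> (forall l, tcl V (mode l i f)) -> tcl V f.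
Proof.
move=> sV H; apply: (tcl_idem (W := tcl V)) => //.
apply: tcvg_tcl (favg_cvg i f) => m; apply: favg_mode => //; exact: tcl_subspace.
Qed.

(** Variables are treated one at a time: a function is a limit of combinations of its modes in one
    variable, each mode is an eigenfunction in that variable, and eigenvalues in earlier variables
    persist. An eigenfunction in all variables is a multiple of an exponential. *)
Theorem expo_dense f : tcl (tspan (@expo R N)) f.
Proof.
pose S := @tspan_subspace R N freq (@expo R N).
suff H n : (n <= N)%N -> forall f, (forall j : 'I_N, (j < N - n)%N ->
    exists l : int, pd j f = ('i * l%:~R) *: f) -> tcl (tspan (@expo R N)) f.
  by apply: (H N) => // j; rewrite subnn.
elim: n => [|n IH] nN {}f Hf.
  have /choice[l Hl] : forall j, exists l : int, pd j f = ('i * l%:~R) *: f.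
    by move=> j; apply: Hf; rewrite subn0.
  have [|c ->] := @eigen_expo R N f [ffun j => l j]; first by move=> j; rewrite ffunE.
  by apply: sub_tcl; apply: subspaceZ => //; exact: tspan_gen.
have iN : (N - n.+1 < N)%N by rewrite ltn_subrL (leq_trans _ nN).
pose i := Ordinal iN.
apply: (mode_tcl (i := i)) => // l; apply: IH; first exact: ltnW.
move=> j jn; have [ji|ji] := eqVneq j i.
  by exists l; rewrite ji mode_eigen.
have [|l' Hl'] := Hf j.
  have : (j : nat) != (N - n.+1)%N by [].
  by move=> jne; rewrite ltn_neqAle jne -ltnS subnSK.
exists l'; rewrite mode_partial Hl' /mode.
have avgZ k (c : continuous k) (z : R[i]) (g : T) : avg c i (z *: g) = z *: avg c i g.
  have avgRlin (u v : 'rV[R]_N -> R) a b x : continuous u -> continuous v ->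
     avgR k i (fun y => a * u y + b * v y) x = a * avgR k i u x + b * avgR k i v x.
    move=> cu cv; rewrite /avgR -!(bfunZ circle_int_bounded); [|exact: kline_continuous..].
    rewrite -(bfunD circle_int_bounded); last 2 first.
    - by apply: mulc_continuous; exact: kline_continuous.
    - by apply: mulc_continuous; exact: kline_continuous.
    by congr circle_int; apply/funext => s; ring.
  apply: tfun_ext => x; rewrite tfunZ /=.
  have -> : (fun y => complex.Re ((z *: g) y)) =
     (fun y => complex.Re z * complex.Re (g y) + (- complex.Im z) * complex.Im (g y)).
    by apply/funext => y; rewrite tfunZ; case: z (g y) => a b [c' d]/=; rewrite mulNr.
  have -> : (fun y => complex.Im ((z *: g) y)) =
     (fun y => complex.Re z * complex.Im (g y) + complex.Im z * complex.Re (g y)).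
    by apply/funext => y; rewrite tfunZ; case: z (g y) => a b [c' d].
  rewrite !avgRlin; try exact: (@tRe_continuous R N g); try exact: (@tIm_continuous R N g).
  by case: z => a b /=; apply/eqP; rewrite eq_complex/= mulNr !eqxx.
by rewrite !avgZ scalerBr !scalerA; congr (_ - _ *: _); exact: mulrC.
Qed.

(** Second derivatives commute on exponentials, and both orders are bounded by [nrm 2], so density
    extends the identity to all smooth functions. *)
Lemma pdC i j (f : T) : pd i (pd j f) = pd j (pd i f).
Proof.
have E g : tspan (@expo R N) g -> pd i (pd j g) = pd j (pd i g).
  move=> [s [c [_ ->]]]; rewrite !pd_sum; apply: eq_bigr => k _.
  by rewrite !(pdZ, expo_partial) !scalerA; congr (_ *: _); ring.
apply/eqP; rewrite -subr_eq0; apply/eqP/(@nrm_eq0 _ _ 0)/le_anti.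
rewrite nrm_ge0 andbT; apply/ler_addgt0Pl => e e0; rewrite addr0.
have [g [Vg hg]] := expo_dense f 2 (divr_gt0 e0 (@ltr0n R 2)).
have -> : pd i (pd j f) - pd j (pd i f) =
  pd i (pd j (f - g)) - pd j (pd i (f - g)).
  by rewrite !pdB (E g Vg); ring.
rewrite (le_trans (nrmB _ _ _))// (splitr e) lerD//;
  by rewrite (le_trans (nrm_partial _ _ _))// (le_trans (nrm_partial _ _ _)).
Qed.

End density.

(** * The Frechet topology *)

Section topology.
Context {R : realType} {N : nat}.
Notation T := (torus_fun R N).

Lemma tword_cat (w1 w2 : seq 'I_N) (f : T) : tword (w1 ++ w2) f = tword w1 (tword w2 f).
Proof. by rewrite /tword foldr_cat. Qed.

Lemma tword_partial i (w : seq 'I_N) (f : T) : tword w (pd i f) = pd i (tword w f).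
Proof. by elim: w => [//|j w IH] /=; rewrite IH pdC. Qed.

Lemma tword_perm (w w' : seq 'I_N) (f : T) : perm_eq w w' -> tword w f = tword w' f.
Proof.
elim: w w' => [|i w IH] w'; first by rewrite perm_sym => /perm_nilP ->.
move=> ww'; have /path.splitPr iw : i \in w' by rewrite -(perm_mem ww') mem_head.
case: iw ww' => w1 w2 ww'.
rewrite tword_cat /= tword_partial -tword_cat -(IH (w1 ++ w2))//.
by rewrite -(perm_cons i) (perm_trans ww')// perm_catC/= perm_cons perm_catC.
Qed.

Lemma mpartial_word (alpha : 'I_N -> nat) (f : T) :
  mpartial alpha f = tword (flatten [seq nseq (alpha i) i | i <- enum 'I_N]) f.
Proof.
rewrite /mpartial; elim: (enum 'I_N) => [//|i s IH] /=; rewrite tword_cat IH.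
by elim: (alpha i) => [//|m IHm] /=; rewrite IHm pd.unlock.
Qed.

(** Since derivatives commute, only the multiplicities of the letters matter; this links the words
    of [nrm] to the multi-indices of [sobolev_norm]. *)
Lemma word_mpartial (w : seq 'I_N) (f : T) : tword w f = mpartial (fun i => count_mem i w) f.
Proof.
rewrite mpartial_word; apply: tword_perm; apply/allP => x _ /=.
rewrite count_flatten -map_comp sumnE big_map (bigD1_seq x)/= ?mem_enum ?enum_uniq//=.
rewrite count_nseq/= eqxx mul1n big1 ?addn0// => i ix.
by rewrite count_nseq/= (negbTE ix) mul0n.
Qed.

Lemma sobolevE k (f : T) : sobolev_norm k f =
  Num.sqrt (\sum_(alpha : {ffun 'I_N -> 'I_k.+1} | (\sum_i alpha i <= k)%N)
    n2 (mpartial (fun i => alpha i) f) ^+ 2).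
Proof.
rewrite /sobolev_norm; congr Num.sqrt; apply: eq_bigr => alpha _.
rewrite n2_sqr ripE RIE; congr torus_Rint; apply/funext => x.
by rewrite tfunM tconjE mul_conjE.
Qed.

Lemma mpartial_nrm (alpha : 'I_N -> nat) (f : T) k : (\sum_i alpha i <= k)%N ->
  n2 (mpartial alpha f) <= nrm k f.
Proof.
move=> ak; rewrite mpartial_word -nrm0E (le_trans (nrm_word _ _ _))// nrm_le//.
rewrite addn0 size_flatten /shape -map_comp sumnE big_map big_enum/=.
by rewrite (eq_bigr (fun i => alpha i))// => i _; rewrite size_nseq.
Qed.

Lemma sobolev_le_nrm k : exists2 C : R, 0 <= C & forall f : T, sobolev_norm k f <= C * nrm k f.
Proof.
pose c := \sum_(alpha : {ffun 'I_N -> 'I_k.+1} | (\sum_i alpha i <= k)%N) (1 : R).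
have c0 : 0 <= c by apply: sumr_ge0.
exists (Num.sqrt c) => [|f]; first exact: sqrtr_ge0.
rewrite sobolevE -[nrm k f]ger0_norm ?nrm_ge0// -sqrtr_sqr -sqrtrM//.
rewrite ler_wsqrtr// /c mulr_suml ler_sum// => alpha ak; rewrite mul1r.
by rewrite ler_pXn2r ?nnegrE ?n2_ge0 ?nrm_ge0// mpartial_nrm.
Qed.

Lemma word_le_sobolev k (w : seq 'I_N) (f : T) : (size w <= k)%N -> n2 (tword w f) <= sobolev_norm k f.
Proof.
move=> wk; have wi i : (count_mem i w < k.+1)%N by rewrite ltnS (leq_trans (count_size _ _)).
pose alpha := [ffun i => Ordinal (wi i)] : {ffun 'I_N -> 'I_k.+1}.
have as_ : (\sum_i alpha i <= k)%N.
  apply: leq_trans wk; rewrite (eq_bigr (fun i => count_mem i w)); last by move=> i _; rewrite ffunE.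
  elim: w {wi alpha} => [|j w IH] /=; first by rewrite big1.
  rewrite big_split/= (bigD1 j)//= eqxx big1 ?addn0 ?add1n// => i ij.
  by rewrite eq_sym (negbTE ij).
have -> : tword w f = mpartial (fun i => alpha i) f.
  rewrite word_mpartial; congr mpartial; apply/funext => i; by rewrite ffunE.
rewrite sobolevE -[leLHS]ger0_norm ?n2_ge0// -sqrtr_sqr ler_wsqrtr//.
rewrite (bigD1 alpha)//= lerDl sumr_ge0// => b _; exact: sqr_ge0.
Qed.

(** Unfolding [nrm k] produces [(N + 1)^k] words of length at most [k], each bounded by the Sobolev
    norm. *)
Lemma nrm_le_sobolev k (f : T) : nrm k f <= (N.+1)%:R ^+ k * sobolev_norm k f.
Proof.
suff H m (w : seq 'I_N) : (size w + m <= k)%N ->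
    nrm m (tword w f) <= (N.+1)%:R ^+ m * sobolev_norm k f by exact: (H k [::]).
elim: m w => [|m IH] w wk; first by rewrite expr0 mul1r nrm0E word_le_sobolev// -(addn0 (size w)).
rewrite nrmS; apply: (@le_trans _ _ ((N.+1)%:R ^+ m * sobolev_norm k f +
    \sum_(i < N) (N.+1)%:R ^+ m * sobolev_norm k f)).
  apply: lerD; first by apply: IH; rewrite (leq_trans _ wk)// leq_add2l.
  by apply: ler_sum => i _; apply: (IH (i :: w)); rewrite addSnnS.
by rewrite sumr_const card_ord -mulrS exprS -mulrA mulr_natl.
Qed.

(** Openness of Sobolev balls for [nrm k]. The squared norm is estimated term by term with
    [(x + e)^2 <= x^2 + e (2 x + 1)] for [e <= 1], in place of Minkowski's inequality. *)
Lemma sobolev_ball k (h f : T) (r : R) : sobolev_norm k (f - h) < r ->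
  exists2 e : R, 0 < e & forall g, nrm k (g - f) <= e -> sobolev_norm k (g - h) < r.
Proof.
move=> fr; have r0 : 0 < r by rewrite (le_lt_trans _ fr)// sqrtr_ge0.
pose P := [pred alpha : {ffun 'I_N -> 'I_k.+1} | (\sum_i alpha i <= k)%N].
pose S := \sum_(alpha | P alpha) n2 (mpartial (fun i => alpha i) (f - h)) ^+ 2.
have S0 : 0 <= S by rewrite sumr_ge0// => a _; exact: sqr_ge0.
have Sr : S < r ^+ 2.
  move: fr; rewrite sobolevE -/S => fr.
  by rewrite -(sqr_sqrtr S0) ltr_pXn2r ?nnegrE ?sqrtr_ge0// ltW.
pose A := \sum_(alpha | P alpha) (2 * n2 (mpartial (fun i => alpha i) (f - h)) + 1).
have A0 : 0 <= A by rewrite sumr_ge0// => a _; rewrite addr_ge0// mulr_ge0// n2_ge0.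
have A1 : 0 < A + 1 by rewrite ltr_wpDl.
pose e := Num.min 1 ((r ^+ 2 - S) / 2 / (A + 1)).
have e0 : 0 < e by rewrite lt_min ltr01/= divr_gt0// divr_gt0// subr_gt0.
have e1 : e <= 1 by rewrite ge_min lexx.
have eA : e * (A + 1) <= (r ^+ 2 - S) / 2.
  by rewrite -ler_pdivlMr// ge_min lexx orbT.
exists e => // g ge; rewrite sobolevE -[r]ger0_norm ?(ltW r0)// -sqrtr_sqr ltr_sqrt; last by rewrite exprn_gt0.
apply: (@le_lt_trans _ _ (S + e * A)); last first.
  have : 0 < r ^+ 2 - S by rewrite subr_gt0.
  nra.
rewrite /S /A mulr_sumr -big_split/=; apply: ler_sum => alpha Pa.
have h1 : n2 (mpartial (fun i => alpha i) (g - h)) <= e + n2 (mpartial (fun i => alpha i) (f - h)).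
  have -> : g - h = (g - f) - (h - f) by ring.
  have -> : f - h = - (h - f) by ring.
  rewrite !mpartial_word; set w := flatten _.
  have -> : tword w (- (h - f)) = - tword w (h - f).
    by elim: w => [//|i w /= ->]; rewrite pdN.
  rewrite n2N (twordB w (g - f)) ; rewrite (le_trans (n2B _ _))// lerD2r (le_trans _ ge)//.
  by rewrite /w -mpartial_word mpartial_nrm.
have h2 := n2_ge0 (mpartial (fun i => alpha i) (f - h)).
have h3 := n2_ge0 (mpartial (fun i => alpha i) (g - h)).
move: h1 h2 h3 e0 e1; nra.
Qed.

(** A basic neighbourhood is a finite intersection of Sobolev balls with arbitrary centres; the
    largest order and the smallest radius give one [nrm] ball centred at [f]. *)
Lemma nbhs_nrmP (f : T) (A : set T) :
  nbhs f A <-> exists k (e : R), 0 < e /\ forall g, nrm k (g - f) <= e -> A g.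
Proof.
split.
  rewrite nbhsE => -[B [[D DD <-] [C DC Cf]] BA].
  have [I ID CE] := DD _ DC.
  suff : exists k (e : R), 0 < e /\ forall g, nrm k (g - f) <= e -> C g.
    move=> [k [e [e0 H]]]; exists k, e; split => // g /H Cg; apply: BA.
    by exists C.
  rewrite -CE in Cf *.
  pose s : seq (T * nat * R) := finmap.enum_fset I.
  have Cf' : forall i, i \in s -> sobolev_norm i.1.2 (f - i.1.1) < i.2 by move=> i iI; exact: (Cf i iI).
  suff : exists k (e : R), 0 < e /\ forall g, nrm k (g - f) <= e ->
      forall i, i \in s -> sobolev_norm i.1.2 (g - i.1.1) < i.2.
    by move=> [k [e [e0 H]]]; exists k, e; split => // g /H Hg i /= iI; exact: Hg.
  elim: s Cf' => [_|i s IH Hs]; first by exists 0%N, 1.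
  have [|k [e [e0 H]]] := IH; first by move=> j js; apply: Hs; rewrite in_cons js orbT.
  have [e' e'0 H'] := sobolev_ball (Hs i (mem_head _ _)).
  exists (maxn k i.1.2), (Num.min e e'); split; first by rewrite lt_min e0.
  move=> g Hg j; rewrite in_cons => /predU1P[->|js].
    apply: H'; rewrite (le_trans (nrm_le _ (leq_maxr k i.1.2)))// (le_trans Hg)//.
    by rewrite ge_min lexx orbT.
  apply: H => //; rewrite (le_trans (nrm_le _ (leq_maxl k i.1.2)))// (le_trans Hg)//.
  by rewrite ge_min lexx.
move=> [k [e [e0 H]]].
have C0 : 0 < (N.+1)%:R ^+ k :> R by rewrite exprn_gt0// ltr0n.
pose B : set T := [set g | sobolev_norm k (g - f) < e / (N.+1)%:R ^+ k].
rewrite nbhsE; exists B.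
  split.
    exists [set B]; last by rewrite bigcup_set1.
    move=> _ ->.
    exact: (@finI_from1 _ T [set b : T * nat * R | 0 < b.2]
      (fun b => [set g | sobolev_norm b.1.2 (g - b.1.1) < b.2])
      (f, k, e / (N.+1)%:R ^+ k) (divr_gt0 e0 C0)).
  have [C _ HC] := sobolev_le_nrm k.
  rewrite /B/= (le_lt_trans (HC _))// subrr nrm0 mulr0 divr_gt0//.
move=> g /= Bg; apply: H; rewrite (le_trans (nrm_le_sobolev _ _))//.
by rewrite mulrC -ler_pdivlMr// ltW.
Qed.

Lemma closed_nrmP (S : set T) : closed S <->
  forall f, (forall k (e : R), 0 < e -> exists2 g, S g & nrm k (g - f) <= e) -> S f.
Proof.
split=> [cS f Hf|H f cf].
  apply: cS => B /nbhs_nrmP[k [e [e0 HB]]].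
  by have [g Sg gf] := Hf k e e0; exists g; split => //; exact: HB.
apply: H => k e e0.
have /cf[g [Sg gf]] : nbhs f [set g | nrm k (g - f) <= e].
  by apply/nbhs_nrmP; exists k, e.
by exists g.
Qed.

Lemma globally_solvableP (Q : T -> T) : globally_solvable Q <->
  forall f, (forall k (e : R), 0 < e -> exists u, nrm k (Q u - f) <= e) -> exists u, Q u = f.
Proof.
rewrite /globally_solvable closed_nrmP; split=> H f Hf.
  have [|u _ <-] := H f; last by exists u.
  by move=> k e e0; have [u Hu] := Hf k e e0; exists (Q u) => //; exists u.
have [|u <-] := H f; last by exists u.
by move=> k e e0; have [_ [u _ <-] Hu] := Hf k e e0; exists u.
Qed.

(** Approximate solutions with error [1 / (m + 1)] in the norm of order [m] converge in each
    coordinate, hence in the product topology. Conversely, finitely many coordinate neighbourhoods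
    intersect in a neighbourhood. *)
Lemma globally_solvable_familyP d (Q : 'I_d -> T -> T) : globally_solvable_family Q <->
  forall F : 'I_d -> T, (forall k (e : R), 0 < e -> exists u, forall j, nrm k (Q j u - F j) <= e) ->
    exists u, forall j, Q j u = F j.
Proof.
rewrite /globally_solvable_family; split=> [cS F HF|H F cF].
  have /choice[u Hu] : forall m : nat, exists u, forall j, nrm m (Q j u - F j) <= m.+1%:R^-1.
    by move=> m; apply: HF; rewrite invr_gt0.
  have cu : (fun m => (fun j => Q j (u m)) : {ptws 'I_d -> T}) @ \oo --> (F : {ptws 'I_d -> T}).
    apply/cvg_sup => j U [V] [[W] oW <-] WF WU.
    have /nbhs_nrmP[k [e [e0 HW]]] : nbhs (F j) W by apply: open_nbhs_nbhs; split.
    have Hm : \forall m \near \oo, W (Q j (u m)).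
      near=> m; apply: HW.
      have km : (k <= m)%N by near: m; exists k.
      rewrite (le_trans (nrm_le _ km))// (le_trans (Hu m j))//.
      by apply: ltW; near: m; exact: (near_infty_natSinv_lt (PosNum e0)).
    by apply: filterS Hm => m Wm; exact: WU.
  have : range (fun f => (fun j => Q j f) : {ptws 'I_d -> T}) F.
    apply: cS => B FB; have [M _ /(_ M (leqnn M)) HM] := cu B FB.
    by exists (fun j => Q j (u M)); split => //; exists (u M).
  by move=> [v _ E]; exists v => j; rewrite -[RHS]/((F : {ptws 'I_d -> T}) j) -E.
have [|u Hu] := H F; last by exists u => //; apply/funext => j; exact: Hu.
move=> k e e0.
have /cF[_ [[u _ <-] Hu]] :
    \forall G \near (F : {ptws 'I_d -> T}), forall j, nrm k (G j - F j) <= e.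
  apply: (@filter_forall _ 'I_d (fun j (G : {ptws 'I_d -> T}) => nrm k (G j - F j) <= e)
    (nbhs (F : {ptws 'I_d -> T})) _) => j.
  have : nbhs (F j) [set g | nrm k (g - F j) <= e] by apply/nbhs_nrmP; exists k, e.
  exact: (@proj_continuous _ (fun _ : 'I_d => T) j F).
by exists u.
Unshelve. all: by end_near. Qed.

End topology.

Section closed_range.
Context {R : realType} {N : nat}.
Notation T := (torus_fun R N).

Lemma bounded_distribution (u : T -> R[i]) k (C : R) : scalar u ->
  (forall phi, normc (u phi) <= C * nrm k phi) -> Defs.distribution u.
Proof.
move=> lu bu; split => // phi A /nbhs_ballP[e /= e0 HA].
have [r [er r0]] : exists r : R, e = r%:C /\ 0 < r.
  exists (complex.Re e); move: e0; rewrite ltcE/= => /andP[/eqP eI ?]; split => //.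
  by apply/eqP; rewrite eq_complex/= eI !eqxx.
have C1 : 0 < `|C| + 1 by rewrite ltr_wpDl.
suff : nbhs phi [set g | A (u g)] by [].
apply/nbhs_nrmP; exists k, (r / 2 / (`|C| + 1)); split; first by rewrite !divr_gt0.
move=> g Hg; apply: HA; rewrite /ball/=.
have -> : u phi - u g = u (phi - g).
  by have := lu (-1) g phi; rewrite !scaleN1r => h; rewrite [phi - g]addrC h addrC mulN1r.
rewrite er; have -> : `|u (phi - g)| = (normc (u (phi - g)))%:C by [].
rewrite ltcR (le_lt_trans (bu _))// nrm_distC.
apply: (@le_lt_trans _ _ ((`|C| + 1) * nrm k (g - phi))).
  rewrite ler_wpM2r ?nrm_ge0// (le_trans (ler_norm C))// lerDl//.
rewrite mulrC; rewrite ler_pdivlMr// in Hg.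
by rewrite (le_lt_trans Hg)// ltr_pdivrMr// ltr_pMr// ltr1n.
Qed.

Lemma tame_tcvg (A : T -> T) u v : tame A -> {morph A : f g / f - g} ->
  tcvg u v -> tcvg (fun m => A (u m)) (A v).
Proof.
move=> tA AB uv k e e0; have [m [C [C0 H]]] := tA k.
have C1 : 0 < C + 1 by rewrite ltr_wpDl.
have := uv m _ (divr_gt0 e0 C1); apply: filterS => p Hp.
rewrite -AB (le_trans (H _))//.
apply: (@le_trans _ _ ((C + 1) * nrm m (u p - v))); first by rewrite ler_wpM2r ?nrm_ge0// lerDl.
by rewrite mulrC -ler_pdivlMr.
Qed.

(** [V] plays the role of a complement of the common kernel: approximate solutions can be moved into
    it with little change in their images, and there the estimate makes them Cauchy. The limit may
    leave [V]; only its images matter. *)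
Lemma closed_range_of_estimate d (Q : 'I_d -> T -> T) (V : T -> Prop) :
  (forall j, tame (Q j)) -> (forall j, {morph Q j : f g / f - g}) ->
  (forall f g, V f -> V g -> V (f - g)) ->
  (forall k, exists m (C : R), 0 <= C /\ forall u, V u -> nrm k u <= C * \sum_j nrm m (Q j u)) ->
  (forall u k (e : R), 0 < e -> exists u', V u' /\ forall j, nrm k (Q j u' - Q j u) <= e) ->
  forall F : 'I_d -> T, (forall k (e : R), 0 < e -> exists u, forall j, nrm k (Q j u - F j) <= e) ->
    exists u, forall j, Q j u = F j.
Proof.
move=> tQ QB VB est dns F HF.
have /choice[u Hu] : forall m : nat, exists u, V u /\ forall j, nrm m (Q j u - F j) <= m.+1%:R^-1.
  move=> m; have e0 : 0 < m.+1%:R^-1 / 2 :> R by rewrite divr_gt0// invr_gt0.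
  have [u Hu] := HF m _ e0; have [u' [Vu' Hu']] := dns u m _ e0.
  exists u'; split => // j.
  have -> : Q j u' - F j = (Q j u' - Q j u) + (Q j u - F j) by rewrite addrA subrK.
  by rewrite (le_trans (nrmD _ _ _))// (splitr m.+1%:R^-1) lerD.
have QF j : tcvg (fun m => Q j (u m)) (F j).
  move=> k e e0; near=> m.
  have km : (k <= m)%N by near: m; exists k.
  have [_ /(_ j) h] := Hu m; rewrite (le_trans (nrm_le _ km))// (le_trans h)//.
  by apply: ltW; near: m; exact: (near_infty_natSinv_lt (PosNum e0)).
have cu : tcauchy u.
  move=> k e e0; have [m [C [C0 H]]] := est k.
  have L0 : 0 < e / (2 * C * d%:R + 1) by rewrite divr_gt0// ltr_wpDl// !mulr_ge0.
  have [M0 _ HM0] := near_infty_natSinv_lt (PosNum L0).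
  exists (maxn m M0) => p q; rewrite !geq_max => /andP[mp Mp] /andP[mq Mq].
  have hp r : (m <= r)%N -> (M0 <= r)%N -> forall j, nrm m (Q j (u r) - F j) <= e / (2 * C * d%:R + 1).
    move=> mr Mr j; have [_ /(_ j) h] := Hu r; rewrite (le_trans (nrm_le _ mr))// (le_trans h)//.
    by rewrite ltW//; have := HM0 r Mr.
  rewrite (le_trans (H _ (VB _ _ (Hu p).1 (Hu q).1)))//.
  apply: (@le_trans _ _ (C * \sum_(j < d) 2 * (e / (2 * C * d%:R + 1)))).
    rewrite ler_wpM2l//; apply: ler_sum => j _; rewrite QB.
    have -> : Q j (u p) - Q j (u q) = (Q j (u p) - F j) - (Q j (u q) - F j) by ring.
    by rewrite (le_trans (nrmB _ _ _))// mulr_natl mulr2n lerD// hp.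
  rewrite sumr_const card_ord -[X in C * X]mulr_natr.
  have -> : C * (2 * (e / (2 * C * d%:R + 1)) * d%:R) = e * (2 * C * d%:R / (2 * C * d%:R + 1)).
    by field; rewrite gt_eqF// ltr_wpDl// !mulr_ge0.
  by rewrite ler_piMr ?(ltW e0)// ler_pdivrMr ?ltr_wpDl ?mulr_ge0// mul1r lerDl.
have [v uv] := torus_complete cu.
exists v => j; apply: (tcvg_unique (u := fun m => Q j (u m))) => //.
exact: tame_tcvg.
Unshelve. all: by end_near. Qed.

End closed_range.

(** * Operators with an orthogonal family of eigenfunctions *)

Section diagonal.
Context {R : realType} {N : nat}.
Notation T := (torus_fun R N).
Context {K : eqType} (E : K -> T) {d : nat} (Y : 'I_d -> T -> T) (l : 'I_d -> K -> R).

(** Common structure of the exponentials with the coordinate derivatives and of the gauged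
    exponentials with the frame of the tube. Orthogonality is not postulated: it follows from
    [eig_skew] and [eig_sep]. *)
Record eigenfamily : Prop := Eigenfamily {
  eigD : forall i, {morph Y i : f g / f + g} ;
  eigZ : forall i (c : R[i]), {morph Y i : f / c *: f} ;
  eigE : forall i x, Y i (E x) = ('i * (l i x)%:C) *: E x ;
  eig_skew : forall i f g, rip (Y i f) g = - rip f (Y i g) ;
  eig_tame : forall i, tame (Y i) ;
  eig_nrm : forall k, exists2 C : R, 0 <= C & forall f, nrm k f <= C * gn Y k f ;
  eig_unit : forall x, E x * tconj (E x) = 1 ;
  eig_sep : forall x y, x != y -> exists i, l i x != l i y ;
  eig_dense : forall f, tcl (tspan E) f }.

Hypothesis H : eigenfamily.

Let YD := eigD H.
Let YZ := eigZ H.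

(** The eigenvalue of [1 - sum_i Y_i^2] on [E x]. *)
Definition weight x : R := 1 + \sum_i l i x ^+ 2.

Lemma weight_ge1 x : 1 <= weight x.
Proof. by rewrite /weight lerDl sumr_ge0// => i _; exact: sqr_ge0. Qed.

Lemma weight_gt0 x : 0 < weight x. Proof. exact: lt_le_trans (weight_ge1 x). Qed.

Definition comb (s : seq K) (c : K -> R[i]) : T := \sum_(x <- s) c x *: E x.

Lemma ripJ (f g : T) : rip ('i *: f) g = - rip f ('i *: g).
Proof.
rewrite ripZ -ripNr; congr rip; rewrite -scaleNr; congr (_ *: _).
by apply/eqP; rewrite eq_complex/= oppr0 !eqxx.
Qed.

(** Eigenvectors of a skew operator with distinct eigenvalues. As [rip] is only a real part,
    comparing eigenvalues yields orthogonality with an extra factor ['i], which is absorbed in the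
    arbitrary coefficient [b]. *)
Lemma eig_orth x y (c c' : R[i]) : x != y -> rip (c *: E x) (c' *: E y) = 0.
Proof.
move=> /(eig_sep H)[i lxy].
suff G (b : R[i]) : rip ('i *: (b *: E x)) (c' *: E y) = 0.
  have := G (- 'i * c); rewrite scalerA mulNr mulrN mulrA sqri mulN1r opprK//.
have := eig_skew H i (b *: E x) (c' *: E y).
rewrite !YZ !(eigE H).
have -> : b *: (('i * (l i x)%:C) *: E x) = (l i x)%:C *: ('i *: (b *: E x)).
  by rewrite !scalerA; congr (_ *: _); ring.
have -> : c' *: (('i * (l i y)%:C) *: E y) = (l i y)%:C *: ('i *: (c' *: E y)).
  by rewrite !scalerA; congr (_ *: _); ring.
rewrite ripZrl ripZrr -mulrN -ripJ => /eqP; rewrite -subr_eq0 -mulrBl mulf_eq0.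
by rewrite subr_eq0 (negbTE lxy) => /eqP.
Qed.

Lemma rip_eigE x (c c' : R[i]) : rip (c *: E x) (c' *: E x) = complex.Re (c * conjc c') * @vol R N.
Proof.
rewrite ripE tconjZ -tscalerAl -tscalerAr (eig_unit H) scalerA.
rewrite RIE /vol -torus_Rint_cst; congr torus_Rint; apply/funext => z.
by rewrite tfunZ tfun1 mulr1.
Qed.

Lemma normc_sqr (c : R[i]) : normc c ^+ 2 = complex.Re c ^+ 2 + complex.Im c ^+ 2.
Proof. by case: c => a b /=; rewrite sqr_sqrtr// addr_ge0// sqr_ge0. Qed.

Lemma rip_eig_sqr x (c : R[i]) : rip (c *: E x) (c *: E x) = normc c ^+ 2 * @vol R N.
Proof. by rewrite rip_eigE mul_conjE normc_sqr. Qed.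

Lemma rip_comb s (c c' : K -> R[i]) : uniq s ->
  rip (comb s c) (comb s c') = \sum_(x <- s) rip (c x *: E x) (c' x *: E x).
Proof.
move=> us; rewrite rip_suml big_seq [RHS]big_seq; apply: eq_bigr => x xs.
rewrite rip_sumr (bigD1_seq x)//= big1 ?addr0// => y yx.
by rewrite eig_orth// eq_sym.
Qed.

(** The squared norm of order [k] read on coefficients: on finite sums its square root is [gn Y k]
    up to a factor depending on [k] and [d] only. *)
Definition wsum k s (c : K -> R[i]) : R := \sum_(x <- s) weight x ^+ k * normc (c x) ^+ 2 * @vol R N.

Lemma wsum_ge0 k s c : 0 <= wsum k s c.
Proof.
apply: sumr_ge0 => x _; apply: mulr_ge0; last exact: (ltW vol_gt0).
by apply: mulr_ge0; [rewrite exprn_ge0// ltW// weight_gt0|exact: sqr_ge0].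
Qed.

Lemma n2_comb s c : uniq s -> n2 (comb s c) = Num.sqrt (wsum 0 s c).
Proof.
move=> us; rewrite -[LHS]ger0_norm ?n2_ge0// -sqrtr_sqr n2_sqr rip_comb//.
congr Num.sqrt; apply: eq_bigr => x _.
by rewrite rip_eig_sqr expr0 mul1r.
Qed.

Lemma Y_comb i s c : Y i (comb s c) = comb s (fun x => c x * ('i * (l i x)%:C)).
Proof.
have Y0 : Y i 0 = 0 by apply: (addrI (Y i 0)); rewrite -YD !addr0.
rewrite /comb (big_morph (Y i) (YD i) Y0); apply: eq_bigr => x _.
by rewrite YZ (eigE H) scalerA.
Qed.

Lemma normc_i : normc ('i : R[i]) = 1.
Proof. by rewrite /= expr0n/= add0r expr1n sqrtr1. Qed.

Lemma wsum_Y k i s c : wsum k s (fun x => c x * ('i * (l i x)%:C)) =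
  \sum_(x <- s) weight x ^+ k * (l i x ^+ 2 * normc (c x) ^+ 2) * @vol R N.
Proof.
apply: eq_bigr => x _; congr (_ * _ * _).
rewrite !ComplexField.Normc.normcM normc_i mul1r normc_real exprMn real_normK ?num_real//.
by rewrite mulrC.
Qed.

Lemma wsumS k s c : wsum k.+1 s c = wsum k s c +
  \sum_i wsum k s (fun x => c x * ('i * (l i x)%:C)).
Proof.
under [X in _ + X]eq_bigr do rewrite wsum_Y.
rewrite exchange_big/= -big_split/=; apply: eq_bigr => x _.
rewrite exprS /weight mulrDl mul1r !mulrDl; congr (_ + _).
rewrite !mulr_suml; apply: eq_bigr => i _; ring.
Qed.

Lemma gn_comb_le k s c : uniq s ->
  gn Y k (comb s c) <= (d.+1)%:R ^+ k * Num.sqrt (wsum k s c).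
Proof.
move=> us; elim: k c => [|k IH] c; first by rewrite expr0 mul1r /= n2_comb.
rewrite gnS; apply: (@le_trans _ _ ((d.+1)%:R ^+ k * Num.sqrt (wsum k.+1 s c) +
   \sum_(i < d) (d.+1)%:R ^+ k * Num.sqrt (wsum k.+1 s c))).
  apply: lerD.
    rewrite (le_trans (IH c))// ler_wpM2l ?exprn_ge0// ler_wsqrtr// wsumS lerDl.
    by apply: sumr_ge0 => i _; exact: wsum_ge0.
  apply: ler_sum => i _; rewrite Y_comb (le_trans (IH _))// ler_wpM2l ?exprn_ge0//.
  rewrite ler_wsqrtr// wsumS (bigD1 i)//= addrCA lerDl addr_ge0 ?wsum_ge0//.
  by apply: sumr_ge0 => j _; exact: wsum_ge0.
by rewrite sumr_const card_ord -mulrS exprS -mulrA mulr_natl.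
Qed.

Lemma wsum_le_gn k s c : uniq s -> Num.sqrt (wsum k s c) <= gn Y k (comb s c).
Proof.
move=> us; elim: k c => [|k IH] c; first by rewrite /= n2_comb.
have g0 f : 0 <= gn Y k f by exact: gn_ge0.
rewrite -[leRHS]ger0_norm ?gn_ge0// -sqrtr_sqr ler_wsqrtr// wsumS gnS.
apply: (@le_trans _ _ (gn Y k (comb s c) ^+ 2 + \sum_i gn Y k (Y i (comb s c)) ^+ 2)).
  apply: lerD; first by rewrite -(sqr_sqrtr (wsum_ge0 k s c)) ler_pXn2r ?nnegrE ?sqrtr_ge0.
  apply: ler_sum => i _; rewrite Y_comb -(sqr_sqrtr (wsum_ge0 k s _)).
  by rewrite ler_pXn2r ?nnegrE ?sqrtr_ge0.
have sq (r : seq 'I_d) (F : 'I_d -> R) : (forall i, 0 <= F i) ->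
    \sum_(i <- r) F i ^+ 2 <= (\sum_(i <- r) F i) ^+ 2.
  move=> F0; elim: r => [|i r IHr]; first by rewrite !big_nil expr0n.
  rewrite !big_cons; have : 0 <= \sum_(j <- r) F j by apply: sumr_ge0.
  by have := F0 i; move: IHr; move: (\sum_(j <- r) F j) (F i) => a b; nra.
have := sq (index_enum 'I_d) (fun i => gn Y k (Y i (comb s c))) (fun i => g0 _).
have : 0 <= \sum_i gn Y k (Y i (comb s c)) by apply: sumr_ge0.
have := g0 (comb s c).
set a := gn Y k (comb s c); set b := \sum_i gn Y k (Y i (comb s c)).
set b' := \sum_i gn Y k (Y i (comb s c)) ^+ 2; move: a b b' => a b b'; nra.
Qed.

Lemma gn_le_nrm k : exists m (C : R), 0 <= C /\ forall f, gn Y k f <= C * nrm m f.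
Proof.
elim: k => [|k [m [C [C0 IH]]]].
  by exists 0%N, 1; split => // f; rewrite mul1r nrm0E.
have /choice[p Hp] : forall i, exists p : nat * R, 0 <= p.2 /\ forall f, nrm m (Y i f) <= p.2 * nrm p.1 f.
  by move=> i; have [m' [C' [C'0 H']]] := eig_tame H i m; exists (m', C').
pose M := maxn m (\max_i (p i).1).
exists M, (C + \sum_i C * (p i).2); split.
  by rewrite addr_ge0// sumr_ge0// => i _; rewrite mulr_ge0//; have [] := Hp i.
move=> f; rewrite gnS mulrDl mulr_suml; apply: lerD.
  by rewrite (le_trans (IH f))// ler_wpM2l// nrm_le// leq_maxl.
apply: ler_sum => i _; rewrite (le_trans (IH _))// -mulrA ler_wpM2l//.
have [p0 hp] := Hp i; rewrite (le_trans (hp _))// ler_wpM2l// nrm_le//.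
by rewrite leq_max (leq_bigmax i) orbT.
Qed.

Definition nonresonant (res : K -> bool) (f : T) := exists (s : seq K) (c : K -> R[i]),
  [/\ uniq s, all (fun x => ~~ res x) s & f = comb s c].

Lemma nonresonant_subspace res : subspace (nonresonant res).
Proof.
split; first by exists [::], (fun=> 0); rewrite /comb big_nil.
move=> b f g [s [c [us sr ->]]] [s' [c' [us' sr' ->]]].
have [t [a [ut ta]]] : tspan E (b *: comb s c + comb s' c').
  have [_] := tspan_subspace E; apply; first by exists s, c.
  by exists s', c'.
pose t' := [seq x <- t | ~~ res x].
exists t', a; split; first exact: filter_uniq.
  by apply/allP => x; rewrite mem_filter => /andP[].
rewrite ta /comb big_filter (bigID (fun x => ~~ res x))/= [X in _ + X = _](_ : _ = 0) ?addr0//.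
(* The resonant part is orthogonal to itself. *)
apply: rip_eq0.
set h := \sum_(i <- t | _) _.
have hr : forall x, res x -> forall z : R[i], rip (b *: comb s c + comb s' c') (z *: E x) = 0.
  move=> x rx z; rewrite ripDl /comb scaler_sumr !rip_suml !big_seq !big1 ?addr0// => y ys.
    rewrite eig_orth//; apply: contraL rx => /eqP <-; exact: (allP sr').
  by rewrite scalerA eig_orth//; apply: contraL rx => /eqP <-; exact: (allP sr).
have h1 : rip (b *: comb s c + comb s' c') h = 0.
  by rewrite rip_sumr big1// => x; rewrite negbK => rx; exact: hr.
rewrite ta (bigID (fun x => ~~ res x))/= -/h ripDl in h1.
rewrite -[RHS]h1 -[LHS]add0r; congr (_ + _).
rewrite rip_suml big1// => x rx; rewrite rip_sumr big1// => y ry.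
by rewrite eig_orth//; apply: contraNneq rx => ->; move: ry; rewrite negbK.
Qed.

(** The resonant part [p] of any approximation [g] of [f] may be deleted: orthogonality of [f] to it
    gives [rip p p = - rip (f - g) p], so [n2 p <= n2 (f - g)]. The derivatives [Y i f] satisfy the
    same orthogonality, whence the bound in every [gn Y k]. *)
Lemma tcl_nonresonant (res : K -> bool) (f : T) :
  (forall x, res x -> forall z : R[i], rip f (z *: E x) = 0) -> tcl (nonresonant res) f.
Proof.
move=> fr.
have gnB' k u v : gn Y k (u - v) <= gn Y k u + gn Y k v.
  by apply: gnB => [i x y|i c' x]; [exact: YD|exact: YZ].
have key k : forall f, (forall x, res x -> forall z : R[i], rip f (z *: E x) = 0) ->
    forall s c, uniq s -> gn Y k (comb [seq x <- s | res x] c) <= gn Y k (f - comb s c).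
  elim: k => [|k IH] g gr s c us.
    rewrite /=; set p := comb [seq x <- s | res x] c.
    have gp : rip g p = 0.
      rewrite rip_sumr big_seq big1// => x; rewrite mem_filter => /andP[rx _]; exact: gr.
    have cp : rip (comb s c) p = rip p p.
      rewrite {1}/comb (bigID res)/= ripDl -[X in X + _]/(rip _ p) /p /comb big_filter.
      rewrite [X in _ + X](_ : _ = 0) ?addr0//.
      rewrite rip_suml big1// => x rx; rewrite rip_sumr big1// => y ry.
      by rewrite eig_orth//; apply: contraNneq rx => ->.
    have : rip p p <= n2 (g - comb s c) * n2 p.
      by have := ripN_le (g - comb s c) p; rewrite ripBl gp cp sub0r opprK.
    rewrite -n2_sqr expr2; have [->|p0] := eqVneq (n2 p) 0; first by rewrite n2_ge0.
    have p1 : 0 < n2 p by rewrite lt_neqAle eq_sym p0 n2_ge0.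
    by move=> h; rewrite (ler_pM2r p1) in h; exact: h.
  rewrite !gnS; apply: lerD; first exact: IH.
  apply: ler_sum => i _; rewrite Y_comb.
  have YB u v : Y i (u - v) = Y i u - Y i v.
    by rewrite YD -scaleN1r YZ scaleN1r.
  rewrite YB Y_comb; apply: IH => // x rx z.
  rewrite (eig_skew H) YZ (eigE H) scalerA gr ?oppr0//.
move=> k e e0; have [C C0 HC] := eig_nrm H k; have [m [C' [C'0 HC']]] := gn_le_nrm k.
have C1 : 0 < 2 * C * C' + 1 by rewrite ltr_wpDl// !mulr_ge0.
have [g [[s [c [us gE]]] Hg]] := eig_dense H f m (divr_gt0 e0 C1).
exists (comb [seq x <- s | ~~ res x] c); split.
  exists [seq x <- s | ~~ res x], c; split => //; first exact: filter_uniq.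
  by apply/allP => x; rewrite mem_filter => /andP[].
have -> : f - comb [seq x <- s | ~~ res x] c = (f - comb s c) - (- comb [seq x <- s | res x] c).
  have -> : comb s c = comb [seq x <- s | res x] c + comb [seq x <- s | ~~ res x] c.
    by rewrite /comb !big_filter (bigID res).
  by ring.
rewrite (le_trans (HC _))//.
apply: (@le_trans _ _ (C * (2 * gn Y k (f - comb s c)))).
  rewrite ler_wpM2l// (le_trans (gnB' _ _ _))// mulr_natl mulr2n lerD//.
  rewrite gnN; last by move=> i z u; exact: YZ.
  exact: key.
apply: (@le_trans _ _ (C * (2 * (C' * nrm m (f - comb s c))))).
  by rewrite !ler_wpM2l.
rewrite gE -/(comb s c) ler_pdivlMr// in Hg; rewrite (le_trans _ Hg)//.
have := nrm_ge0 m (f - comb s c); move: (nrm _ _) => z z0.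
have -> : C * (2 * (C' * z)) = z * (2 * C * C') by ring.
by rewrite ler_wpM2l// lerDl.
Qed.

Lemma coef_eq0 (f : T) : (forall x (z : R[i]), rip f (z *: E x) = 0) -> f = 0.
Proof.
move=> f0; apply: rip_eq0; apply: le_anti; rewrite rip_ge0 andbT.
apply/ler_addgt0Pl => e e0; rewrite addr0.
have F1 : 0 < n2 f + 1 by rewrite ltr_wpDl// n2_ge0.
have [g [[s [c [us gE]]] Hg]] := eig_dense H f 0 (divr_gt0 e0 F1).
have -> : rip f f = rip f (f - g).
  by rewrite ripBr gE rip_sumr big1 ?subr0.
rewrite (le_trans (rip_le _ _))//.
rewrite nrm0E ler_pdivlMr// in Hg; rewrite (le_trans _ Hg)// mulrC.
by rewrite ler_wpM2l ?n2_ge0// lerDl.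
Qed.

Section diagonal_system.
Context {m : nat} (Q : 'I_m -> T -> T) (q : 'I_m -> K -> R[i]).
Hypothesis Qtame : forall j, tame (Q j).
Hypothesis QD : forall j, {morph Q j : f g / f + g}.
Hypothesis QZ : forall j (c : R[i]), {morph Q j : f / c *: f}.
Hypothesis QE : forall j x, Q j (E x) = q j x *: E x.

Lemma Q_comb j s c : Q j (comb s c) = comb s (fun x => c x * q j x).
Proof.
have Q0 : Q j 0 = 0 by apply: (addrI (Q j 0)); rewrite -QD !addr0.
rewrite /comb (big_morph (Q j) (QD j) Q0); apply: eq_bigr => x _.
by rewrite QZ QE scalerA.
Qed.

Let QB j : {morph Q j : f g / f - g}.
Proof. by move=> f g; rewrite QD -scaleN1r QZ scaleN1r. Qed.

(** The hypothesis bounds the joint symbol below by a negative power of the weight off the common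
    kernel, so inverting costs finitely many derivatives. The estimate is needed only on finite
    nonresonant sums, which serve as the subspace [V]. *)
Lemma diagonal_closed_range (C : R) (M : nat) : 0 <= C ->
  (forall x, (forall j, q j x = 0) \/ 1 <= C * weight x ^+ M * \sum_j normc (q j x) ^+ 2) ->
  forall F : 'I_m -> T, (forall k (e : R), 0 < e -> exists u, forall j, nrm k (Q j u - F j) <= e) ->
    exists u, forall j, Q j u = F j.
Proof.
move=> C0 DC; pose res x := [forall j, q j x == 0].
apply: (closed_range_of_estimate (V := nonresonant res)) => //.
- by move=> f g; apply: subspaceB; exact: nonresonant_subspace.
- move=> k; have [Ck Ck0 Hk] := eig_nrm H k.
  have [p [C' [C'0 Hp]]] := gn_le_nrm (k + M)%N.
  exists p, (Ck * ((d.+1)%:R ^+ k * (Num.sqrt C * C'))).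
  split; first by rewrite !mulr_ge0// ?exprn_ge0// sqrtr_ge0.
  move=> u [s [c [us sr ->]]].
  rewrite (le_trans (Hk _))// -!mulrA ler_wpM2l// (le_trans (gn_comb_le k c us))//.
  rewrite ler_wpM2l ?exprn_ge0//.
  set S := \sum_j gn Y (k + M) (Q j (comb s c)).
  have S0 : 0 <= S by apply: sumr_ge0 => j _; exact: gn_ge0.
  apply: (@le_trans _ _ (Num.sqrt C * S)); last first.
    rewrite ler_wpM2l ?sqrtr_ge0// mulr_sumr; apply: ler_sum => j _; exact: Hp.
  rewrite -(@ler_pXn2r _ 2)// ?nnegrE ?mulr_ge0 ?sqrtr_ge0//.
  rewrite exprMn !sqr_sqrtr ?wsum_ge0//.
  apply: (@le_trans _ _ (C * \sum_j wsum (k + M) s (fun x => c x * q j x))); last first.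
    rewrite ler_wpM2l//.
    apply: (@le_trans _ _ (\sum_j gn Y (k + M) (Q j (comb s c)) ^+ 2)).
      apply: ler_sum => j _; rewrite Q_comb -(sqr_sqrtr (wsum_ge0 _ _ _)).
      by rewrite ler_pXn2r ?nnegrE ?sqrtr_ge0 ?gn_ge0// wsum_le_gn.
    rewrite /S; elim: (index_enum _) => [|j r IHr]; first by rewrite !big_nil expr0n.
    rewrite !big_cons; set a := gn _ _ _; set b := \sum_(j <- r) _; set b' := \sum_(j <- r) _.
    have a0 : 0 <= a by exact: gn_ge0.
    have b0 : 0 <= b' by apply: sumr_ge0 => i _; exact: gn_ge0.
    move: IHr; rewrite -/b -/b'; nra.
  rewrite exchange_big/= mulr_sumr /wsum big_seq [leRHS]big_seq; apply: ler_sum => x xs.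
  have [q0|h] := DC x.
    have := allP sr x xs; suff -> : res x by [].
    by apply/forallP => j; apply/eqP.
  have -> : C * \sum_(j < m) weight x ^+ (k + M) * normc (c x * q j x) ^+ 2 * @vol R N =
     (weight x ^+ k * normc (c x) ^+ 2 * @vol R N) * (C * weight x ^+ M * \sum_j normc (q j x) ^+ 2).
    rewrite !mulr_sumr; apply: eq_bigr => j _.
    rewrite ComplexField.Normc.normcM exprD; ring.
  rewrite ler_peMr//; apply: mulr_ge0; last exact: (ltW vol_gt0).
  by apply: mulr_ge0; [rewrite exprn_ge0// ltW// weight_gt0|exact: sqr_ge0].
- move=> u k e e0.
  have /choice[pm Hpm] : forall j, exists pm : nat * R, 0 <= pm.2 /\ forall f, nrm k (Q j f) <= pm.2 * nrm pm.1 f.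
    by move=> j; have [m' [C' [? ?]]] := Qtame j k; exists (m', C').
  pose M' := \max_j (pm j).1; pose A := 1 + \sum_j (pm j).2.
  have A0 : 0 < A by rewrite ltr_pwDl// sumr_ge0// => j _; have [] := Hpm j.
  have [g [[s [c [us gE]]] Hg]] := eig_dense H u M' (divr_gt0 e0 A0).
  exists (comb [seq x <- s | ~~ res x] c); split.
    exists [seq x <- s | ~~ res x], c; split => //; first exact: filter_uniq.
    by apply/allP => x; rewrite mem_filter => /andP[].
  move=> j.
  have -> : Q j (comb [seq x <- s | ~~ res x] c) = Q j (comb s c).
    rewrite !Q_comb /comb big_filter [RHS](bigID res)/= [X in _ = X + _](_ : _ = 0) ?add0r//.
    by rewrite big1// => x /forallP/(_ j)/eqP ->; rewrite mulr0 scale0r.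
  rewrite gE -/(comb s c) nrm_distC ler_pdivlMr// mulrC in Hg.
  rewrite -QB; have [p0 hp] := Hpm j; rewrite (le_trans (hp _))// (le_trans _ Hg)//.
  apply: ler_pM => //; first exact: nrm_ge0.
    rewrite /A (bigD1 j)//= addrCA lerDl addr_ge0// sumr_ge0// => i _; by have [] := Hpm i.
  by rewrite nrm_le// (leq_bigmax j).
Qed.

End diagonal_system.

End diagonal.

(** * The Laplacian on functions of mean zero *)

Section laplacian.
Context {R : realType} {N : nat}.
Notation T := (torus_fun R N).
Notation freq := {ffun 'I_N -> int}.

Lemma expo_eigenfamily : eigenfamily (@expo R N) (@pd R N) (fun i k => (k i)%:~R).
Proof.
split.
- exact: pdD.
- by move=> i c f; rewrite pdZ.
- by move=> i k; rewrite expo_partial int_realc.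
- exact: rip_partial.
- exact: tame_partial.
- by move=> k; exists 1 => // f; rewrite mul1r.
- exact: expo_conj.
- move=> x y xy; apply/existsP; move: xy; apply: contraR; rewrite negb_exists => /forallP E.
  by apply/eqP/ffunP => i; move: (E i); rewrite negbK eqr_int => /eqP.
- exact: expo_dense.
Qed.

Definition freq0 : freq := [ffun=> 0].

Lemma expo0 : expo freq0 = 1 :> T.
Proof.
apply: tfun_ext => x; rewrite tcisE /linear_phase big1; last by move=> i _; rewrite ffunE mul0r.
by rewrite cos0 sin0.
Qed.

Definition mean_zero (f : T) := forall z : R[i], rip f (z *: (1 : T)) = 0.

Lemma mean_zero_partial i f : mean_zero (pd i f).
Proof. by move=> z; rewrite rip_partial pdZ pd1 scaler0 rip0r oppr0. Qed.

Lemma mean_zeroB f g : mean_zero f -> mean_zero g -> mean_zero (f - g).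
Proof. by move=> hf hg z; rewrite ripBl hf hg subrr. Qed.

Lemma mean_zeroZ (c : R[i]) f : mean_zero f -> mean_zero (c *: f).
Proof. by move=> hf z; rewrite ripZ scalerA hf. Qed.

Lemma mean_zero_sum I (r : seq I) (P : pred I) (F : I -> T) :
  (forall i, P i -> mean_zero (F i)) -> mean_zero (\sum_(i <- r | P i) F i).
Proof. by move=> hF z; rewrite rip_suml big1// => i Pi; exact: hF. Qed.

Lemma rip_cst (c z : R[i]) : rip (c *: (1 : T)) (z *: (1 : T)) = complex.Re (c * conjc z) * @vol R N.
Proof. by rewrite -expo0 (rip_eigE expo_eigenfamily). Qed.

Lemma mean_proj f : exists c : R[i], mean_zero (f - c *: (1 : T)).
Proof.
have v0 : @vol R N != 0 by rewrite gt_eqF// vol_gt0.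
exists ((rip f (1 : T) / @vol R N) +i* (rip f ('i *: (1 : T)) / @vol R N)) => z.
rewrite ripBl rip_cst.
have -> : z *: (1 : T) = (complex.Re z)%:C *: (1 : T) + (complex.Im z)%:C *: ('i *: (1 : T)).
  by rewrite scalerA -scalerDl; congr (_ *: _); apply/eqP; rewrite eq_complex; case: z => a b /=;
    apply/andP; split; apply/eqP; ring.
rewrite ripDr !ripZrr; case: z => a b /=; move: (rip _ _) (rip _ _) (vol) v0 => p q v v0.
by field.
Qed.

Lemma mean_zero_res f : mean_zero f -> forall k, k == freq0 -> forall z : R[i], rip f (z *: expo k) = 0.
Proof. by move=> mf k /eqP -> z; rewrite expo0. Qed.

Lemma freq_norm (k : freq) : k != freq0 -> 1 <= \sum_i (k i)%:~R ^+ 2 :> R.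
Proof.
move=> k0; have [i ki] : exists i, k i != 0.
  apply/existsP; move: k0; apply: contraR; rewrite negb_exists => /forallP E.
  by apply/eqP/ffunP => i; move: (E i); rewrite negbK ffunE => /eqP.
rewrite (bigD1 i)//=; apply: (@le_trans _ _ ((k i)%:~R ^+ 2)).
  by rewrite -rmorphXn/= -[1]/(1%:~R) ler_int -gtz0_ge1 exprn_even_gt0.
by rewrite lerDl sumr_ge0// => j _; exact: sqr_ge0.
Qed.

Lemma sum_sqr_le (I : Type) (r : seq I) (F : I -> R) : (forall i, 0 <= F i) ->
  \sum_(i <- r) F i ^+ 2 <= (\sum_(i <- r) F i) ^+ 2.
Proof.
move=> F0; elim: r => [|i r IHr]; first by rewrite !big_nil expr0n.
rewrite !big_cons; have : 0 <= \sum_(j <- r) F j by apply: sumr_ge0.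
by have := F0 i; move: IHr; move: (\sum_(j <- r) F j) (F i) => a b; nra.
Qed.

Lemma sqr_sum_le m (G : 'I_m -> R) : (\sum_j G j) ^+ 2 <= m%:R * \sum_j G j ^+ 2.
Proof.
have alg (p g S Q : R) : 0 <= p -> 0 <= Q -> S ^+ 2 <= p * Q ->
    (g + S) ^+ 2 <= (p + 1) * (g ^+ 2 + Q).
  move=> p0 Q0 h; have k0 : 0 <= p * g ^+ 2 + Q by rewrite addr_ge0// mulr_ge0// sqr_ge0.
  suff : 2 * g * S <= p * g ^+ 2 + Q by move: h; clear; nra.
  rewrite (le_trans (ler_norm _))// -(@ler_pXn2r _ 2)// ?nnegrE// -normrX ger0_norm ?sqr_ge0//.
  have := mulr_ge0 (sqr_ge0 g) (_ : 0 <= p * Q - S ^+ 2); rewrite subr_ge0 => /(_ h).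
  have := sqr_ge0 (p * g ^+ 2 - Q); clear; nra.
elim: m G => [|m IH] G; first by rewrite !big_ord0 expr0n mul0r.
rewrite !big_ord_recl -natr1; apply: alg => //.
by apply: sumr_ge0 => j _; exact: sqr_ge0.
Qed.

(** A nonzero integer vector has length at least 1, which gives the inequality on finite sums
    without constant term; approximation in [nrm 1] controls both sides. *)
Theorem poincare f : mean_zero f -> n2 f <= \sum_i n2 (pd i f).
Proof.
move=> mf; apply/ler_addgt0Pl => e e0.
have [g [[s [c [us sr gE]]] Hg]] :=
  tcl_nonresonant expo_eigenfamily (res := fun k => k == freq0) (mean_zero_res mf) 1 (divr_gt0 e0 (@ltr0n R 2)).
have H : n2 g <= \sum_i n2 (pd i g).
  have E := expo_eigenfamily.
  rewrite -(@ler_pXn2r _ 2)// ?nnegrE ?n2_ge0//; last by apply: sumr_ge0 => i _; exact: n2_ge0.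
  apply: (@le_trans _ _ (\sum_i n2 (pd i g) ^+ 2)); last first.
    by apply: sum_sqr_le => i; exact: n2_ge0.
  rewrite gE (n2_comb E)// sqr_sqrtr ?wsum_ge0//.
  under eq_bigr => i _ do rewrite (Y_comb E) (n2_comb E)// sqr_sqrtr ?wsum_ge0// wsum_Y.
  rewrite exchange_big/= /wsum big_seq [leRHS]big_seq; apply: ler_sum => k ks.
  rewrite expr0 mul1r -mulr_suml; apply: ler_wpM2r; first exact: (ltW vol_gt0).
  rewrite -mulr_sumr -mulr_suml mul1r ler_peMl ?sqr_ge0// freq_norm//.
  exact: (allP sr k ks).
have h1 : n2 f <= n2 (f - g) + n2 g by rewrite -[X in n2 X <= _](subrK g) n2D.
have h2 : \sum_i n2 (pd i g) <= \sum_i n2 (pd i f) + \sum_i n2 (pd i (f - g)).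
  rewrite -big_split/=; apply: ler_sum => i _.
  have -> : pd i g = pd i f - pd i (f - g) by rewrite -pdB opprB addrC subrK.
  exact: n2B.
have h3 : n2 (f - g) + \sum_i n2 (pd i (f - g)) <= e / 2 by exact: Hg.
apply: (le_trans h1); apply: (le_trans (lerD (lexx _) (le_trans H h2))).
rewrite addrCA addrC lerD2r; apply: (le_trans h3).
by rewrite ler_pdivrMr// ler_peMr ?ler1n// ltW.
Qed.

Definition lap (f : T) : T := \sum_i pd i (pd i f).

Lemma tame_lap : tame lap.
Proof. by apply: tame_sum => i _; apply: (tame_comp (tame_partial i) (tame_partial i)). Qed.

Lemma lapD : {morph lap : f g / f + g}.
Proof. by move=> f g; rewrite /lap -big_split; apply: eq_bigr => i _; rewrite !pdD. Qed.

Lemma lapZ (c : R[i]) : {morph lap : f / c *: f}.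
Proof. by move=> f; rewrite /lap scaler_sumr; apply: eq_bigr => i _; rewrite !pdZ. Qed.

Lemma lap_expo k : lap (expo k) = (- (\sum_i (k i)%:~R ^+ 2 : R))%:C *: expo k.
Proof.
rewrite /lap rmorphN/= rmorph_sum/= scaleNr scaler_suml -sumrN; apply: eq_bigr => i _.
rewrite !(pdZ, expo_partial) scalerA -scaleNr; congr (_ *: _).
have -> : 'i * (k i)%:~R * ('i * (k i)%:~R) = ('i * 'i) * (k i)%:~R ^+ 2 :> R[i] by ring.
by rewrite sqri mulN1r rmorphXn/= rmorph_int.
Qed.

(** Finite sums without constant term are solved term by term, so [f] is a limit of values of [lap];
    the range is closed because nonzero symbols have modulus at least 1. *)
Theorem lap_onto f : mean_zero f -> exists v, lap v = f.
Proof.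
move=> mf; have E := expo_eigenfamily.
pose q (k : freq) : R := - \sum_i (k i)%:~R ^+ 2.
have qE k : lap (expo k) = (q k)%:C *: expo k by exact: lap_expo.
have DC k : (forall _ : 'I_1, (q k)%:C = 0) \/
    1 <= 1 * weight (fun i (k : freq) => (k i)%:~R : R) k ^+ 0 * \sum_(j < 1) normc (q k)%:C ^+ 2.
  have [->|k0] := eqVneq k freq0.
    by left=> _; rewrite /q big1 ?oppr0// => i _; rewrite ffunE expr0n.
  right; rewrite big_ord1 expr0 !mul1r normc_real normrN real_normK ?num_real//.
  by have := freq_norm k0 => h; rewrite expr_ge1// (le_trans ler01).
have AP k (e : R) : 0 < e -> exists u, forall _ : 'I_1, nrm k (lap u - f) <= e.
  move=> e0.
  have [g [[s [c [us sr gE]]] Hg]] := tcl_nonresonant E (res := fun k => k == freq0) (mean_zero_res mf) k e0.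
  exists (comb (@expo R N) s (fun k => c k * (q k)^-1%:C)) => _.
  suff -> : lap (comb (@expo R N) s (fun k => c k * (q k)^-1%:C)) = g by rewrite nrm_distC.
  have lap0 : lap 0 = 0 by apply: (addrI (lap 0)); rewrite -lapD !addr0.
  rewrite gE /comb (big_morph lap lapD lap0) big_seq [RHS]big_seq; apply: eq_bigr => x xs.
  rewrite lapZ qE scalerA -mulrA -rmorphM/= mulVf ?mulr1//.
  have h := freq_norm (allP sr x xs).
  by rewrite oppr_eq0 gt_eqF// (lt_le_trans ltr01).
have [v Hv] := diagonal_closed_range E (fun=> tame_lap) (fun=> lapD) (fun=> lapZ)
   (fun=> qE) ler01 DC AP.
by exists v; exact: (Hv ord0).
Qed.

Lemma grad0_mean_zero f : (forall i, pd i f = 0) -> mean_zero f -> f = 0.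
Proof.
move=> f0 mf; apply: n2_eq0; apply: le_anti; rewrite n2_ge0 andbT.
by rewrite (le_trans (poincare mf))// big1// => i _; rewrite f0 n20.
Qed.

Lemma lap_energy f : rip (lap f) f = - \sum_i n2 (pd i f) ^+ 2.
Proof.
rewrite rip_suml -sumrN; apply: eq_bigr => i _.
by rewrite rip_partial n2_sqr.
Qed.

Lemma lap0_grad f : lap f = 0 -> forall i, pd i f = 0.
Proof.
move=> f0 i; apply: n2_eq0; apply/eqP; rewrite -sqrf_eq0.
have := lap_energy f; rewrite f0 rip0l => /eqP; rewrite eq_sym oppr_eq0 psumr_eq0; last first.
  by move=> j _; exact: sqr_ge0.
by move=> /allP/(_ i); rewrite mem_index_enum => /(_ isT).
Qed.

End laplacian.

(** * The operators of the tube structure *)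

Section tube_operators.
Context {R : realType} {n : nat}.
Notation T := (torus_fun R (n + 1)).
Implicit Types (f g u : T).

Definition ix : 'I_(n + 1) := rshift n ord0.
Definition Dx (f : T) : T := pd ix f.
Definition dt (j : 'I_n) (f : T) : T := pd (lshift 1 j) f.

Lemma sum_tube (V : nmodType) (F : 'I_(n + 1) -> V) :
  \sum_i F i = \sum_j F (lshift 1 j) + F ix.
Proof. by rewrite big_split_ord/= big_ord1. Qed.

Variable al : 'I_n -> T.
Hypothesis alD : forall j, Dx (al j) = 0.
Hypothesis alR : forall j, tconj (al j) = al j.

Definition Xf (j : 'I_n) (f : T) : T := dt j f + al j * Dx f.
Definition Pf (f : T) : T := \sum_j Xf j (Xf j f).

Lemma DxD : {morph Dx : f g / f + g}. Proof. by move=> f g; exact: pdD. Qed.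
Lemma DxB : {morph Dx : f g / f - g}. Proof. by move=> f g; exact: pdB. Qed.
Lemma DxZ (c : R[i]) : {morph Dx : f / c *: f}. Proof. by move=> f; exact: pdZ. Qed.
Lemma DxM f g : Dx (f * g) = Dx f * g + f * Dx g. Proof. exact: pdM. Qed.
Lemma Dx_skew f g : rip (Dx f) g = - rip f (Dx g). Proof. exact: rip_partial. Qed.
Lemma tame_Dx : tame Dx. Proof. exact: tame_partial. Qed.

Lemma XfD j : {morph Xf j : f g / f + g}.
Proof. by move=> f g; rewrite /Xf /dt /Dx !pdD mulrDr addrACA. Qed.
Lemma XfZ j (c : R[i]) : {morph Xf j : f / c *: f}.
Proof. by move=> f; rewrite /Xf /dt /Dx !pdZ -tscalerAr scalerDr. Qed.
Lemma XfB j : {morph Xf j : f g / f - g}.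
Proof. by move=> f g; rewrite XfD -scaleN1r XfZ scaleN1r. Qed.
Lemma Xf0 j : Xf j 0 = 0.
Proof. by apply: (addrI (Xf j 0)); rewrite -XfD !addr0. Qed.
Lemma XfM j f g : Xf j (f * g) = Xf j f * g + f * Xf j g.
Proof. by rewrite /Xf /dt /Dx !pdM; ring. Qed.
Lemma Xf_skew j f g : rip (Xf j f) g = - rip f (Xf j g).
Proof.
rewrite /Xf ripDl ripDr opprD /dt rip_partial; congr (_ + _).
by rewrite ripM alR Dx_skew DxM alD mul0r add0r.
Qed.
Lemma tame_Xf j : tame (Xf j).
Proof.
apply: tame_add; first exact: tame_partial.
exact: (tame_comp (tame_mul (al j)) tame_Dx).
Qed.
Lemma DxXf j f : Dx (Xf j f) = Xf j (Dx f).
Proof.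
have E : Dx (dt j f) = dt j (Dx f) := pdC ix (lshift 1 j) f.
by rewrite /Xf DxD (DxM (al j)) alD mul0r add0r E.
Qed.
Lemma Xf_conj j f : Xf j (tconj f) = tconj (Xf j f).
Proof. by rewrite /Xf /dt /Dx !pd_conj tconjD tconjM alR. Qed.

Lemma PfD : {morph Pf : f g / f + g}.
Proof. by move=> f g; rewrite /Pf -big_split; apply: eq_bigr => j _; rewrite !XfD. Qed.
Lemma PfZ (c : R[i]) : {morph Pf : f / c *: f}.
Proof. by move=> f; rewrite /Pf scaler_sumr; apply: eq_bigr => j _; rewrite !XfZ. Qed.
Lemma PfB : {morph Pf : f g / f - g}.
Proof. by move=> f g; rewrite PfD -scaleN1r PfZ scaleN1r. Qed.
Lemma tame_Pf : tame Pf.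
Proof. by apply: tame_sum => j _; exact: (tame_comp (tame_Xf j) (tame_Xf j)). Qed.
Lemma DxPf f : Dx (Pf f) = Pf (Dx f).
Proof.
rewrite /Pf /Dx pd_sum; apply: eq_bigr => j _.
by rewrite -!/(Dx _) !DxXf.
Qed.
Lemma Pf_energy f : - rip (Pf f) f = \sum_j n2 (Xf j f) ^+ 2.
Proof.
rewrite rip_suml -sumrN; apply: eq_bigr => j _.
by rewrite Xf_skew opprK n2_sqr.
Qed.
Lemma dtE j f : dt j f = Xf j f - al j * Dx f.
Proof. by rewrite /Xf addrK. Qed.

Definition curv j k : T := dt j (al k) - dt k (al j).

Lemma commutator j k f : Xf j (Xf k f) - Xf k (Xf j f) = curv j k * Dx f.
Proof.
have alX i h : Xf i h = dt i h + al i * Dx h by [].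
rewrite (alX j (Xf k f)) (alX k (Xf j f)) !DxXf /Xf /dt !pdD !pdM -!/(Dx _) /curv.
have c1 : pd (lshift 1 j) (pd (lshift 1 k) f) = pd (lshift 1 k) (pd (lshift 1 j) f).
  exact: pdC.
have c2 : pd (lshift 1 j) (Dx f) = Dx (pd (lshift 1 j) f) by exact: pdC.
have c3 : pd (lshift 1 k) (Dx f) = Dx (pd (lshift 1 k) f) by exact: pdC.
rewrite c1 c2 c3 /dt; ring.
Qed.

Lemma curvD j k : Dx (curv j k) = 0.
Proof.
rewrite /curv DxB /Dx /dt pdC -/(Dx _) alD pd0 sub0r.
by rewrite pdC -/(Dx (al j)) alD pd0 oppr0.
Qed.

Lemma curvR j k : tconj (curv j k) = curv j k.
Proof. by rewrite /curv tconjB /dt -!pd_conj !alR. Qed.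

(* The fields X_1, ..., X_n together with the derivative in x form a frame. *)
Definition Yf (i : 'I_(n + 1)) : T -> T :=
  match fintype.split i with inl j => Xf j | inr _ => Dx end.

Lemma Yf_l j : Yf (lshift 1 j) = Xf j.
Proof. by rewrite /Yf (unsplitK (inl j)). Qed.
Lemma Yf_r : Yf ix = Dx.
Proof. by rewrite /Yf (unsplitK (inr ord0)). Qed.

Lemma Yf_ind (P : (T -> T) -> Prop) : (forall j, P (Xf j)) -> P Dx -> forall i, P (Yf i).
Proof. by move=> PX PD i; rewrite /Yf; case: (fintype.split i). Qed.

Lemma YfD i : {morph Yf i : f g / f + g}.
Proof. by apply: (@Yf_ind (fun Y => {morph Y : f g / f + g})); [exact: XfD|exact: DxD]. Qed.
Lemma YfZ i (c : R[i]) : {morph Yf i : f / c *: f}.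
Proof. by apply: (@Yf_ind (fun Y => {morph Y : f / c *: f})); [move=> j; exact: XfZ|exact: DxZ]. Qed.

(** A coordinate derivative is [X_j f - al j * Dx f], so the frame controls the coordinates with
    bounded coefficients. *)
Lemma nrm_le_gnY k : exists2 C : R, 0 <= C & forall f, nrm k f <= C * gn Yf k f.
Proof.
elim: k => [|k [C C0 IH]]; first by exists 1 => // f; rewrite mul1r nrm0E.
have /choice[B HB] : forall j, exists B : R, 0 <= B /\ forall f, nrm k (al j * f) <= B * nrm k f.
  by move=> j; have [B B0 HB] := nrmM_bounded k (al j); exists B.
pose A := C + \sum_j B j * C.
have A0 : 0 <= \sum_j B j * C by apply: sumr_ge0 => j _; rewrite mulr_ge0//; have [] := HB j.
exists A; first by rewrite addr_ge0.
move=> f; rewrite nrmS gnS !sum_tube.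
have -> : \sum_j gn Yf k (Yf (lshift 1 j) f) = \sum_j gn Yf k (Xf j f).
  by apply: eq_bigr => j _; rewrite Yf_l.
rewrite Yf_r.
have hx : nrm k (pd ix f) <= C * gn Yf k (Dx f) by exact: IH.
have ht : \sum_j nrm k (pd (lshift 1 j) f) <= C * (\sum_j gn Yf k (Xf j f)) + (\sum_j B j * C) * gn Yf k (Dx f).
  rewrite mulr_sumr mulr_suml -big_split/=; apply: ler_sum => j _.
  rewrite -/(dt j f) dtE (le_trans (nrmB _ _ _))// lerD//.
  have [B0 h] := HB j; rewrite (le_trans (h _))// -mulrA ler_wpM2l//; exact: IH.
have h0 := IH f.
have g0 := gn_ge0 Yf k f; have g1 := gn_ge0 Yf k (Dx f).
have g2 : 0 <= \sum_j gn Yf k (Xf j f) by apply: sumr_ge0 => j _; exact: gn_ge0.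
have alg (b c x1 x2 x3 y1 y2 y3 : R) : 0 <= c -> 0 <= b -> 0 <= y1 -> 0 <= y2 -> 0 <= y3 ->
    x1 <= c * y1 -> x2 <= c * y3 + b * y2 -> x3 <= c * y2 ->
    x1 + (x2 + x3) <= (c + b) * (y1 + (y3 + y2)).
  by move=> *; nra.
exact: alg.
Qed.

Definition nX f : R := \sum_j n2 (Xf j f).

Lemma nX_ge0 f : 0 <= nX f. Proof. by apply: sumr_ge0 => j _; exact: n2_ge0. Qed.
Lemma n2X_le j f : n2 (Xf j f) <= nX f.
Proof. by rewrite /nX (bigD1 j)//= lerDl sumr_ge0// => i _; exact: n2_ge0. Qed.

Lemma nX_sqr f : nX f ^+ 2 <= n%:R * \sum_j n2 (Xf j f) ^+ 2.
Proof. exact: sqr_sum_le. Qed.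

End tube_operators.

(** * Elliptic regularity of the Laplacian *)

Section elliptic.
Context {R : realType} {N : nat}.
Notation T := (torus_fun R N).
Implicit Types (u f : T).

Lemma lap_partial i u : lap (pd i u) = pd i (lap u).
Proof.
rewrite /lap pd_sum; apply: eq_bigr => j _.
by rewrite (pdC j i u) (pdC j i (pd j u)).
Qed.

(** After removal of the mean, the energy identity gives [|grad v|^2 <= |lap v| |v|]; Poincaré
    replaces [|v|] by the gradient, one factor of which is cancelled. *)
Lemma grad_le_lap u : \sum_i n2 (pd i u) <= N%:R * n2 (lap u).
Proof.
have [c mc] := mean_proj u; set v := u - c *: (1 : T).
have vu i : pd i v = pd i u by rewrite pdB pdZ pd1 scaler0 subr0.
have lv : lap v = lap u by apply: eq_bigr => i _; rewrite vu.
have E1 : \sum_i n2 (pd i v) ^+ 2 <= n2 (lap v) * n2 v.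
  by have := ripN_le (lap v) v; rewrite lap_energy opprK.
have P := poincare mc; rewrite -/v in P.
have S : (\sum_i n2 (pd i v)) ^+ 2 <= N%:R * \sum_i n2 (pd i v) ^+ 2.
  exact: sqr_sum_le.
have Eu : \sum_i n2 (pd i u) = \sum_i n2 (pd i v).
  by apply: eq_bigr => i _; rewrite vu.
rewrite Eu -lv; set G := \sum_i n2 (pd i v) in P S *.
have G0 : 0 <= G by apply: sumr_ge0 => i _; exact: n2_ge0.
have [->|Gn] := eqVneq G 0; first by rewrite mulr_ge0// n2_ge0.
have Gp : 0 < G by rewrite lt_neqAle eq_sym Gn.
rewrite -(ler_pM2r Gp) -expr2; apply: (le_trans S); rewrite -mulrA ler_wpM2l//.
by apply: (le_trans E1); rewrite ler_wpM2l ?n2_ge0.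
Qed.

Lemma nrm_grad_le_lap k i u : nrm k (pd i u) <= N%:R * nrm k (lap u).
Proof.
elim: k u => [|k IH] u.
  rewrite !nrm0E; apply: le_trans (grad_le_lap u).
  by rewrite (bigD1 i)//= lerDl sumr_ge0// => j _; exact: n2_ge0.
rewrite !nrmS mulrDr mulr_sumr; apply: lerD; first exact: IH.
by apply: ler_sum => j _; rewrite -lap_partial pdC; exact: IH.
Qed.

Lemma nrm_le_lap k u : mean_zero u -> nrm k u <= N%:R * nrm k (lap u).
Proof.
elim: k u => [|k IH] u mu.
  rewrite !nrm0E; exact: le_trans (poincare mu) (grad_le_lap u).
rewrite !nrmS mulrDr mulr_sumr; apply: lerD; first exact: IH.
by apply: ler_sum => j _; rewrite -lap_partial; apply: IH; exact: mean_zero_partial.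
Qed.

(* Integrating by parts twice, |lap u|^2 is the sum of all |pd i (pd j u)|^2. *)
Lemma nrm_hessian_le_lap k i j u : nrm k (pd i (pd j u)) <= nrm k (lap u).
Proof.
elim: k u => [|k IH] u; last first.
  rewrite !nrmS; apply: lerD; first exact: IH.
  apply: ler_sum => l _; rewrite -lap_partial.
  rewrite (pdC l i (pd j u)) (pdC l j u); exact: IH.
rewrite !nrm0E -(@ler_pXn2r _ 2)// ?nnegrE ?n2_ge0// !n2_sqr.
have -> : rip (lap u) (lap u) = \sum_i \sum_j rip (pd i (pd j u)) (pd i (pd j u)).
  rewrite [LHS]rip_suml; apply: eq_bigr => p _; rewrite rip_sumr; apply: eq_bigr => q _.
  rewrite (rip_partial p) (pdC p q (pd q u)) -(rip_partial q (pd p u)).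
  by rewrite (pdC q p u).
rewrite (bigD1 i)//= (bigD1 j)//= -addrA lerDl addr_ge0// sumr_ge0// => p _; first exact: rip_ge0.
by apply: sumr_ge0 => q _; exact: rip_ge0.
Qed.

Lemma elliptic_gain k : exists2 C : R, 0 <= C & forall u, mean_zero u -> nrm k.+2 u <= C * nrm k (lap u).
Proof.
exists (N%:R + \sum_(i < N) N%:R + \sum_(i < N) (N%:R + \sum_(j < N) 1)).
  by rewrite !addr_ge0// sumr_ge0// => i _; rewrite ?addr_ge0// sumr_ge0.
move=> u mu; rewrite !mulrDl !mulr_suml nrmS nrmS.
apply: lerD; first apply: lerD.
- exact: nrm_le_lap.
- by apply: ler_sum => i _; exact: nrm_grad_le_lap.
- apply: ler_sum => i _; rewrite nrmS mulrDl mulr_suml; apply: lerD; first exact: nrm_grad_le_lap.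
  by apply: ler_sum => j _; rewrite mul1r; exact: nrm_hessian_le_lap.
Qed.

Lemma nrm_lap_le k u : nrm k (lap u) <= N%:R * nrm k.+2 u.
Proof.
rewrite (le_trans (nrm_sum _ _ _ _))//.
apply: (@le_trans _ _ (\sum_(i < N) nrm k.+2 u)); last by rewrite sumr_const card_ord mulr_natl.
by apply: ler_sum => i _; rewrite (le_trans (nrm_partial _ _ _))// nrm_partial.
Qed.

End elliptic.

(** * Non-commuting fields: a priori estimates *)

Section noninvolutive.
Context {R : realType} {n : nat}.
Notation T := (torus_fun R (n + 1)).
Implicit Types (f g u w : T).
Variable al : 'I_n -> T.
Hypothesis alD : forall j, Dx (al j) = 0.
Hypothesis alR : forall j, tconj (al j) = al j.
Notation X := (Xf al).
Notation P := (Pf al).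

(** The factorization [lap u = P u + first_order (Dx u)] is the point: every term separating the
    Laplacian from [P] contains a derivative in [x], so regularity of [Dx u] suffices to recover
    that of [u]. *)
Definition first_order (w : T) : T :=
  Dx w - \sum_j (dt j (al j * w) + al j * dt j w + al j * (al j * Dx w)).

Lemma lap_Pf u : lap u = P u + first_order (Dx u).
Proof.
rewrite /lap sum_tube /first_order -/(Dx (Dx u)) addrCA addrC; congr (_ + _).
rewrite /Pf -sumrB; apply: eq_bigr => j _.
have E : Dx (dt j u) = dt j (Dx u) := pdC ix (lshift 1 j) u.
rewrite /Xf -/(dt j _) -/(dt j (dt j u)).
have -> : dt j (dt j u + al j * Dx u) = dt j (dt j u) + dt j (al j * Dx u) by exact: pdD.
by rewrite DxD (DxM (al j)) alD mul0r add0r E; ring.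
Qed.

Lemma nrm_first_order k : exists2 C : R, 0 <= C & forall w, nrm k (first_order w) <= C * nrm k.+1 w.
Proof.
have /choice[B HB] : forall j, exists B : R, [/\ 0 <= B,
    forall f, nrm k (al j * f) <= B * nrm k f & forall f, nrm k.+1 (al j * f) <= B * nrm k.+1 f].
  move=> j; have [B1 B10 H1] := nrmM_bounded k (al j); have [B2 B20 H2] := nrmM_bounded k.+1 (al j).
  exists (B1 + B2); split; first by rewrite addr_ge0.
    by move=> f; rewrite (le_trans (H1 f))// ler_wpM2r ?nrm_ge0// lerDl.
  by move=> f; rewrite (le_trans (H2 f))// ler_wpM2r ?nrm_ge0// lerDr.
exists (1 + \sum_j (B j + B j + B j * B j)).
  by rewrite addr_ge0// sumr_ge0// => j _; have [B0 _ _] := HB j; rewrite !addr_ge0// mulr_ge0.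
move=> w; rewrite /first_order (le_trans (nrmB _ _ _))// mulrDl mul1r lerD ?nrm_partial//.
rewrite (le_trans (nrm_sum _ _ _ _))// mulr_suml; apply: ler_sum => j _.
have [B0 h1 h2] := HB j.
rewrite !mulrDl (le_trans (nrmD _ _ _))//; apply: lerD.
  rewrite (le_trans (nrmD _ _ _))//; apply: lerD.
    by rewrite (le_trans (nrm_partial _ _ _)).
  by rewrite (le_trans (h1 _))// ler_wpM2l// nrm_partial.
by rewrite (le_trans (h1 _))// -mulrA ler_wpM2l// (le_trans (h1 _))// ler_wpM2l// nrm_partial.
Qed.

Lemma nrm_Pf_le k : exists2 C : R, 0 <= C & forall u, nrm k (P u) <= C * nrm k.+2 u.
Proof.
have [C C0 H] := nrm_first_order k.
exists ((n + 1)%:R + C); first by rewrite addr_ge0.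
move=> u; have -> : P u = lap u - first_order (Dx u) by rewrite lap_Pf addrK.
rewrite (le_trans (nrmB _ _ _))// mulrDl lerD ?nrm_lap_le//.
by rewrite (le_trans (H _))// ler_wpM2l// nrm_partial.
Qed.

Lemma grad_le_nX : exists2 C : R, 0 <= C & forall u, \sum_i n2 (pd i u) <= C * (nX al u + n2 (Dx u)).
Proof.
have /choice[B HB] : forall j, exists B : R, 0 <= B /\ forall f, n2 (al j * f) <= B * n2 f.
  by move=> j; have [B B0 HB] := n2M_bounded (al j); exists B.
have S0 : 0 <= \sum_j B j by apply: sumr_ge0 => j _; have [] := HB j.
exists (1 + \sum_j B j); first by rewrite addr_ge0.
move=> u; rewrite sum_tube -/(Dx u).
have h : \sum_j n2 (pd (lshift 1 j) u) <= nX al u + (\sum_j B j) * n2 (Dx u).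
  rewrite /nX mulr_suml -big_split/=; apply: ler_sum => j _.
  rewrite -/(dt j u) (dtE al) (le_trans (n2B _ _))// lerD2l; by have [_] := HB j.
have := nX_ge0 al u; have := n2_ge0 (Dx u); move: h S0.
move: (\sum_j n2 _) (nX al u) (n2 (Dx u)) (\sum_j B j) => a b c s; clear; nra.
Qed.

Variables (j0 k0 : 'I_n).
Hypothesis curv0 : curv al j0 k0 != 0.
Notation b := (curv al j0 k0).

Lemma rip_scale_diag (c : R[i]) w : rip (c *: w) w = complex.Re c * n2 w ^+ 2.
Proof.
have i0 : rip ('i *: w) w = 0.
  have : rip ('i *: w) w = - rip ('i *: w) w.
    by rewrite {1}ripZ (_ : conjc 'i = - 'i) ?scaleNr ?ripNr 1?ripC//; apply/eqP; rewrite eq_complex/= oppr0 !eqxx.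
  by move=> h; lra.
have -> : c *: w = (complex.Re c)%:C *: w + (complex.Im c)%:C *: ('i *: w).
  rewrite scalerA -scalerDl; congr (_ *: _); case: c => x y.
  by apply/eqP; rewrite eq_complex/=; apply/andP; split; apply/eqP; ring.
by rewrite ripDl !ripZrl i0 mulr0 addr0 n2_sqr.
Qed.

(* For b the curvature and c the mean of b^2, b^2 - c = lap v with v independent of x, so that
   b^2 - c = sum_j X_j (dt j v); then integrate by parts. *)
Lemma curv_average : exists (c m : R), [/\ 0 < c, 0 <= m &
  forall w, c * n2 w ^+ 2 <= n2 (b * w) ^+ 2 + m * (n2 w * nX al w)].
Proof.
have bD := curvD alD j0 k0; have bR := curvR alR j0 k0.
have [c mc] := mean_proj (b * b); have [v lv] := lap_onto mc.
(* Testing [b^2 - c] against 1 gives [Re c * vol = n2 b ^ 2], which is positive because the real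
   function [b] is not identically zero. *)
have c0 : 0 < complex.Re c.
  have := mc 1; rewrite ripBl rip_cst rmorph1 mulr1 scale1r => /eqP.
  rewrite subr_eq0 ripM bR mulr1 => /eqP E.
  rewrite -(pmulr_lgt0 _ (@vol_gt0 R (n + 1))) -E lt_neqAle rip_ge0 andbT eq_sym.
  by apply: contra curv0 => /eqP/rip_eq0 ->.
(* Since [b] is independent of [x], [Dx v] is harmonic; being a derivative it has mean zero, hence
   vanishes. *)
have Dv : Dx v = 0.
  apply: grad0_mean_zero; last exact: mean_zero_partial.
  apply: lap0_grad; rewrite lap_partial lv -/(Dx _) DxB DxM bD mul0r mulr0 addr0 DxZ.
  by rewrite /Dx pd1 scaler0 subr0.
have Xv j : X j (dt j v) = dt j (dt j v).
  have E : Dx (dt j v) = dt j (Dx v) := pdC ix (lshift 1 j) v.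
  by rewrite /Xf E Dv /dt pd0 mulr0 addr0.
have lvX : b * b - c *: (1 : T) = \sum_j X j (dt j v).
  rewrite -lv /lap sum_tube -!/(Dx _) Dv /Dx pd0 addr0.
  by apply: eq_bigr => j _; rewrite Xv.
have /choice[B HB] : forall j, exists B : R, 0 <= B /\ forall f, n2 (dt j v * f) <= B * n2 f.
  by move=> j; have [B B0 HB] := n2M_bounded (dt j v); exists B.
exists (complex.Re c), (\sum_j 2 * B j); split => //.
  by apply: sumr_ge0 => j _; rewrite mulr_ge0//; have [] := HB j.
move=> w.
have E1 : rip ((b * b - c *: (1 : T)) * w) w = n2 (b * w) ^+ 2 - complex.Re c * n2 w ^+ 2.
  rewrite mulrBl ripBl -tscalerAl mul1r rip_scale_diag; congr (_ - _).
  by rewrite -mulrA ripM bR n2_sqr.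
have E2 : - rip ((b * b - c *: (1 : T)) * w) w <= (\sum_j 2 * B j) * (n2 w * nX al w).
  rewrite lvX [X in rip X _]mulr_suml rip_suml -sumrN mulr_suml; apply: ler_sum => j _.
  have -> : X j (dt j v) * w = X j (dt j v * w) - dt j v * X j w by rewrite XfM addrK.
  rewrite ripBl opprB (Xf_skew alD alR) opprK.
  have [B0 hB] := HB j.
  apply: (@le_trans _ _ (B j * n2 (X j w) * n2 w + B j * n2 w * n2 (X j w))).
    apply: lerD.
      by rewrite (le_trans (rip_le _ _))// ler_wpM2r ?n2_ge0.
    by rewrite (le_trans (rip_le _ _))// ler_wpM2r ?n2_ge0.
  have -> : B j * n2 (X j w) * n2 w + B j * n2 w * n2 (X j w) = 2 * B j * (n2 w * n2 (X j w)) by ring.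
  by rewrite ler_wpM2l ?mulr_ge0// ler_wpM2l ?n2_ge0// n2X_le.
by rewrite E1 opprB lerBlDr addrC in E2.
Qed.

End noninvolutive.

Section noninvolutive_estimates.
Context {R : realType} {n : nat}.
Notation T := (torus_fun R (n + 1)).
Implicit Types (f g u w : T).
Variable al : 'I_n -> T.
Hypothesis alD : forall j, Dx (al j) = 0.
Hypothesis alR : forall j, tconj (al j) = al j.
Notation X := (Xf al).
Notation P := (Pf al).

Lemma nrm_Xf_le k : exists2 C : R, 0 <= C & forall j u, nrm k (X j u) <= C * nrm k.+1 u.
Proof.
have /choice[B HB] : forall j, exists B : R, 0 <= B /\ forall f, nrm k (al j * f) <= B * nrm k f.
  by move=> j; have [B B0 HB] := nrmM_bounded k (al j); exists B.
exists (1 + \sum_j B j).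
  by rewrite addr_ge0// sumr_ge0// => j _; have [] := HB j.
move=> j u; rewrite (le_trans (nrmD _ _ _))// mulrDl mul1r lerD ?nrm_partial//.
have [B0 h] := HB j; rewrite (le_trans (h _))// ler_pM ?nrm_ge0 ?nrm_partial//.
by rewrite (bigD1 j)//= lerDl sumr_ge0// => i _; have [] := HB i.
Qed.

Lemma nrm_Pf_le_Xf k : exists2 C : R, 0 <= C & forall u, nrm k (P u) <= C * \sum_j nrm k.+1 (X j u).
Proof.
have [C C0 H] := nrm_Xf_le k; exists C => // u.
rewrite (le_trans (nrm_sum _ _ _ _))// mulr_sumr; apply: ler_sum => j _; exact: H.
Qed.

Lemma mean_zero_Xf j u : mean_zero (X j u).
Proof.
move=> z; rewrite (Xf_skew alD alR) XfZ /Xf /dt /Dx !pd1 mulr0 addr0 scaler0.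
by rewrite rip0r oppr0.
Qed.

Lemma Xf1 j : X j (1 : T) = 0.
Proof. by rewrite /Xf /dt /Dx !pd1 mulr0 addr0. Qed.

Lemma Pf1 : P (1 : T) = 0.
Proof. by apply: big1 => j _; rewrite Xf1 Xf0. Qed.

Section curved.
Variables (j0 k0 : 'I_n).
Hypothesis curv0 : curv al j0 k0 != 0.
Notation b := (curv al j0 k0).

(* b Dx u is the commutator of X_j0 and X_k0 applied to u. *)
Lemma curv_Dx_le : exists2 C : R, 0 <= C & forall u,
  n2 (b * Dx u) ^+ 2 <= C * (nX al u * (n2 (Dx u) + nX al (Dx u))).
Proof.
have [B B0 HB] := n2M_bounded b.
have [B1 B10 HB1] := n2M_bounded (X j0 b).
have [B2 B20 HB2] := n2M_bounded (X k0 b).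
exists (2 * (B + B1 + B2)); first by rewrite mulr_ge0// !addr_ge0.
move=> u; set w := Dx u.
have h (i k : 'I_n) (D : R) : 0 <= D -> (forall f, n2 (X i b * f) <= D * n2 f) ->
    D <= B1 + B2 ->
    `|rip (X k u) (X i (b * w))| <= nX al u * ((B + B1 + B2) * (n2 w + nX al w)).
  move=> D0 HD DB; rewrite (le_trans (rip_norm_le _ _))// ler_pM ?n2_ge0 ?n2X_le//.
  rewrite XfM (le_trans (n2D _ _))//.
  have a1 : n2 (b * X i w) <= B * nX al w.
    by rewrite (le_trans (HB _))// ler_wpM2l// n2X_le.
  have a2 := HD w; have := n2_ge0 w; have := nX_ge0 al w.
  move: a1 a2 DB B0 B10 B20 D0; clear; move: (n2 (b * _)) (n2 (X i b * w)) (n2 w) (nX al w).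
  move=> y z d q a1 a2 DB B0 B10 B20 D0 q0 d0.
  have := ler_wpM2r d0 DB; have := mulr_ge0 B0 d0; have := mulr_ge0 (addr_ge0 B10 B20) q0; lra.
have E : b * w = X j0 (X k0 u) - X k0 (X j0 u) by rewrite (commutator alD).
rewrite n2_sqr [X in rip X _]E ripBl (Xf_skew alD alR j0) (Xf_skew alD alR k0 (X j0 u)) opprK addrC.
have h1 := h k0 j0 B2 B20 HB2 _; have h2 := h j0 k0 B1 B10 HB1 _.
have e1 : B2 <= B1 + B2 by rewrite lerDr.
have e2 : B1 <= B1 + B2 by rewrite lerDl.
have := le_trans (ler_norm _) (h1 e1); have := h2 e2; rewrite -normrN => /(le_trans (ler_norm _)).
move: (rip _ _) (rip _ _) (nX al u) (n2 w + nX al w) => x y z t; clear; lra.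
Qed.

(** With [d = n2 (Dx u)], [p = nX u] and [q = nX (Dx u)], the two preceding estimates give
    [c d^2 <= K (d (p + q) + p q)]. A value of [d] above [(K / c + 1) (p + q)] would contradict this
    inequality. *)
Lemma Dx_le_nX : exists2 C : R, 0 <= C & forall u, n2 (Dx u) <= C * (nX al u + nX al (Dx u)).
Proof.
have [c [m [c0 m0 H1]]] := curv_average alD alR curv0; have [B B0 H2] := curv_Dx_le.
have K0 : 0 <= B + m by rewrite addr_ge0.
have Kc : 0 <= (B + m) / c by rewrite divr_ge0// ltW.
exists ((B + m) / c + 1) => [|u]; first by rewrite addr_ge0.
have h1 := H1 (Dx u); have h2 := H2 u.
have d0 := n2_ge0 (Dx u); have p0 := nX_ge0 al u; have q0 := nX_ge0 al (Dx u).
have alg (d p q K r : R) : 0 <= d -> 0 <= p -> 0 <= q -> 0 <= K -> K = r * c ->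
    c * d ^+ 2 <= K * (d * (p + q)) + K * (p * q) -> d <= (r + 1) * (p + q).
  move=> d0' p0' q0' K0' Kr hh; rewrite leNgt; apply/negP => lt.
  have r0 : 0 <= r by rewrite -(pmulr_lge0 _ c0) -Kr.
  have s0 : 0 <= p + q by exact: addr_ge0.
  have dp : 0 < d by apply: le_lt_trans lt; rewrite mulr_ge0// addr_ge0.
  move: hh; rewrite Kr leNgt => /negP; apply.
  rewrite (_ : _ + _ = c * (r * (d * (p + q) + p * q))); last by ring.
  rewrite ltr_pM2l//.
  have e1 : (r + 1) * (p + q) * d < d ^+ 2 by rewrite expr2 ltr_pM2r.
  have e2 : r * (p * q) <= (p + q) * d.
    have : r * (p + q) <= d by lra.
    by nra.
  by move: e1 e2; lra.
apply: (alg _ _ _ (B + m)) => //; first by rewrite divfK// gt_eqF.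
apply: (le_trans h1); rewrite (le_trans (lerD h2 (lexx _)))//.
move: h1 h2 d0 p0 q0; move: (n2 _) (nX al u) (nX al (Dx u)) => d p q _ _ d0 p0 q0.
by have := mulr_ge0 p0 q0; have := mulr_ge0 d0 p0; have := mulr_ge0 d0 q0; nra.
Qed.

(** The energy identity is used for [u] and for [Dx u], whose image under [P] is [Dx (P u)]; this is
    where one derivative of [P u] is lost. [Dx_le_nX] and Poincaré then close the system. *)
Lemma Pf_estimate1 : exists2 C : R, 0 <= C & forall u, mean_zero u -> nrm 1 u <= C * nrm 1 (P u).
Proof.
have [C1 C10 H1] := grad_le_nX al; have [C2 C20 H2] := Dx_le_nX.
pose K := C1 + (C1 + 1) * C2; have K0 : 0 <= K by rewrite addr_ge0// mulr_ge0// addr_ge0.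
exists (2 * C1 * (1 + C2) * (2 * n%:R * K)).
  by rewrite !mulr_ge0// addr_ge0.
move=> u mu.
have en v : nX al v ^+ 2 <= n%:R * (n2 (P v) * n2 v).
  rewrite (le_trans (nX_sqr al v))// ler_wpM2l// -(Pf_energy alD alR).
  exact: ripN_le.
have e1 := en u; have e2 := en (Dx u); rewrite -(DxPf alD) in e2.
have f1 : n2 (P u) <= nrm 1 (P u) by exact: n2_le_nrm.
have f2 : n2 (Dx (P u)) <= nrm 1 (P u) by rewrite -nrm0E; exact: nrm_partial.
have pu := poincare mu; have g := H1 u; have h := H2 u.
have N1 : nrm 1 u = n2 u + \sum_i n2 (pd i u) by [].
rewrite N1.
have p0 := nX_ge0 al u; have q0 := nX_ge0 al (Dx u); have d0 := n2_ge0 (Dx u); have u0 := n2_ge0 u.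
have f0 := nrm_ge0 1 (P u); have n0 : 0 <= n%:R :> R by [].
have F1 : nX al u ^+ 2 <= n%:R * (nrm 1 (P u) * (C1 * (nX al u + n2 (Dx u)))).
  rewrite (le_trans e1)// ler_wpM2l// ler_pM ?n2_ge0//.
  by rewrite (le_trans pu).
have F2 : nX al (Dx u) ^+ 2 <= n%:R * (nrm 1 (P u) * n2 (Dx u)).
  by rewrite (le_trans e2)// ler_wpM2l// ler_wpM2r.
move: F1 F2 pu g h p0 q0 d0 u0 f0 n0; clear -C10 C20 K0.
rewrite /K in K0 *; move: (nX al u) (nX al (Dx u)) (n2 (Dx u)) (n2 u) (nrm 1 (P u)) (\sum_i _) (n%:R : R).
move=> p q d x f G nn F1 F2 pu g h p0 q0 d0 x0 f0 n0.
set k := C1 + (C1 + 1) * C2 in K0 *.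
have nf : 0 <= nn * f by rewrite mulr_ge0.
(* The squares are bounded by [f] times a quantity linear in [p + q], so one factor [p + q] can be
   cancelled. *)
have s : (p + q) ^+ 2 <= 2 * nn * k * f * (p + q).
  have a1 : (p + q) ^+ 2 <= 2 * (p ^+ 2 + q ^+ 2) by have := sqr_ge0 (p - q); nra.
  have a2 : p ^+ 2 + q ^+ 2 <= nn * f * (C1 * (p + d) + d).
    by rewrite (le_trans (lerD F1 F2))// -!mulrA -mulrDr -mulrDr.
  have a3 : C1 * (p + d) + d <= k * (p + q).
    have -> : C1 * (p + d) + d = C1 * p + (C1 + 1) * d by ring.
    have : (C1 + 1) * d <= (C1 + 1) * (C2 * (p + q)) by rewrite ler_wpM2l// addr_ge0.
    have := mulr_ge0 C10 q0; rewrite /k; lra.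
  have := ler_wpM2l nf a3; lra.
have t : p + q <= 2 * nn * k * f.
  have [z|nz] := eqVneq (p + q) 0; first by rewrite z !mulr_ge0.
  have sp : 0 < p + q by rewrite lt_neqAle eq_sym nz addr_ge0.
  by rewrite -(ler_pM2r sp) -expr2.
have a : G <= C1 * ((1 + C2) * (p + q)).
  rewrite (le_trans g)// ler_wpM2l// mulrDl mul1r; lra.
have : C1 * ((1 + C2) * (p + q)) <= C1 * ((1 + C2) * (2 * nn * k * f)).
  by rewrite ler_wpM2l// ler_wpM2l// addr_ge0.
lra.
Qed.

(** Bootstrap: the Laplacian gains two derivatives and costs [P u] plus a first order term in
    [Dx u]. The induction hypothesis applies to [Dx u], which has mean zero and satisfies
    [P (Dx u) = Dx (P u)], at the price of one more derivative of [P u]. *)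
Theorem Pf_estimate k : exists m (C : R), 0 <= C /\ forall u, mean_zero u -> nrm k u <= C * nrm m (P u).
Proof.
have [C1 C10 H1] := Pf_estimate1.
case: k => [|k].
  by exists 1%N, C1; split => // u mu; rewrite (le_trans _ (H1 _ mu))// nrm_le.
elim: k => [|k [m [C [C0 IH]]]]; first by exists 1%N, C1.
have [D D0 HD] := @elliptic_gain R (n + 1) k; have [F F0 HF] := nrm_first_order al k.
exists (maxn k m.+1), (D * (1 + F * C)).
split; first by rewrite mulr_ge0// addr_ge0// mulr_ge0.
move=> u mu; rewrite (le_trans (HD _ mu))// -mulrA ler_wpM2l// (lap_Pf alD).
rewrite (le_trans (nrmD _ _ _))// mulrDl mul1r lerD//; first by rewrite nrm_le// leq_maxl.
rewrite (le_trans (HF _))// -mulrA ler_wpM2l// (le_trans (IH _ _))//; first exact: mean_zero_partial.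
by rewrite ler_wpM2l// -(DxPf alD) (le_trans (nrm_partial _ _ _))// nrm_le// leq_maxr.
Qed.

Lemma Pf_closed f : (forall k (e : R), 0 < e -> exists u, nrm k (P u - f) <= e) -> exists u, P u = f.
Proof.
move=> Hf.
suff [u Hu] : exists u, forall j : 'I_1, P u = f by exists u; exact: (Hu ord0).
apply: (@closed_range_of_estimate R (n + 1) 1 (fun=> P) mean_zero _ _ _ _ _ (fun=> f)).
- by move=> _; exact: tame_Pf.
- by move=> _; exact: PfB.
- exact: mean_zeroB.
- move=> k; have [m [C [C0 H]]] := Pf_estimate k; exists m, C; split => // u mu.
  by rewrite big_ord1; exact: H.
- move=> u k e e0; have [c mc] := mean_proj u; exists (u - c *: (1 : T)); split => // _.
  by rewrite PfB PfZ Pf1 scaler0 subr0 subrr nrm0 ltW.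
- by move=> k e /(Hf k)[u Hu]; exists u => _.
Qed.

(** [P u] is a sum of [X_j (X_j u)], so the estimate for [P] is also one for the system, with one
    more derivative on the images. *)
Lemma Xf_closed (F : 'I_n -> T) :
  (forall k (e : R), 0 < e -> exists u, forall j, nrm k (X j u - F j) <= e) -> exists u, forall j, X j u = F j.
Proof.
apply: (@closed_range_of_estimate R (n + 1) n X mean_zero).
- exact: tame_Xf.
- exact: XfB.
- exact: mean_zeroB.
- move=> k; have [m [C [C0 H]]] := Pf_estimate k; have [D D0 HD] := nrm_Pf_le_Xf m.
  exists m.+1, (C * D); split => [|u mu]; first by rewrite mulr_ge0.
  by rewrite (le_trans (H _ mu))// -mulrA ler_wpM2l.
- move=> u k e e0; have [c mc] := mean_proj u; exists (u - c *: (1 : T)); split => // j.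
  by rewrite XfB XfZ Xf1 scaler0 subr0 subrr nrm0 ltW.
Qed.

End curved.
End noninvolutive_estimates.

(** * Non-commuting fields: surjectivity onto the functions of mean zero *)

Section continuity_method.
Context {R : realType} {n : nat}.
Notation T := (torus_fun R (n + 1)).
Notation freq := {ffun 'I_(n + 1) -> int}.
Implicit Types (f g u w : T).
Variable al : 'I_n -> T.
Hypothesis alD : forall j, Dx (al j) = 0.
Hypothesis alR : forall j, tconj (al j) = al j.
Variables (j0 k0 : 'I_n).
Hypothesis curv0 : curv al j0 k0 != 0.
Notation X := (Xf al).
Notation P := (Pf al).

Definition Dx_eigen (xi : R) (u : T) := Dx u = ('i * xi%:C) *: u.

Lemma Dx_eigen_orth xi xi' f g : Dx_eigen xi f -> Dx_eigen xi' g -> xi != xi' -> rip f g = 0.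
Proof.
move=> ef eg ne.
have := Dx_skew ('i *: f) g; rewrite DxZ ef eg !scalerA mulrA sqri mulN1r.
have ri (h h' : T) : rip ('i *: h) ('i *: h') = rip h h'.
  by rewrite ripJ scalerA sqri scaleN1r ripNr opprK.
rewrite -rmorphN ripZrl -scalerA ri ripZrr => /eqP.
by rewrite mulNr eqr_opp -subr_eq0 -mulrBl mulf_eq0 subr_eq0 (negbTE ne) => /eqP.
Qed.

Section fixed_frequency.
Variable xi : R.
Hypothesis xi0 : xi != 0.
Notation M := (Dx_eigen xi).

Lemma M_subspace : subspace M.
Proof.
split; first by rewrite /Dx_eigen scaler0 /Dx pd0.
by move=> c f g Mf Mg; rewrite /Dx_eigen DxD DxZ Mf Mg scalerDr !scalerA mulrC.
Qed.

Lemma M_mean_zero u : M u -> mean_zero u.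
Proof.
move=> Mu; have -> : u = ('i * xi%:C)^-1 *: Dx u.
  rewrite Mu scalerA mulVf ?scale1r// mulf_neq0//; last by rewrite eq_complex/= negb_and xi0.
  by rewrite eq_complex/= negb_and oner_eq0 orbT.
exact/mean_zeroZ/mean_zero_partial.
Qed.

Lemma nrm_Dx_M k u : M u -> nrm k (Dx u) = `|xi| * nrm k u.
Proof.
move=> ->; rewrite nrmZ; congr (_ * _).
by rewrite ComplexField.Normc.normcM normc_real /= expr0n expr1n add0r sqrtr1 mul1r.
Qed.

(** The path starts at [lap - 1], whose symbol vanishes nowhere and whose energy controls [u]
    together with its gradient, and ends at [P]. *)
Definition Ls (s : R) u : T := (1 - s)%:C *: (lap u - u) + s%:C *: P u.

Lemma Ls_lap s u : Ls s u = lap u - ((1 - s)%:C *: u + s%:C *: first_order al (Dx u)).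
Proof.
have E : P u = lap u - first_order al (Dx u) by rewrite (lap_Pf alD) addrK.
by rewrite /Ls E rmorphB rmorph1 !scalerBr !scalerBl !scale1r; ring.
Qed.

Lemma LsD s : {morph Ls s : f g / f + g}.
Proof. by move=> f g; rewrite /Ls lapD PfD !(scalerDr, scalerBr); ring. Qed.
Lemma LsZ s (c : R[i]) : {morph Ls s : f / c *: f}.
Proof.
move=> f; rewrite /Ls lapZ PfZ -scalerBr [RHS]scalerDr; congr (_ + _);
  by rewrite !scalerA mulrC.
Qed.
Lemma Ls_M s u : M u -> M (Ls s u).
Proof.
move=> Mu; rewrite /Dx_eigen /Ls DxD !DxZ DxB (DxPf alD) /Dx -lap_partial -/(Dx u) Mu PfZ lapZ.
by rewrite [RHS]scalerDr -scalerBr !scalerA; congr (_ *: _ + _ *: _); rewrite mulrC.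
Qed.

Lemma Ls_energy s u : - rip (Ls s u) u =
  (1 - s) * (\sum_i n2 (pd i u) ^+ 2 + n2 u ^+ 2) + s * \sum_j n2 (X j u) ^+ 2.
Proof.
rewrite ripDl !ripZrl ripBl lap_energy -(Pf_energy alD alR) -n2_sqr.
move: (\sum_i _) (rip _ _) (n2 u) => a b c; ring.
Qed.

(** On [M] the norm of [Dx u] is [|xi|] times that of [u], so [nX u] alone controls the gradient.
    Each endpoint energy thus dominates the squared gradient norm with the same constant [m], and so
    does every convex combination of them. *)
Lemma Ls_estimate1 : exists2 C : R, 0 <= C & forall s u, 0 <= s <= 1 -> M u ->
  nrm 1 u <= C * n2 (Ls s u).
Proof.
have [C1 C10 H1] := grad_le_nX al; have [C2 C20 H2] := Dx_le_nX alD alR curv0.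
pose K := C1 * (1 + C2 * (1 + `|xi|)).
have K0 : 0 <= K by rewrite mulr_ge0// addr_ge0// mulr_ge0// addr_ge0.
have gX u : M u -> \sum_i n2 (pd i u) <= K * nX al u.
  move=> Mu; rewrite (le_trans (H1 u))// /K -mulrA ler_wpM2l// mulrDl mul1r lerD2l.
  rewrite (le_trans (H2 u))// -mulrA ler_wpM2l// mulrDl mul1r lerD2l /nX mulr_sumr.
  apply: ler_sum => j _.
  by rewrite -(DxXf alD) -!nrm0E nrm_Dx_M// /Dx_eigen (DxXf alD) Mu XfZ.
pose m : R := (n + 1)%:R + n%:R * K ^+ 2.
have m0 : 0 <= m by rewrite addr_ge0// mulr_ge0// sqr_ge0.
exists (4 * m) => [|s u /andP[s0 s1] Mu]; first by rewrite mulr_ge0.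
set G := \sum_i n2 (pd i u).
have G0 : 0 <= G by apply: sumr_ge0 => i _; exact: n2_ge0.
have uG : n2 u <= G by apply: poincare; exact: M_mean_zero.
have e1 : G ^+ 2 <= (n + 1)%:R * \sum_i n2 (pd i u) ^+ 2 by exact: sqr_sum_le.
have e2 : G ^+ 2 <= K ^+ 2 * (n%:R * \sum_j n2 (X j u) ^+ 2).
  apply: (@le_trans _ _ ((K * nX al u) ^+ 2)).
    rewrite ler_pXn2r ?nnegrE; [exact: gX|by []|exact: G0|].
    by apply: mulr_ge0 K0 (nX_ge0 al u).
  by rewrite exprMn ler_wpM2l ?sqr_ge0// nX_sqr.
have e3 := Ls_energy s u; have e4 := ripN_le (Ls s u) u.
have -> : nrm 1 u = n2 u + G by [].
have A0 : 0 <= \sum_i n2 (pd i u) ^+ 2 by apply: sumr_ge0 => i _; exact: sqr_ge0.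
have B0 : 0 <= \sum_j n2 (X j u) ^+ 2 by apply: sumr_ge0 => i _; exact: sqr_ge0.
clear gX; subst m; have n0 : 0 <= n%:R :> R by []. have n10 : 0 <= (n + 1)%:R :> R by [].
have L0 := n2_ge0 (Ls s u); have u0 := n2_ge0 u.
move: G0 uG e1 e2 e3 e4 A0 B0 n0 n10 L0 m0 K0 u0.
move: (\sum_i n2 (pd i u) ^+ 2) (\sum_j n2 (X j u) ^+ 2) G (n2 u) (n2 (Ls s u)) (rip _ _) (n%:R : R) ((n+1)%:R : R) K s0 s1.
clear; move=> A B G x L r nn n1 K s0 s1 G0 uG e1 e2 e3 e4 A0 B0 n0 n10 L0 m0 K0 x0.
have k2 := sqr_ge0 K.
have h1 : G ^+ 2 <= (n1 + nn * K ^+ 2) * A.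
  by rewrite mulrDl (le_trans e1)// lerDl !mulr_ge0.
have h2 : G ^+ 2 <= (n1 + nn * K ^+ 2) * B.
  by rewrite mulrDl (le_trans e2)// mulrA [K ^+ 2 * nn]mulrC lerDr mulr_ge0.
set mm := n1 + nn * K ^+ 2 in m0 h1 h2 *.
have s1' : 0 <= 1 - s by rewrite subr_ge0.
have h3 : G ^+ 2 <= mm * (L * G).
  have t1 := ler_wpM2l s1' h1; have t2 := ler_wpM2l s0 h2.
  have t3 : L * x <= L * G by rewrite ler_wpM2l.
  have t4 : (1 - s) * A + s * B <= L * G.
    have := mulr_ge0 s1' (sqr_ge0 x); lra.
  have := ler_wpM2l m0 t4; lra.
have h4 : G <= mm * L.
  have [->|Gn] := eqVneq G 0; first by rewrite mulr_ge0.
  have Gp : 0 < G by rewrite lt_neqAle eq_sym Gn.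
  by rewrite -(ler_pM2r Gp) -mulrA -expr2.
have := mulr_ge0 m0 L0; lra.
Qed.

(** On [M] the term [first_order (Dx u)] is [xi] times an operator of order one in [u], so elliptic
    regularity gains one order at each step with constants independent of [s]. *)
Lemma Ls_estimate k : exists2 C : R, 0 <= C & forall s u, 0 <= s <= 1 -> M u ->
  nrm k.+2 u <= C * nrm k (Ls s u).
Proof.
have step k' (C : R) : 0 <= C -> (forall s u, 0 <= s <= 1 -> M u -> nrm k'.+1 u <= C * nrm k' (Ls s u)) ->
    exists2 C : R, 0 <= C & forall s u, 0 <= s <= 1 -> M u -> nrm k'.+2 u <= C * nrm k' (Ls s u).
  move=> C0 HC; have [D D0 HD] := @elliptic_gain R (n + 1) k'.
  have [F F0 HF] := nrm_first_order al k'.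
  exists (D * (1 + (1 + F * `|xi|) * C)); first by rewrite !(mulr_ge0, addr_ge0).
  move=> s u s01 Mu; have h := HC s u s01 Mu; have /andP[s0 s1] := s01.
  rewrite (le_trans (HD _ (M_mean_zero Mu)))// -mulrA ler_wpM2l//.
  have -> : lap u = Ls s u + ((1 - s)%:C *: u + s%:C *: first_order al (Dx u)) by rewrite Ls_lap subrK.
  rewrite (le_trans (nrmD _ _ _))// [leRHS]mulrDl mul1r lerD2l -mulrA.
  apply: (@le_trans _ _ ((1 + F * `|xi|) * nrm k'.+1 u)); last first.
    by rewrite ler_wpM2l// addr_ge0// mulr_ge0.
  rewrite (le_trans (nrmD _ _ _))// !nrmZ !normc_real mulrDl mul1r.
  have a1 : `|1 - s| <= 1 by rewrite ger0_norm; lra.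
  have a2 : `|s| <= 1 by rewrite ger0_norm.
  apply: lerD.
    by rewrite (le_trans _ (nrm_le u (leqnSn k')))// ler_piMl ?nrm_ge0.
  rewrite (le_trans (ler_piMl _ a2)) ?nrm_ge0// (le_trans (HF _))// nrm_Dx_M//.
  by rewrite mulrA.
elim: k => [|k [C C0 IH]].
  by have [C C0 H] := Ls_estimate1; exact: (step 0 C).
apply: (step _ C) => // s u s01 Mu; rewrite (le_trans (IH _ _ s01 Mu))// ler_wpM2l//.
exact: nrm_le.
Qed.

Definition Ls_dense k s := forall f (e : R), M f -> 0 < e -> exists2 u, M u & nrm k (Ls s u - f) <= e.

(* One step of the continuity method in the norm of order k: the step length depends on k, but finitely
   many steps lead from s = 0 to s = 1. *)
Lemma Ls_dense_step k : exists2 d : R, 0 < d & forall s s', 0 <= s <= 1 -> `|s' - s| <= d ->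
  Ls_dense k s -> Ls_dense k s'.
Proof.
have [C C0 HC] := Ls_estimate k.
have [B B0 HB] : exists2 B : R, 0 <= B & forall u, nrm k (P u - (lap u - u)) <= B * nrm k.+2 u.
  have [B B0 HB] := nrm_Pf_le alD k; exists (B + (n + 1)%:R + 1); first by rewrite !addr_ge0.
  move=> u; rewrite (le_trans (nrmB _ _ _))// -addrA mulrDl lerD// (le_trans (nrmB _ _ _))//.
  by rewrite mulrDl mul1r lerD ?nrm_lap_le// nrm_le// ltnW.
have BC0 : 0 <= B * C by rewrite mulr_ge0.
have BC1 : 0 < 2 * (B * C + 1) by rewrite mulr_gt0// ltr_wpDl.
(* This length makes the change [(s' - s) (P - (lap - 1))] at most half of [Ls s] on [M]; the added
   1 keeps the divisor positive. *)
exists (2 * (B * C + 1))^-1; first by rewrite invr_gt0.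
move=> s s' s01 ds Ds f e Mf e0.
have e4 : 0 < e / 4 by rewrite divr_gt0.
(* Approximate Neumann iteration: correcting by an [e / 4]-approximate solution of
   [Ls s v = f - Ls s' u] halves the error up to [e / 4 + e / 8], and [3 * (e / 4)] is the fixed
   point of this recursion. *)
have key m : exists2 u, M u & nrm k (Ls s' u - f) <= 2^-1 ^+ m * nrm k f + 3 * (e / 4).
  elim: m => [|m [u Mu Hu]].
    exists 0; first by have [] := M_subspace.
    rewrite -[Ls s' 0](_ : 0 = _); last by rewrite -[X in Ls s' X](scale0r (0 : T)) LsZ scale0r.
    by rewrite sub0r nrmN expr0 mul1r lerDl mulr_ge0// ltW.
  have Mr : M (f - Ls s' u) by apply: (subspaceB M_subspace) => //; exact: Ls_M.
  have [v Mv Hv] := Ds _ _ Mr e4.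
  exists (u + v); first exact: (subspaceD M_subspace).
  have -> : Ls s' (u + v) - f = (Ls s v - (f - Ls s' u)) + (s' - s)%:C *: (P v - (lap v - v)).
    rewrite LsD /Ls !(rmorphB, rmorph1) !scalerBl !scalerBr !scale1r; ring.
  rewrite (le_trans (nrmD _ _ _))// nrmZ normc_real.
  have h1 : nrm k (Ls s v) <= e / 4 + nrm k (f - Ls s' u).
    have -> : Ls s v = (Ls s v - (f - Ls s' u)) + (f - Ls s' u) by rewrite subrK.
    by rewrite (le_trans (nrmD _ _ _))// lerD2r.
  have h2 : `|s' - s| * nrm k (P v - (lap v - v)) <= 2^-1 * nrm k (Ls s v).
    apply: (@le_trans _ _ ((2 * (B * C + 1))^-1 * (B * C * nrm k (Ls s v)))).
      apply: ler_pM => //; first exact: nrm_ge0.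
      by rewrite (le_trans (HB v))// -mulrA ler_wpM2l// HC.
    rewrite mulrA ler_wpM2r ?nrm_ge0// mulrC ler_pdivrMr// mulrA mulVf// mul1r lerDl//.
  rewrite nrm_distC in Hu; rewrite exprS -mulrA; move: Hv h1 h2 Hu; clear.
  move: (nrm k _) (nrm k _) (_ * nrm k _) (nrm k _) (2^-1 ^+ m * _) => a b c d x.
  by lra. 
have [m Hm] : exists m : nat, 2^-1 ^+ m * nrm k f <= e / 4.
  have [m Hm] := half_pow_small (nrm_ge0 k f) e4.
  by exists m; rewrite mulrC ltW.
have [u Mu Hu] := key m; exists u => //; rewrite (le_trans Hu)//; lra.
Qed.

(** An element of [M] is orthogonal to the exponentials of any other frequency in [x], so it is a
    limit of combinations of those in [M], each an eigenfunction of [lap - 1] with eigenvalue at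
    most -1. *)
Lemma Ls_dense0 k : Ls_dense k 0.
Proof.
move=> f e Mf e0.
pose W g := exists2 u, M u & Ls 0 u = g.
have sW : subspace W.
  split.
    exists 0; first by have [] := M_subspace.
    by rewrite -[X in Ls 0 X](scale0r (0 : T)) LsZ scale0r.
  move=> c _ _ [u Mu <-] [v Mv <-]; exists (c *: u + v); last by rewrite LsD LsZ.
  by have [_] := M_subspace; apply.
pose res (kappa : freq) := (kappa ix)%:~R != xi.
have [|g [[s [c [us sr ->]]] Hg]] := tcl_nonresonant expo_eigenfamily (res := res) (f := f) _ k e0.
  move=> kappa r z; apply: (Dx_eigen_orth (xi := xi) (xi' := (kappa ix)%:~R)) => //.
    by rewrite /Dx_eigen DxZ /Dx expo_partial int_realc !scalerA mulrC.
  by rewrite eq_sym.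
suff [u Mu Hu] : W (comb (@expo R (n + 1)) s c) by exists u; rewrite // Hu nrm_distC.
rewrite /comb big_seq; apply: subspace_sum => // kappa ks.
have /eqP rk : (kappa ix)%:~R == xi by have := allP sr _ ks; rewrite negbK.
have nz : (- (\sum_i (kappa i)%:~R ^+ 2 : R) - 1)%:C != 0 :> R[i].
  rewrite eq_complex/= negb_and; apply/orP; left; rewrite -opprD oppr_eq0 gt_eqF//.
  by rewrite ltr_wpDl// sumr_ge0// => i _; exact: sqr_ge0.
exists ((c kappa / (- (\sum_i (kappa i)%:~R ^+ 2 : R) - 1)%:C) *: expo kappa).
  apply: (subspaceZ M_subspace); rewrite /Dx_eigen /Dx expo_partial int_realc.
  by rewrite rk.
rewrite LsZ /Ls subr0 scale0r addr0 scale1r lap_expo -{2}[expo kappa]scale1r -scalerBl scalerA.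
by rewrite -(rmorph1 (real_complex R)) -rmorphB divfK.
Qed.

Lemma Ls_dense1 k : Ls_dense k 1.
Proof.
have [d d0 step] := Ls_dense_step k.
have := archi_boundP (ltW (_ : 0 < d^-1)); rewrite invr_gt0 => /(_ d0).
set m := Num.bound _ => dm.
have m0 : 0 < m%:R :> R by apply: lt_trans dm; rewrite invr_gt0.
have dm' : m%:R^-1 <= d by rewrite -[d]invrK lef_pV2 ?posrE ?invr_gt0// ltW.
have H i : (i <= m)%N -> Ls_dense k (i%:R / m%:R).
  elim: i => [|i IH] im; first by rewrite mul0r; exact: Ls_dense0.
  apply: step (IH (ltnW im)).
    apply/andP; split; first exact: divr_ge0.
    by rewrite ler_pdivrMr// mul1r ler_nat ltnW.
  by rewrite -mulrBl -natrB ?leqnSn// subSnn mul1r ger0_norm// invr_ge0 ltW.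
by have := H m (leqnn m); rewrite divff ?gt_eqF.
Qed.

End fixed_frequency.

(** Without dependence on [x], [P] acts as the Laplacian and the exponential is an eigenfunction.
    Otherwise the continuity method yields approximate solutions in every norm, and the closed range
    of [P] turns them into one exact solution. *)
Lemma expo_range (kappa : freq) : kappa != freq0 (N := n + 1) -> exists u : T, P u = expo kappa.
Proof.
move=> k0'; have [kx|kx] := eqVneq (kappa ix) 0.
  have D0 : Dx (expo kappa) = 0 :> T by rewrite /Dx expo_partial kx mulr0 scale0r.
  have E : P (expo kappa) = lap (expo kappa).
    rewrite (lap_Pf alD) D0 /first_order /Dx pd0 sub0r big1 ?oppr0 ?addr0// => j _.
    by rewrite /dt pd0 !mulr0 pd0 !addr0.
  have nz : (- (\sum_i (kappa i)%:~R ^+ 2 : R))%:C != 0 :> R[i].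
    rewrite eq_complex/= negb_and oppr_eq0; apply/orP; left; rewrite gt_eqF//.
    have h : 1 <= \sum_i (kappa i)%:~R ^+ 2 :> R := freq_norm k0'.
    exact: lt_le_trans ltr01 h.
  exists ((- (\sum_i (kappa i)%:~R ^+ 2 : R))%:C^-1 *: expo kappa).
  by rewrite PfZ E lap_expo scalerA mulVf// scale1r.
have xi0 : (kappa ix)%:~R != 0 :> R by rewrite intr_eq0.
apply: (Pf_closed alD alR curv0) => k e e0.
have Me : Dx_eigen (kappa ix)%:~R (expo kappa) by rewrite /Dx_eigen /Dx expo_partial int_realc.
have [u _ Hu] := Ls_dense1 xi0 k Me e0.
by exists u; move: Hu; rewrite /Ls subrr scale0r add0r scale1r.
Qed.

Theorem Pf_onto f : mean_zero f -> exists u, P u = f.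
Proof.
move=> mf; apply: (Pf_closed alD alR curv0) => k e e0.
have [g [[s [c [us sr ->]]] Hg]] := tcl_nonresonant expo_eigenfamily (mean_zero_res mf) k e0.
suff [u Hu] : exists u, P u = comb (@expo R (n + 1)) s c by exists u; rewrite Hu nrm_distC.
have sW : subspace (fun g => exists u, P u = g).
  split; first by exists 0; apply: big1 => j _; rewrite !Xf0.
  by move=> b _ _ [u <-] [v <-]; exists (b *: u + v); rewrite PfD PfZ.
rewrite /comb big_seq; apply: (subspace_sum sW) => kappa ks.
by apply: (subspaceZ sW); apply: expo_range; exact: (allP sr _ ks).
Qed.

End continuity_method.

(** * Distributions and transposition *)

Section complex_integral.
Context {R : realType} {N : nat}.
Notation T := (torus_fun R N).
Implicit Types (f g v phi : T).

Definition cint f : R[i] := RI f +i* RI (- 'i *: f).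

Lemma dist_ofE v phi : dist_of v phi = cint (v * phi).
Proof. exact: (torus_intE (v * phi)). Qed.

Lemma cintD f g : cint (f + g) = cint f + cint g.
Proof. by rewrite /cint scalerDr !RID; apply/eqP; rewrite eq_complex/= !eqxx. Qed.

Lemma cintZ (c : R[i]) f : cint (c *: f) = c * cint f.
Proof.
have E : c *: f = (complex.Re c)%:C *: f + (- complex.Im c)%:C *: (- 'i *: f).
  rewrite scalerA -scalerDl; congr (_ *: _); case: c => x y.
  by apply/eqP; rewrite eq_complex/=; apply/andP; split; apply/eqP; ring.
have E' : - 'i *: (c *: f) = (complex.Re c)%:C *: (- 'i *: f) + (complex.Im c)%:C *: f.
  rewrite !scalerA -scalerDl; congr (_ *: _); case: c {E} => x y.
  by apply/eqP; rewrite eq_complex/=; apply/andP; split; apply/eqP; ring.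
rewrite /cint E' E !RID !RIZ; case: c {E E'} => x y /=.
by apply/eqP; rewrite eq_complex/=; apply/andP; split; apply/eqP; ring.
Qed.

Lemma cintN f : cint (- f) = - cint f.
Proof. by rewrite -scaleN1r cintZ mulN1r. Qed.
Lemma cintB f g : cint (f - g) = cint f - cint g.
Proof. by rewrite cintD cintN. Qed.
Lemma cint0 : cint (0 : T) = 0.
Proof. by rewrite -(scale0r (0 : T)) cintZ mul0r. Qed.
Lemma cint_sum I (r : seq I) (P : pred I) (F : I -> T) :
  cint (\sum_(i <- r | P i) F i) = \sum_(i <- r | P i) cint (F i).
Proof. by rewrite (big_morph cint cintD cint0). Qed.

Lemma cint_partial i f : cint (pd i f) = 0.
Proof. by rewrite /cint -pdZ !RI_partial. Qed.

Lemma cint_by_parts i f g : cint (pd i f * g) = - cint (f * pd i g).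
Proof. by apply/eqP; rewrite -addr_eq0 -cintD -pdM cint_partial. Qed.

Lemma cint_mean_zero f : cint f = 0 -> mean_zero f.
Proof.
move=> f0 z; rewrite ripE tconjZ tconj1 -tscalerAr mulr1.
by have := cintZ (conjc z) f; rewrite f0 mulr0 => /(congr1 (@complex.Re R)).
Qed.

Lemma dist_of_scalar v : scalar (dist_of v).
Proof. by move=> c f g; rewrite !dist_ofE mulrDr -tscalerAr cintD cintZ. Qed.

(* Almost global hypoellipticity of the system of transposes of the A i; a divergence-free field is
   minus its own transpose, so this covers both the fields and their sum of squares. *)
Definition agh (I : Type) (A : I -> T -> T) := forall u : functional R N, Defs.distribution u ->
  (forall i, exists g, forall phi, u (A i phi) = dist_of g phi) ->
  exists v, forall i phi, u (A i phi) = dist_of v (A i phi).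

(** The scalar [e] is the sign created by transposition: -1 for a divergence-free field, 1 for a sum
    of their squares. *)
Lemma aghP (S : set (functional R N -> functional R N)) I (A : I -> T -> T) (e : R[i]) :
  e != 0 ->
  (forall Q, S Q -> exists i, forall u, scalar u -> forall phi, Q u phi = e * u (A i phi)) ->
  (forall i, exists2 Q, S Q & forall u, scalar u -> forall phi, Q u phi = e * u (A i phi)) ->
  almost_globally_hypoelliptic S <-> agh A.
Proof.
move=> e0 SA AS.
have sB u v : scalar u -> scalar (u - dist_of v).
  move=> su c f g; rewrite !fctE su dist_of_scalar mulrBr.
  by rewrite opprD addrACA.
split=> H u du Hu.
  have su := du.1.
  have [|v Hv] := H u du.
    move=> Q /SA[i Qi]; have [g Hg] := Hu i; exists (e *: g).
    by apply/funext => phi; rewrite (Qi _ su) Hg !dist_ofE -tscalerAl cintZ.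
  exists v => i phi; have [Q SQ Qi] := AS i.
  have := congr1 (fun F => F phi) (Hv Q SQ); rewrite (Qi _ (sB _ v su)) => /eqP.
  by rewrite mulf_eq0 (negbTE e0)/= subr_eq0 => /eqP.
have su := du.1.
have [|v Hv] := H u du.
  move=> i; have [Q SQ Qi] := AS i; have [g Hg] := Hu Q SQ; exists (e^-1 *: g) => phi.
  by rewrite dist_ofE -tscalerAl cintZ -dist_ofE -Hg (Qi _ su) mulrA mulVf// mul1r.
exists v => Q /SA[i Qi]; apply/funext => phi; rewrite (Qi _ (sB _ v su)) !fctE Hv subrr.
exact: mulr0.
Qed.

End complex_integral.

Section transposition.
Context {R : realType} {N : nat}.
Notation T := (torus_fun R N).
Implicit Types (X : 'I_N -> T) (u : T -> R[i]).

Lemma functional0 u : scalar u -> u 0 = 0.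
Proof.
move=> su; have := su 1 0 0; rewrite scale1r addr0 mul1r => /eqP.
by rewrite -subr_eq0 opprD addrA subrr sub0r oppr_eq0 => /eqP.
Qed.
Lemma functionalD u f g : scalar u -> u (f + g) = u f + u g.
Proof. by move=> su; have := su 1 f g; rewrite scale1r mul1r. Qed.
Lemma functionalZ u c f : scalar u -> u (c *: f) = c * u f.
Proof. by move=> su; have := su c f 0; rewrite !addr0 (functional0 su) addr0. Qed.
Lemma functional_sum u I (r : seq I) (P : pred I) (F : I -> T) : scalar u ->
  u (\sum_(i <- r | P i) F i) = \sum_(i <- r | P i) u (F i).
Proof.
move=> su; elim/big_rec2: _ => [|i y x _ <-]; first exact: functional0.
by rewrite functionalD.
Qed.

Lemma vf_actE X f : vf_act X f = \sum_k X k * pd k f.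
Proof. by rewrite /vf_act pd.unlock. Qed.

Lemma vf_dist_div_free X u phi : (forall k, pd k (X k) = 0) -> scalar u ->
  vf_dist X u phi = - u (vf_act X phi).
Proof.
move=> dX su; rewrite vf_actE (functional_sum _ _ _ su) -sumrN /vf_dist.
rewrite fct_sumE; apply: eq_bigr => k _.
rewrite /dist_mul /dist_partial.
have -> : tpartial k (X k * phi) = pd k (X k * phi) by rewrite pd.unlock.
by rewrite pdM dX mul0r add0r.
Qed.

Lemma vf_act_lin X : forall (c : R[i]) f g, vf_act X (c *: f + g) = c *: vf_act X f + vf_act X g.
Proof.
move=> c f g; rewrite !vf_actE scaler_sumr -big_split; apply: eq_bigr => k _.
by rewrite pdD pdZ mulrDr tscalerAr.
Qed.

Lemma vf_dist_scalar X u : (forall k, pd k (X k) = 0) -> scalar u -> scalar (vf_dist X u).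
Proof.
move=> dX su c f g; rewrite !vf_dist_div_free// vf_act_lin su.
by rewrite opprD mulrN.
Qed.

Lemma sum_squares_dist_div_free d (X : 'I_d -> 'I_N -> T) u phi :
  (forall j k, pd k (X j k) = 0) -> scalar u ->
  sum_squares_dist X u phi = u (sum_squares_act X phi).
Proof.
move=> dX su; rewrite /sum_squares_act (functional_sum _ _ _ su) /sum_squares_dist fct_sumE.
apply: eq_bigr => j _; rewrite vf_dist_div_free//; last exact: vf_dist_scalar.
by rewrite vf_dist_div_free// opprK.
Qed.

End transposition.

Section transposed_fields.
Context {R : realType} {n : nat}.
Notation T := (torus_fun R (n + 1)).
Implicit Types (v phi : T).
Variable al : 'I_n -> T.
Hypothesis alD : forall j, Dx (al j) = 0.

Lemma dist_of_Xf j v phi : dist_of (Xf al j v) phi = - dist_of v (Xf al j phi).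
Proof.
rewrite !dist_ofE /Xf mulrDl mulrDr !cintD opprD /dt cint_by_parts; congr (_ + _).
have -> : al j * Dx v * phi = Dx v * (al j * phi) by ring.
by rewrite /Dx cint_by_parts -/(Dx _) DxM alD mul0r add0r.
Qed.

Lemma dist_of_Pf v phi : dist_of (Pf al v) phi = dist_of v (Pf al phi).
Proof.
rewrite dist_ofE mulr_suml cint_sum [RHS]dist_ofE mulr_sumr cint_sum.
by apply: eq_bigr => j _; rewrite -!dist_ofE !dist_of_Xf opprK.
Qed.

End transposed_fields.

Section tube_fields.
Context {R : realType} {n : nat}.
Notation T := (torus_fun R (n + 1)).
Implicit Types (f g u phi : T).

Lemma real_conjc (z : R[i]) : z \is Num.real -> conjc z = z.
Proof.
case: z => x y; rewrite realE !lecE/= => H; have y0 : y = 0.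
  by case/orP: H => /andP[/eqP h _]; first [by rewrite h|by rewrite -h].
by apply/eqP; rewrite eq_complex/= y0 oppr0 !eqxx.
Qed.

Lemma derive_lsubmx (g : 'rV[R]_n -> R) (x v : 'rV[R]_(n + 1)) :
  'D_v (fun y : 'rV[R]_(n + 1) => g (lsubmx y)) x = 'D_(lsubmx v) g (lsubmx x).
Proof.
have Q : (fun h : R => h^-1 *: (((fun y : 'rV[R]_(n + 1) => g (lsubmx y)) \o shift x) (h *: v) - g (lsubmx x)))
    = (fun h : R => h^-1 *: ((g \o shift (lsubmx x)) (h *: lsubmx v) - g (lsubmx x))).
  apply/funext => h /=; congr (_ *: (g _ - _)).
  by apply/rowP => j; rewrite !mxE.
by rewrite /derive Q.
Qed.

Lemma Dx_pullback (f : torus_fun R n) : Dx (pullback 1 f) = 0.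
Proof.
apply: tfun_ext => x; rewrite /Dx pdE tfun0.
have D0 (g : 'rV[R]_n -> R) : partial ix (fun y : 'rV[R]_(n + 1) => g (lsubmx y)) x = 0.
  rewrite /partial derive_lsubmx (_ : lsubmx (delta_mx 0 ix : 'rV[R]_(n + 1)) = 0) ?derive0//.
  by apply/rowP => j; rewrite !mxE eq_lrshift andbF.
by rewrite (D0 (fun y => complex.Re (f y))) (D0 (fun y => complex.Im (f y))).
Qed.

Lemma dt_pullback j (f : torus_fun R n) : dt j (pullback 1 f) = pullback 1 (pd j f).
Proof.
apply: tfun_ext => x; rewrite /dt pdE /= pdE.
have D0 (g : 'rV[R]_n -> R) : partial (lshift 1 j) (fun y : 'rV[R]_(n + 1) => g (lsubmx y)) x
    = partial j g (lsubmx x).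
  rewrite /partial derive_lsubmx (_ : lsubmx (delta_mx 0 (lshift 1 j) : 'rV[R]_(n + 1)) = delta_mx 0 j)//.
  by apply/rowP => i; rewrite !mxE (inj_eq (@lshift_inj _ _)).
by rewrite (D0 (fun y => complex.Re (f y))) (D0 (fun y => complex.Im (f y))).
Qed.

Lemma pullback_conj (f : torus_fun R n) : (forall t, f t \is Num.real) ->
  tconj (pullback 1 f) = pullback 1 f.
Proof. by move=> fr; apply: tfun_ext => x; rewrite tconjE; apply: real_conjc; exact: fr. Qed.

Variable a : 'I_n -> torus_fun R n.
Hypothesis ha : forall j t, a j t \is Num.real.

Definition lifted (j : 'I_n) : T := pullback 1 (a j).
Notation al := lifted.

Lemma lifted_Dx j : Dx (al j) = 0. Proof. exact: Dx_pullback. Qed.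
Lemma lifted_conj j : tconj (al j) = al j. Proof. exact: pullback_conj. Qed.

Lemma tube_field_l j i : tube_field a j (lshift 1 i) = (i == j)%:R.
Proof. by rewrite /tube_field (unsplitK (inl i)). Qed.
Lemma tube_field_r j : tube_field a j ix = al j.
Proof. by rewrite /tube_field (unsplitK (inr ord0)). Qed.

Lemma tube_field_div_free j k : pd k (tube_field a j k) = 0.
Proof.
case: (split_ordP k) => i ->.
  by rewrite tube_field_l; case: (i == j); rewrite ?pd1 ?pd0.
by rewrite (ord1 i) -/ix tube_field_r; exact: lifted_Dx.
Qed.

Lemma vf_act_tube j f : vf_act (tube_field a j) f = Xf al j f.
Proof.
rewrite vf_actE sum_tube tube_field_r /Xf; congr (_ + _).
rewrite (bigD1 j)//= big1 ?addr0 => [|i ij].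
  by rewrite tube_field_l eqxx mul1r.
by rewrite tube_field_l (negbTE ij) mul0r.
Qed.

Lemma sum_squares_act_tube f : sum_squares_act (tube_field a) f = Pf al f.
Proof. by apply: eq_bigr => j _; rewrite !vf_act_tube. Qed.

Lemma agh_tube : almost_globally_hypoelliptic [set vf_dist X | X in tube_system a] <-> agh (Xf al).
Proof.
apply: (@aghP _ _ _ _ _ (-1)); first by rewrite oppr_eq0 oner_eq0.
  move=> Q [X [j _ <-] <-]; exists j => u su phi.
  by rewrite vf_dist_div_free ?vf_act_tube ?mulN1r// => k; exact: tube_field_div_free.
move=> j; exists (vf_dist (tube_field a j)); first by exists (tube_field a j) => //; exists j.
move=> u su phi; rewrite vf_dist_div_free ?vf_act_tube ?mulN1r// => k; exact: tube_field_div_free.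
Qed.

Lemma agh_sum_squares :
  almost_globally_hypoelliptic [set sum_squares_dist (tube_field a)] <-> agh (fun _ : unit => Pf al).
Proof.
have H (u : functional R (n + 1)) phi : scalar u -> sum_squares_dist (tube_field a) u phi = 1 * u (Pf al phi).
  move=> su; rewrite mul1r sum_squares_dist_div_free ?sum_squares_act_tube//.
  exact: tube_field_div_free.
apply: (@aghP _ _ _ _ _ 1); first exact: oner_neq0.
  by move=> Q ->; exists tt => u su phi; exact: H.
by move=> _; exists (sum_squares_dist (tube_field a)) => // u su phi; exact: H.
Qed.

Lemma globally_solvable_sum_squares : globally_solvable (sum_squares_act (tube_field a)) <->
  forall f, (forall k (e : R), 0 < e -> exists u, nrm k (Pf al u - f) <= e) -> exists u, Pf al u = f.
Proof.
have -> : sum_squares_act (tube_field a) = Pf al by apply/funext => f; exact: sum_squares_act_tube.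
exact: globally_solvableP.
Qed.

Lemma globally_solvable_tube : globally_solvable_family (fun j => vf_act (tube_field a j)) <->
  forall F : 'I_n -> T, (forall k (e : R), 0 < e -> exists u, forall j, nrm k (Xf al j u - F j) <= e) ->
    exists u, forall j, Xf al j u = F j.
Proof.
have -> : (fun j => vf_act (tube_field a j)) = Xf al.
  by apply/funext => j; apply/funext => f; exact: vf_act_tube.
exact: globally_solvable_familyP.
Qed.

Section curved.
Variables (j0 k0 : 'I_n).
Hypothesis curv0 : curv al j0 k0 != 0.

Lemma curved_agh_Pf : agh (fun _ : unit => Pf al).
Proof.
move=> u du /(_ tt)[g Hg].
have mg : mean_zero g.
  by apply: cint_mean_zero; rewrite -[g]mulr1 -dist_ofE -Hg Pf1; exact: functional0 du.1.
have [v Pv] := Pf_onto lifted_Dx lifted_conj curv0 mg.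
by exists v => _ phi; rewrite Hg -Pv (dist_of_Pf lifted_Dx).
Qed.

(** The data determine [u] on the range of [P], where it agrees with a smooth [v]. Each [X_j phi]
    has mean zero, hence lies in that range, so [u] and [v] agree on it as well. *)
Lemma curved_agh_Xf : agh (Xf al).
Proof.
move=> u du Hu; have su := du.1.
have /choice[g Hg] := Hu.
pose h : T := - \sum_j Xf al j (g j).
have uP phi : u (Pf al phi) = dist_of h phi.
  rewrite (functional_sum _ _ _ su) dist_ofE mulNr cintN mulr_suml cint_sum -sumrN.
  by apply: eq_bigr => j _; rewrite Hg -dist_ofE (dist_of_Xf lifted_Dx) opprK.
have mh : mean_zero h.
  rewrite /h -scaleN1r; apply: mean_zeroZ; apply: mean_zero_sum => j _.
  by apply: mean_zero_Xf; [exact: lifted_Dx|exact: lifted_conj].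
have [v Pv] := Pf_onto lifted_Dx lifted_conj curv0 mh.
exists v => j phi.
have [|psi <-] := Pf_onto lifted_Dx lifted_conj curv0 (f := Xf al j phi).
  by apply: mean_zero_Xf; [exact: lifted_Dx|exact: lifted_conj].
by rewrite uP -Pv (dist_of_Pf lifted_Dx).
Qed.

Lemma lie_algebra_sum (S : set (vector_field R (n + 1))) I (r : seq I) (c : I -> R)
    (Z : I -> vector_field R (n + 1)) :
  (forall i, lie_algebra S (Z i)) -> lie_algebra S (\sum_(i <- r) (c i)%:C *: Z i).
Proof.
move=> SZ; elim: r => [|i r IH]; first by rewrite big_nil; exact: lie_zero.
by rewrite big_cons; apply: lie_add => //; exact: lie_scale.
Qed.

Lemma lie_bracket_tube j k i : lie_bracket (tube_field a j) (tube_field a k) i =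
  if fintype.split i is inr _ then curv al j k else 0.
Proof.
rewrite /lie_bracket !vf_act_tube; case: (split_ordP i) => i' ->.
  rewrite !tube_field_l.
  by case: (i' == k); case: (i' == j); rewrite ?Xf1 ?Xf0 subrr.
rewrite (ord1 i') -/ix !tube_field_r /Xf !lifted_Dx !mulr0 !addr0.
by [].
Qed.

(** The bracket of [X_j0] and [X_k0] points in the [x] direction with coefficient [b]. At a point
    where [b] is nonzero it completes the [X_j] to a basis, and the condition does not depend on
    [x]. *)
Lemma curved_finite_type : exists t : 'rV[R]_n, finite_type a t.
Proof.
have [y yc] : exists y, curv al j0 k0 y != 0.
  apply/not_existsP => H; move/negP: curv0; apply; apply/eqP/tfun_ext => y.
  by have /negP := H y; rewrite negbK => /eqP ->.
have curvE : curv al j0 k0 = pullback 1 (pd j0 (a k0) - pd k0 (a j0)).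
  by apply: tfun_ext => w; rewrite /curv !dt_pullback.
exists (lsubmx y) => x v; set z := row_mx _ _.
have zc : curv al j0 k0 z != 0.
  by move: yc; rewrite curvE /= /z row_mxKl.
set C := complex.Re (curv al j0 k0 z).
have zC : curv al j0 k0 z = C%:C.
  have := tconjE (curv al j0 k0) z; rewrite curvR; last exact: lifted_conj.
  rewrite /C; case: (curv _ _ _ _) => p q [] q0; apply/eqP; rewrite eq_complex/= eqxx/=.
  by apply/eqP; lra.
have C0 : C != 0 by move: zc; rewrite zC eq_complex/= eqxx andbT.
pose r j := complex.Re (al j z).
have zr j : al j z = (r j)%:C.
  have := tconjE (al j) z; rewrite lifted_conj /r; case: (al j z) => p q [] q0.
  by apply/eqP; rewrite eq_complex/= eqxx/=; apply/eqP; lra.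
pose c := (v 0 ix - \sum_j v 0 (lshift 1 j) * r j) / C.
exists (\sum_j (v 0 (lshift 1 j))%:C *: tube_field a j +
        c%:C *: lie_bracket (tube_field a j0) (tube_field a k0)).
  apply: lie_add.
    by apply: lie_algebra_sum => j; apply: lie_gen; exists j.
  by apply: lie_scale; apply: lie_commutator; apply: lie_gen; [exists j0|exists k0].
move=> k; rewrite !fctE fct_sumE tfunD tfun_sum tfunZ lie_bracket_tube.
under eq_bigr do rewrite fctE tfunZ.
case: (split_ordP k) => i ->.
  rewrite [X in _ + X = _](_ : _ = 0); last exact: mulr0.
  rewrite addr0 (bigD1 i)//= big1 => [|j ji].
    by rewrite tube_field_l eqxx tfun1 mulr1 addr0.
  by rewrite tube_field_l eq_sym (negbTE ji) tfun0 mulr0.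
rewrite (ord1 i) -/ix zC.
under eq_bigr do rewrite tube_field_r zr -rmorphM.
by rewrite -rmorph_sum -rmorphM -rmorphD /c divfK// addrC subrK.
Qed.

End curved.
End tube_fields.

(** * Commuting fields: reduction to constant coefficients *)

Section flat_gauge.
Context {R : realType} {n : nat}.
Notation T := (torus_fun R (n + 1)).
Notation freq := {ffun 'I_(n + 1) -> int}.
Implicit Types (f g u : T).
Variable al : 'I_n -> T.
Hypothesis alD : forall j, Dx (al j) = 0.
Hypothesis alR : forall j, tconj (al j) = al j.

Lemma lap_conj f : lap (tconj f) = tconj (lap f).
Proof. by rewrite /lap tconj_sum; apply: eq_bigr => i _; rewrite !pd_conj. Qed.

(** Hodge decomposition: [A] solves [lap A = div al], so the remainder [h] is closed by flatness and
    divergence-free by construction; its components are then harmonic, hence constant. *)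
Lemma flat_gauge : (forall j k, curv al j k = 0) -> exists (A : T) (c : 'I_n -> R),
  [/\ Dx A = 0, tconj A = A & forall j, al j = dt j A + (c j)%:C *: (1 : T)].
Proof.
move=> flat; pose g : T := \sum_j dt j (al j).
have [v lv] : exists v, lap v = g.
  by apply: lap_onto; apply: mean_zero_sum => j _; exact: mean_zero_partial.
(* The real part of [v] solves the same equation because the right-hand side is real. *)
pose A : T := (2^-1)%:C *: (v + tconj v).
have gR : tconj g = g.
  by rewrite /g tconj_sum; apply: eq_bigr => j _; rewrite /dt -pd_conj alR.
have lA : lap A = g.
  rewrite /A lapZ lapD lap_conj lv gR -{1}[g]scale1r -{2}[g]scale1r -scalerDl scalerA.
  rewrite (_ : _ * _ = 1) ?scale1r//; apply/eqP; rewrite eq_complex/=.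
  by apply/andP; split; apply/eqP; field.
have AR : tconj A = A.
  by rewrite /A tconjZ tconjD tconjK addrC; congr (_ *: _); apply/eqP; rewrite eq_complex/= oppr0 !eqxx.
have DA : Dx A = 0.
  apply: grad0_mean_zero; last exact: mean_zero_partial.
  apply: lap0_grad; rewrite /Dx lap_partial lA /g pd_sum big1// => j _.
  by rewrite /dt pdC -/(Dx _) alD pd0.
pose h j : T := al j - dt j A.
have hcurl i j : dt i (h j) = dt j (h i).
  have := flat i j; rewrite /curv => /eqP; rewrite subr_eq0 => /eqP E.
  by rewrite /h /dt !pdB -/(dt i _) -/(dt j _) E (pdC (lshift 1 i)).
have Dh j : Dx (h j) = 0.
  by rewrite /h DxB alD sub0r /dt /Dx pdC -/(Dx A) DA pd0 oppr0.
have hdiv : \sum_i dt i (h i) = 0.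
  have -> : \sum_i dt i (h i) = g - \sum_i dt i (dt i A).
    by rewrite /g -sumrB; apply: eq_bigr => i _; rewrite /h /dt pdB.
  have : lap A = \sum_i dt i (dt i A) + Dx (Dx A) by rewrite /lap sum_tube.
  by rewrite DA /Dx pd0 addr0 lA => ->; rewrite subrr.
have hconst j : exists z : R[i], h j = z *: (1 : T).
  apply: grad0_const; apply: lap0_grad; rewrite /lap sum_tube -!/(Dx _) Dh /Dx pd0 addr0.
  transitivity (dt j (\sum_i dt i (h i))); last by rewrite hdiv /dt pd0.
  rewrite /dt pd_sum; apply: eq_bigr => i _.
  by rewrite -!/(dt i _) hcurl /dt pdC.
have /choice[z Hz] := hconst.
exists A, (fun j => complex.Re (z j)); split => // j.
have zr : (complex.Re (z j))%:C = z j.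
  have : tconj (h j) = h j by rewrite /h tconjB alR /dt -pd_conj AR.
  rewrite Hz tconjZ tconj1 => /(congr1 (fun f : T => f 0)); rewrite !tfunZ tfun1 !mulr1.
  case: (z j) => p q [] q0; apply/eqP; rewrite eq_complex/= eqxx/=; apply/eqP; lra.
by rewrite zr -Hz /h addrC subrK.
Qed.

Variables (A : T) (c : 'I_n -> R).
Hypothesis AD : Dx A = 0.
Hypothesis AR : tconj A = A.
Hypothesis alA : forall j, al j = dt j A + (c j)%:C *: (1 : T).

Lemma gauge_is_phase (xi : R) : is_phase (fun x : 'rV[R]_(n + 1) => - xi * complex.Re (A x)).
Proof.
split; first by apply: smoothM; [exact: smooth_cst|exact: tRe_smooth].
by move=> i; exists 0 => x; rewrite tperiodic mulr0 addr0.
Qed.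

Definition gauge (xi : R) : T := tcis (gauge_is_phase xi).

Lemma conj_real (f : T) x : tconj f = f -> f x = (complex.Re (f x))%:C.
Proof.
move=> /(congr1 (fun g : T => g x)); rewrite tconjE; case: (f x) => p q [] q0.
by apply/eqP; rewrite eq_complex/= eqxx/=; apply/eqP; lra.
Qed.

Lemma gauge_partial xi i : pd i (gauge xi) = ('i * (- xi)%:C) *: (pd i A * gauge xi).
Proof.
rewrite /gauge (@tcis_partial _ _ _ _ i ((- xi)%:C *: pd i A)).
  by rewrite -tscalerAl scalerA.
move=> x; rewrite tfunZ (conj_real x); last by rewrite -pd_conj AR.
rewrite -rmorphM; congr (_ %:C); rewrite /partial.
have -> : (fun y => - xi * complex.Re (A y)) = (- xi) \*: (fun y => complex.Re (A y)) by [].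
rewrite deriveZ; last exact: tRe_derivable.
by rewrite pdE.
Qed.

(* exp(i (k . t + xi (x - A(t)))) for kappa = (k, xi). *)
Definition gexpo (kappa : freq) : T := gauge (kappa ix)%:~R * expo kappa.

Definition gfreq (i : 'I_(n + 1)) (kappa : freq) : R :=
  match fintype.split i with
  | inl j => (kappa (lshift 1 j))%:~R + (kappa ix)%:~R * c j
  | inr _ => (kappa ix)%:~R
  end.

Lemma gfreq_l j kappa : gfreq (lshift 1 j) kappa = (kappa (lshift 1 j))%:~R + (kappa ix)%:~R * c j.
Proof. by rewrite /gfreq (unsplitK (inl j)). Qed.
Lemma gfreq_r kappa : gfreq ix kappa = (kappa ix)%:~R.
Proof. by rewrite /gfreq (unsplitK (inr ord0)). Qed.

Lemma Dx_gauge xi : Dx (gauge xi) = 0.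
Proof. by rewrite /Dx gauge_partial -/(Dx A) AD mul0r scaler0. Qed.

Lemma Dx_gexpo kappa : Dx (gexpo kappa) = ('i * ((kappa ix)%:~R : R)%:C) *: gexpo kappa.
Proof. by rewrite DxM Dx_gauge mul0r add0r /Dx expo_partial int_realc -tscalerAr. Qed.

Lemma Xf_gexpo j kappa : Xf al j (gexpo kappa) = ('i * (gfreq (lshift 1 j) kappa)%:C) *: gexpo kappa.
Proof.
rewrite /Xf Dx_gexpo gfreq_l /gexpo /dt pdM gauge_partial expo_partial int_realc alA -/(dt j A).
apply: tfun_ext => y; rewrite !(tfunD, tfunM, tfunZ, tfun1) rmorphN rmorphD rmorphM /=.
move: (dt j A y) (cos _ +i* sin _) (cos _ +i* sin _) => p q r; ring.
Qed.

(** Multiplication by the gauge [G] of frequency [xi] maps to gauged exponentials only the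
    exponentials with that same frequency in [x]. Writing [expo kappa = G * h], [h] lies in that
    [Dx] eigenspace and is therefore a limit of such exponentials alone. *)
Lemma gexpo_dense f : tcl (tspan gexpo) f.
Proof.
apply: (tcl_idem (W := tspan (@expo R (n + 1)))); last exact: expo_dense.
have sW : subspace (tcl (tspan gexpo)) by exact/tcl_subspace/tspan_subspace.
move=> _ [s [b [_ ->]]]; apply: (subspace_sum sW) => kappa _; apply: (subspaceZ sW).
set G := gauge (kappa ix)%:~R.
pose h := tconj G * expo kappa.
have -> : expo kappa = G * h by rewrite /h mulrA tcis_conj mul1r.
pose res (k : freq) := k ix != kappa ix.
apply: (tcl_tame (A := *%R G) (V := nonresonant (@expo R (n + 1)) res)).
- exact: tame_mul.
- by move=> u v; exact: mulrBr.
- move=> _ [t [d [ut tr ->]]]; apply: sub_tcl.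
  have sS : subspace (tspan gexpo) by exact: tspan_subspace.
  rewrite /comb mulr_sumr big_seq; apply: (subspace_sum sS) => k kt.
  rewrite -tscalerAr; apply: (subspaceZ sS).
  have /eqP rk : k ix == kappa ix by have := allP tr _ kt; rewrite negbK.
  by rewrite /G -rk; exact: tspan_gen.
- apply: (tcl_nonresonant expo_eigenfamily) => k kr z.
  apply: (Dx_eigen_orth (xi := (kappa ix)%:~R) (xi' := (k ix)%:~R)).
  + by rewrite /Dx_eigen /h DxM {1}/Dx pd_conj -/(Dx G) Dx_gauge tconj0 mul0r add0r
      /Dx expo_partial int_realc -tscalerAr.
  + by rewrite /Dx_eigen DxZ /Dx expo_partial int_realc !scalerA mulrC.
  + by rewrite eqr_int eq_sym.
Qed.

Lemma gexpo_eigenfamily : eigenfamily gexpo (Yf al) gfreq.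
Proof.
split.
- exact: YfD.
- exact: YfZ.
- move=> i kappa; case: (split_ordP i) => j ->; first by rewrite Yf_l Xf_gexpo.
  by rewrite (ord1 j) -/ix Yf_r Dx_gexpo gfreq_r.
- apply: (@Yf_ind _ _ al (fun Y => forall f g, rip (Y f) g = - rip f (Y g))).
    by move=> j f g; exact: Xf_skew.
  exact: Dx_skew.
- by apply: (@Yf_ind _ _ al tame) => [j|]; [exact: tame_Xf|exact: tame_Dx].
- exact: nrm_le_gnY.
- move=> kappa; rewrite /gexpo tconjM mulrACA tcis_conj expo_conj mulr1//.
- move=> x y xy; have [exy|nxy] := eqVneq (x ix) (y ix); last first.
    by exists ix; rewrite !gfreq_r eqr_int.
  suff [j xj] : exists j, x (lshift 1 j) != y (lshift 1 j).
    by exists (lshift 1 j); rewrite !gfreq_l exy (inj_eq (addIr _)) eqr_int.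
  apply/existsP; move: xy; apply: contraR; rewrite negb_exists => /forallP E.
  apply/eqP/ffunP => i; case: (split_ordP i) => j ->.
    by have := E j; rewrite negbK => /eqP.
  by rewrite (ord1 j).
- exact: gexpo_dense.
Qed.

End flat_gauge.

(** * Commuting fields: small divisors *)

Section geometric_sums.
Context {R : realType}.
Implicit Types (r s : R ^nat) (b : nat -> R[i]).

Lemma sum_geo_cvg r (C : R) : (forall l, `|r l| <= C * 2^-1 ^+ l) -> cvgn (series r).
Proof.
move=> H; apply: normed_cvg; apply: (series_le_cvg (v_ := geometric C 2^-1)).
- by move=> l; exact: normr_ge0.
- by move=> l; exact: le_trans (normr_ge0 (r l)) (H l).
- exact: H.
- by apply: is_cvg_geometric_series; rewrite ger0_norm ?invf_lt1 ?ltr1n.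
Qed.

Lemma sum_geo_bound r (C : R) : (forall l, `|r l| <= C * 2^-1 ^+ l) -> `|limn (series r)| <= 2 * C.
Proof.
move=> H; have z1 : `|2^-1 : R| < 1 by rewrite ger0_norm ?invf_lt1 ?ltr1n.
have cg : cvgn (series (geometric C 2^-1)) by exact: is_cvg_geometric_series.
have cn : cvgn [normed series r].
  apply: (series_le_cvg (v_ := geometric C 2^-1)) cg => [l|l|l].
  - exact: normr_ge0.
  - exact: le_trans (normr_ge0 (r l)) (H l).
  - exact: H.
rewrite (le_trans (lim_series_norm cn))//; apply: (le_trans (lim_series_le cn cg H)).
rewrite (cvg_lim _ (cvg_geometric_series (a := C) z1))//.
by rewrite (_ : 1 - 2^-1 = 2^-1) ?invrK 1?mulrC//; field.
Qed.

Lemma le_sum_geo r (C : R) l0 : (forall l, 0 <= r l) -> (forall l, `|r l| <= C * 2^-1 ^+ l) ->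
  r l0 <= limn (series r).
Proof.
move=> r0 H; apply: (@le_trans _ _ (series r l0.+1)).
  rewrite /series/= big_nat_recr//= lerDr; apply: sumr_ge0 => *; exact: r0.
apply: nondecreasing_cvgn_le; last exact: sum_geo_cvg H.
by apply: nondecreasing_series => *; exact: r0.
Qed.

Definition geo (C : R) b := forall l, `|complex.Re (b l)| <= C * 2^-1 ^+ l /\
  `|complex.Im (b l)| <= C * 2^-1 ^+ l.

Definition csum b : R[i] := limn (series (fun l => complex.Re (b l))) +i*
  limn (series (fun l => complex.Im (b l))).

Lemma geo_cvg C b : geo C b -> cvgn (series (fun l => complex.Re (b l))) /\
  cvgn (series (fun l => complex.Im (b l))).
Proof. by move=> H; split; apply: (sum_geo_cvg (C := C)) => l; have [] := H l. Qed.

Lemma csum_lin C1 C2 (c : R[i]) b1 b2 : geo C1 b1 -> geo C2 b2 ->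
  csum (fun l => c * b1 l + b2 l) = c * csum b1 + csum b2.
Proof.
move=> /geo_cvg[r1 i1] /geo_cvg[r2 i2]; case: c => x y.
have Zc (k : R) (f : R ^nat) : cvgn (series f) -> cvgn (series (k *: f)) by exact: is_cvg_seriesZ.
have -> : (fun l => (x +i* y) * b1 l + b2 l) = (fun l =>
    (x * complex.Re (b1 l) + - y * complex.Im (b1 l) + complex.Re (b2 l)) +i*
    (x * complex.Im (b1 l) + y * complex.Re (b1 l) + complex.Im (b2 l))).
  apply/funext => l; case: (b1 l) (b2 l) => p q [p' q'].
  by apply/eqP; rewrite eq_complex/= mulNr !eqxx.
have L (k1 k2 : R) (f g h : R ^nat) : cvgn (series f) -> cvgn (series g) -> cvgn (series h) ->
    limn (series (fun l => k1 * f l + k2 * g l + h l)) =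
    k1 * limn (series f) + k2 * limn (series g) + limn (series h).
  move=> cf cg ch.
  have -> : (fun l => k1 * f l + k2 * g l + h l) = k1 *: f + k2 *: g + h by [].
  rewrite lim_seriesD//; last by apply: is_cvg_seriesD; exact: Zc.
  rewrite lim_seriesD; [|exact: Zc|exact: Zc].
  by rewrite !lim_seriesZ.
rewrite /csum /= !L//.
by apply/eqP; rewrite eq_complex/= mulNr !eqxx.
Qed.

Lemma csum_bound C b : geo C b -> `|complex.Re (csum b)| <= 2 * C /\ `|complex.Im (csum b)| <= 2 * C.
Proof. by move=> H; split; apply: sum_geo_bound => l; have [] := H l. Qed.

Lemma csum_eq b (x : R[i]) :
  (forall e : R, 0 < e -> \forall m \near \oo, normc (\sum_(l < m) b l - x) <= e) -> csum b = x.
Proof.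
have le_normc (z : R[i]) : `|complex.Re z| <= normc z /\ `|complex.Im z| <= normc z.
  case: z => p q /=; split.
    by rewrite -sqrtr_sqr ler_wsqrtr// lerDl sqr_ge0.
  by rewrite -sqrtr_sqr ler_wsqrtr// lerDr sqr_ge0.
move=> H.
have S (F : {additive R[i] -> R}) : (forall z, `|F z| <= normc z) ->
    limn (series (fun l => F (b l))) = F x.
  move=> FN; apply: cvg_lim => //; apply/cvgrPdist_le => e /H; apply: filterS => m Hm.
  rewrite distrC /series/= big_mkord -raddf_sum -raddfB (le_trans (FN _))//.
rewrite /csum.
have -> := S (@complex.Re R) (fun z => (le_normc z).1).
have -> := S (@complex.Im R) (fun z => (le_normc z).2).
by case: x {H S}.
Qed.

End geometric_sums.

Section coef_decay_bound.
Context {R : realType} {N : nat}.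
Notation T := (torus_fun R N).
Context {K : eqType} (E : K -> T) {d : nat} (Y : 'I_d -> T -> T) (l : 'I_d -> K -> R).
Hypothesis H : eigenfamily E Y l.

(** Moving the skew operators of [1 - sum_i Y_i^2] from [f] onto [E x] multiplies the coefficient by
    the weight, while Cauchy-Schwarz bounds the result by a norm of [f]. *)
Lemma coef_decay : exists m (C : R), 0 <= C /\ forall (f : T) x (z : R[i]),
  weight l x * `|rip f (z *: E x)| <= C * nrm m f * normc z.
Proof.
pose W g := g - \sum_i Y i (Y i g).
have tW : tame W.
  apply: tame_sub; first exact: tame_id.
  by apply: tame_sum => i _; apply: tame_comp; exact: (eig_tame H).
have [m [C [C0 HC]]] := tW 0%N.
exists m, (C * Num.sqrt (@vol R N)); split; first by rewrite mulr_ge0 ?sqrtr_ge0.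
move=> f x z.
have E1 : rip (W f) (z *: E x) = weight l x * rip f (z *: E x).
  rewrite /W ripBl rip_suml /weight mulrDl mul1r; congr (_ + _).
  rewrite -sumrN mulr_suml; apply: eq_bigr => i _.
  rewrite !(eig_skew H) opprK (eigZ H) (eigE H) !(eigZ H) (eigE H) -ripNr -ripZrr; congr rip.
  rewrite !scalerA -scaleNr; congr (_ *: _).
  have -> : z * ('i * (l i x)%:C) * ('i * (l i x)%:C) = ('i * 'i) * ((l i x)%:C * (l i x)%:C) * z by ring.
  by rewrite sqri -rmorphM/= -expr2 mulN1r mulNr opprK.
rewrite -[weight l x]ger0_norm ?(ltW (weight_gt0 l x))// -normrM -E1.
rewrite (le_trans (rip_norm_le _ _))//.
have -> : n2 (z *: E x) = Num.sqrt (@vol R N) * normc z.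
  rewrite -[LHS]ger0_norm ?n2_ge0// -sqrtr_sqr n2_sqr (rip_eig_sqr H) sqrtrM ?sqr_ge0//.
  by rewrite sqrtr_sqr mulrC ger0_norm ?normc_ge0.
rewrite mulrA ler_wpM2r ?normc_ge0// mulrAC ler_wpM2r ?sqrtr_ge0//.
by rewrite -nrm0E; exact: HC.
Qed.

End coef_decay_bound.

Section small_divisors.
Context {R : realType} {n : nat}.
Notation freq := {ffun 'I_(n + 1) -> int}.
Variable c : 'I_n -> R.

Definition omega (j : 'I_n) (kappa : freq) : R := gfreq c (lshift 1 j) kappa.
Definition sigma (kappa : freq) : R := \sum_j omega j kappa ^+ 2.
Notation w := (weight (gfreq c)).

(** As [k_j = omega_j - xi c_j], the weight is comparable to [1 + |kappa|^2]. This is thus the usual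
    condition that the vector [k + xi c] vanishes or is at least a negative power of the
    frequency. *)
Definition dioph : Prop := exists (M : nat) (C : R), 0 <= C /\
  forall kappa, sigma kappa = 0 \/ 1 <= C * w kappa ^+ M * sigma kappa.

Lemma sigma_ge0 kappa : 0 <= sigma kappa.
Proof. by apply: sumr_ge0 => j _; exact: sqr_ge0. Qed.

Lemma sigma_eq0 kappa : sigma kappa = 0 -> forall j, omega j kappa = 0.
Proof.
move=> /eqP; rewrite psumr_eq0 => [/allP H j|j _]; last exact: sqr_ge0.
by have := H j (mem_index_enum j); rewrite sqrf_eq0 => /eqP.
Qed.

Lemma weightE kappa : w kappa = 1 + (sigma kappa + (kappa ix)%:~R ^+ 2).
Proof. by rewrite /weight sum_tube gfreq_r. Qed.

(* Only finitely many frequencies have bounded weight. *)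
Lemma sigma_lower_bound (W : R) : exists2 m : R, 0 < m &
  forall kappa, w kappa <= W -> sigma kappa != 0 -> m <= sigma kappa.
Proof.
pose S := \sum_j `|c j|; have S0 : 0 <= S by apply: sumr_ge0.
pose B := Num.bound ((`|W| + 1) * (1 + S)).
pose g (h : {ffun 'I_(n + 1) -> 'I_(B + B).+1}) : freq := [ffun i => (h i)%:Z - B%:Z].
have fin kappa : w kappa <= W -> exists h, kappa = g h.
  move=> wW.
  have W1 : 1 <= `|W| + 1 by rewrite lerDr.
  have sq (x : R) : x ^+ 2 <= `|W| + 1 -> `|x| <= `|W| + 1.
    move=> h; rewrite -(@ler_pXn2r _ 2)// ?nnegrE ?addr_ge0// real_normK ?num_real//.
    rewrite (le_trans h)// expr2 ler_peMr// (le_trans _ W1)//.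
  have wW' : sigma kappa + (kappa ix)%:~R ^+ 2 <= `|W| + 1.
    by move: wW; rewrite weightE; have := ler_norm W; lra.
  have xB : `|(kappa ix)%:~R : R| <= `|W| + 1.
    by apply: sq; have := sigma_ge0 kappa; lra.
  have kB j : `|(kappa (lshift 1 j))%:~R : R| <= (`|W| + 1) * (1 + S).
    have oB : `|omega j kappa| <= `|W| + 1.
      apply: sq; rewrite (le_trans _ wW')//.
      rewrite /sigma (bigD1 j)//= -addrA lerDl addr_ge0 ?sqr_ge0// sumr_ge0// => i _; exact: sqr_ge0.
    have -> : (kappa (lshift 1 j))%:~R = omega j kappa - (kappa ix)%:~R * c j.
      by rewrite /omega gfreq_l addrK.
    rewrite (le_trans (ler_normB _ _))// mulrDr mulr1 lerD// normrM ler_pM//.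
    by rewrite /S (bigD1 j)//= lerDl sumr_ge0.
  have kB' i : `|(kappa i)%:~R : R| <= (`|W| + 1) * (1 + S).
    case: (split_ordP i) => j ->; first exact: kB.
    rewrite (ord1 j) -/ix (le_trans xB)// -[leLHS]mulr1.
    by apply: ler_wpM2l; rewrite ?addr_ge0 ?lerDl.
  have kI i : (`|kappa i| <= B)%N.
    rewrite -(ler_nat R) natr_absz intr_norm (le_trans (kB' i))// ltW//.
    by apply: archi_boundP; rewrite mulr_ge0// addr_ge0.
  have k2 i : (`|(kappa i + B%:Z)%R| < (B + B).+1)%N by have := kI i; lia.
  exists [ffun i => Ordinal (k2 i)]; apply/ffunP => i; rewrite !ffunE.
  have := kI i => h; rewrite gez0_abs ?addrK//; lia.
have [m m0 Hm] : exists2 m : R, 0 < m & forall h, sigma (g h) != 0 -> m <= sigma (g h).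
  suff [m m0 Hm] : exists2 m : R, 0 < m & forall h, h \in enum {ffun 'I_(n + 1) -> 'I_(B + B).+1} ->
      sigma (g h) != 0 -> m <= sigma (g h).
    by exists m => // h; apply: Hm; rewrite mem_enum.
  elim: (enum _) => [|h s [m m0 IH]]; first by exists 1.
  have [sh|sh] := eqVneq (sigma (g h)) 0.
    exists m => // h'; rewrite inE => /predU1P[->|]; first by rewrite sh eqxx.
    exact: IH.
  have sp : 0 < sigma (g h) by rewrite lt_neqAle eq_sym sh sigma_ge0.
  exists (Num.min m (sigma (g h))); first by rewrite lt_min m0.
  move=> h'; rewrite inE => /predU1P[->|hs sn]; first by rewrite ge_min lexx orbT.
  by rewrite ge_min IH.
by exists m => // kappa /fin[h ->]; exact: Hm.
Qed.

(** The negated condition produces small divisors but not large weights; the latter are forced by a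
    constant adapted to the least nonzero divisor among bounded weights. *)
Lemma not_dioph : ~ dioph -> exists kappa : nat -> freq, forall l,
  [/\ 2 ^+ l <= w (kappa l), w (kappa l) ^+ l * sigma (kappa l) <= 1 & sigma (kappa l) != 0].
Proof.
move=> nd; suff /choice[kappa Hk] : forall l, exists k,
    [/\ 2 ^+ l <= w k, w k ^+ l * sigma k <= 1 & sigma k != 0] by exists kappa.
move=> l.
have [m m0 Hm] := sigma_lower_bound (2 ^+ l).
apply: contrapT => /forallNP H; apply: nd.
have C0 : 0 <= 1 + m^-1 by rewrite addr_ge0// ltW// invr_gt0.
(* A frequency violating the condition with this constant has [w^l * sigma < 1] by the summand 1,
   and [sigma < m] by the summand [m^-1], so its weight must exceed [2^l]. *)
exists l, (1 + m^-1); split => // k.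
have [->|s0] := eqVneq (sigma k) 0; [by left|right].
have w1 := weight_ge1 (gfreq c) k.
have wl : 1 <= w k ^+ l by rewrite exprn_ege1.
rewrite leNgt; apply/negP => lt1.
have sp : 0 < sigma k by rewrite lt_neqAle eq_sym s0 sigma_ge0.
have h1 : w k ^+ l * sigma k <= (1 + m^-1) * w k ^+ l * sigma k.
  by rewrite -mulrA ler_peMl// ?mulr_ge0 ?(ltW sp) ?(le_trans ler01)// lerDl ltW// invr_gt0.
have h2 : m^-1 * sigma k <= (1 + m^-1) * w k ^+ l * sigma k.
  rewrite ler_wpM2r ?(ltW sp)// -[leLHS]mulr1; apply: ler_pM => //.
    by rewrite ltW// invr_gt0.
  by rewrite lerDr.
apply: (H k); split => //.
  rewrite leNgt; apply/negP => lt2; have := Hm k (ltW lt2) s0.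
  rewrite leNgt => /negP; apply.
  by have := le_lt_trans h2 lt1; rewrite ltr_pdivrMl// mulr1.
by rewrite (le_trans h1)// ltW.
Qed.

End small_divisors.

Section geometric_series.
Context {R : realType} {N : nat}.
Notation T := (torus_fun R N).
Implicit Types (f g : T).

Lemma nrm_conj k f : nrm k (tconj f) = nrm k f.
Proof.
elim: k f => [|k IH] f; first by rewrite !nrm0E n2_conj.
by rewrite !nrmS IH; congr (_ + _); apply: eq_bigr => i _; rewrite pd_conj IH.
Qed.

Lemma normc_le (z : R[i]) : normc z <= `|complex.Re z| + `|complex.Im z|.
Proof.
case: z => x y /=; rewrite -[leRHS]ger0_norm ?addr_ge0// -sqrtr_sqr ler_wsqrtr//.
have := real_normK (num_real x); have := real_normK (num_real y).
have := mulr_ge0 (normr_ge0 x) (normr_ge0 y); nra.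
Qed.

Lemma Re_cint_conj f g : complex.Re (cint (f * tconj g)) = rip f g.
Proof. by rewrite ripE. Qed.

Lemma normc_cint_le f g : normc (cint (f * g)) <= 2 * (n2 f * n2 g).
Proof.
have h f' : `|complex.Re (cint (f' * g))| <= n2 f' * n2 g.
  by rewrite -[g]tconjK Re_cint_conj n2_conj rip_norm_le.
rewrite (le_trans (normc_le _))// mulr_natl mulr2n lerD//.
have -> : complex.Im (cint (f * g)) = complex.Re (cint ((- 'i *: f) * g)).
  by rewrite -tscalerAl cintZ; case: (cint _) => x y /=; ring.
rewrite (le_trans (h _))// n2Z /= oppr0 expr0n/= add0r sqrrN expr1n sqrtr1 mul1r//.
Qed.

Lemma tcvg_geo (t : nat -> T) :
  (forall k, exists L (D : R), 0 <= D /\ forall l, (L <= l)%N -> nrm k (t l) <= D * 2^-1 ^+ l) ->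
  exists v, tcvg (fun m => \sum_(l < m) t l) v.
Proof.
move=> H; apply: torus_complete => k e e0; have [L [D [D0 HD]]] := H k.
have tail p q : (L <= q)%N -> nrm k (\sum_(l < q + p) t l - \sum_(l < q) t l) <= 2 * D * 2^-1 ^+ q - 2 * D * 2^-1 ^+ (q + p).
  move=> Lq; elim: p => [|p IH]; first by rewrite addn0 !subrr nrm0.
  rewrite addnS big_ord_recr/= addrAC (le_trans (nrmD _ _ _))//.
  have := HD (q + p)%N (leq_trans Lq (leq_addr _ _)); rewrite exprS; move: IH.
  move: (nrm k _) (nrm k _) (2^-1 ^+ q) (2^-1 ^+ (q + p)) => a b x y; lra.
have [M HM] : exists M : nat, 2 * D * 2^-1 ^+ M <= e.
  by have [M HM] := half_pow_small (mulr_ge0 (ler0n R 2) D0) e0; exists M; exact: ltW.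
have key p q : (maxn L M <= q)%N -> (q <= p)%N -> nrm k (\sum_(l < p) t l - \sum_(l < q) t l) <= e.
  rewrite geq_max => /andP[Lq Mq] qp; rewrite -(subnKC qp) (le_trans (tail _ _ Lq))//.
  have h : 2^-1 ^+ q <= 2^-1 ^+ M :> R by rewrite ler_wiXn2l// invf_le1// ler1n.
  have h2 : 0 <= 2 * D * 2^-1 ^+ (q + (p - q)) by rewrite !mulr_ge0// exprn_ge0.
  rewrite (le_trans _ HM)// lerBlDr (le_trans (ler_wpM2l _ h)) ?mulr_ge0// lerDl//.
exists (maxn L M) => p q Mp Mq; case: (leqP q p) => qp; first exact: key.
by rewrite nrm_distC; apply: key => //; exact: ltnW.
Qed.

End geometric_series.

Section flat_systems.
Context {R : realType} {n : nat}.
Notation T := (torus_fun R (n + 1)).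
Notation freq := {ffun 'I_(n + 1) -> int}.
Implicit Types (f g u v phi : T).
Variable al : 'I_n -> T.
Hypothesis alD : forall j, Dx (al j) = 0.
Hypothesis alR : forall j, tconj (al j) = al j.
Variables (A : T) (c : 'I_n -> R).
Hypothesis AD : Dx A = 0.
Hypothesis AR : tconj A = A.
Hypothesis alA : forall j, al j = dt j A + (c j)%:C *: (1 : T).
Notation E := (gexpo A).
Notation w := (weight (gfreq c)).
Notation X := (Xf al).
Notation P := (Pf al).

Let H : eigenfamily E (Yf al) (gfreq c) := gexpo_eigenfamily alD alR AD AR alA.

Lemma X_gexpo j kappa : X j (E kappa) = ('i * (omega c j kappa)%:C) *: E kappa.
Proof. exact: Xf_gexpo. Qed.

Lemma Pf_gexpo kappa : P (E kappa) = (- sigma c kappa)%:C *: E kappa.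
Proof.
rewrite /Pf /sigma -sumrN rmorph_sum scaler_suml; apply: eq_bigr => j _.
rewrite X_gexpo XfZ X_gexpo scalerA; congr (_ *: _).
rewrite mulrACA sqri mulN1r -rmorphM/= -rmorphN; congr (_ %:C); rewrite expr2 //.
Qed.

Lemma Pf_conj f : P (tconj f) = tconj (P f).
Proof. by rewrite /Pf tconj_sum; apply: eq_bigr => j _; rewrite !(Xf_conj alR). Qed.

Lemma dioph_Xf_closed : dioph c -> forall F : 'I_n -> T,
  (forall k (e : R), 0 < e -> exists u, forall j, nrm k (X j u - F j) <= e) -> exists u, forall j, X j u = F j.
Proof.
move=> [M [C [C0 DC]]].
apply: (diagonal_closed_range H (tame_Xf al) (XfD al) (XfZ al) X_gexpo C0 (M := M)) => kappa.
have [s0|h] := DC kappa.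
  by left => j; rewrite (sigma_eq0 s0) mulr0.
right; rewrite (eq_bigr (fun j => omega c j kappa ^+ 2))// => j _.
by rewrite ComplexField.Normc.normcM normc_i mul1r normc_real real_normK ?num_real.
Qed.

(** The symbol of [P] is [- sigma], so the quantity to bound below is [sigma^2]; squaring the
    Diophantine inequality produces [C ^+ 2] and the exponent [M * 2]. *)
Lemma dioph_Pf_closed : dioph c -> forall f,
  (forall k (e : R), 0 < e -> exists u, nrm k (P u - f) <= e) -> exists u, P u = f.
Proof.
move=> [M [C [C0 DC]]] f Hf.
suff [u Hu] : exists u, forall j : 'I_1, P u = f by exists u; exact: (Hu ord0).
have C20 : 0 <= C ^+ 2 by exact: sqr_ge0.
have DC' kappa : (forall j : 'I_1, (- sigma c kappa)%:C = 0 :> R[i]) \/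
    1 <= C ^+ 2 * w kappa ^+ (M * 2) * \sum_(j < 1) normc (- sigma c kappa)%:C ^+ 2.
  have [s0|h] := DC kappa; first by left => _; rewrite s0 oppr0.
  right; rewrite big_ord1 normc_real normrN real_normK ?num_real// exprM -!exprMn.
  exact: exprn_ege1.
apply: (@diagonal_closed_range _ _ _ _ _ _ _ H 1 (fun=> P) (fun _ kappa => (- sigma c kappa)%:C)
  (fun=> @tame_Pf _ _ al) (fun=> PfD al) (fun=> PfZ al) (fun=> Pf_gexpo) _ _ C20 DC' (fun=> f)).
by move=> k e /(Hf k)[u Hu]; exists u.
Qed.

(** [P] kills the conjugates of resonant eigenfunctions, so the smooth image [g] has no resonant
    part. It is a limit of nonresonant sums, which lie in the range, and closedness gives
    [P v = g]. *)
Lemma Pf_closed_agh : (forall f,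
  (forall k (e : R), 0 < e -> exists u, nrm k (P u - f) <= e) -> exists u, P u = f) ->
  agh (fun _ : unit => P).
Proof.
move=> cl u du /(_ tt)[g Hg]; have su := du.1.
have gr kappa : sigma c kappa == 0 -> forall z : R[i], rip g (z *: E kappa) = 0.
  move=> /eqP s0 z; rewrite -Re_cint_conj -dist_ofE -Hg Pf_conj PfZ Pf_gexpo s0.
  by rewrite oppr0 scale0r scaler0 tconj0 (functional0 su).
have [v Pv] : exists v, P v = g.
  apply: cl => k e e0; have [h [[s [b [us sr ->]]] Hh]] := tcl_nonresonant H gr k e0.
  suff [u' Hu] : exists u, P u = comb E s b by exists u'; rewrite Hu nrm_distC.
  have sW : subspace (fun g => exists u, P u = g).
    split; first by exists 0; apply: big1 => j _; rewrite !Xf0.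
    by move=> a _ _ [x <-] [y <-]; exists (a *: x + y); rewrite PfD PfZ.
  rewrite /comb big_seq; apply: (subspace_sum sW) => kappa ks; apply: (subspaceZ sW).
  have s0 : sigma c kappa != 0 by exact: (allP sr _ ks).
  exists ((- sigma c kappa)%:C^-1 *: E kappa); rewrite PfZ Pf_gexpo scalerA mulVf ?scale1r//.
  by rewrite eq_complex/= negb_and oppr_eq0 s0.
by exists v => _ phi; rewrite Hg -Pv (dist_of_Pf alD).
Qed.

(** The [v] obtained for [P] satisfies [X_j v = - g_j]. This equality of smooth functions is checked
    on coefficients: conjugates of nonresonant eigenfunctions lie in the range of [P], where [u] and
    [v] agree, and those of resonant ones are killed by [X_j]. *)
Lemma Pf_agh_Xf_agh : agh (fun _ : unit => P) -> agh X.
Proof.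
move=> aP u du Hu; have su := du.1; have /choice[g Hg] := Hu.
have uP phi : u (P phi) = dist_of (- \sum_j X j (g j)) phi.
  rewrite (functional_sum _ _ _ su) dist_ofE mulNr cintN mulr_suml cint_sum -sumrN.
  by apply: eq_bigr => j _; rewrite Hg -dist_ofE (dist_of_Xf alD) opprK.
have [|v Hv] := aP u du; first by move=> _; exists (- \sum_j X j (g j)).
exists v => j phi; rewrite Hg; apply/eqP; rewrite -subr_eq0.
suff -> : g j = - X j v by rewrite dist_ofE mulNr cintN -dist_ofE (dist_of_Xf alD) opprK subrr.
apply/eqP; rewrite -addr_eq0; apply/eqP/(coef_eq0 H) => kappa z.
rewrite -Re_cint_conj mulrDl cintD -!dist_ofE -Hg (dist_of_Xf alD).
set psi := tconj (z *: E kappa).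
suff -> : u (X j psi) = dist_of v (X j psi) by rewrite subrr.
have XE : X j psi = conjc (z * ('i * (omega c j kappa)%:C)) *: tconj (E kappa).
  by rewrite /psi (Xf_conj alR) XfZ X_gexpo scalerA tconjZ.
have [s0|s0] := eqVneq (sigma c kappa) 0.
  rewrite XE (sigma_eq0 s0) !mulr0 rmorph0 scale0r (functional0 su).
  by rewrite (functional0 (dist_of_scalar v)).
have PE : tconj (E kappa) = P ((- sigma c kappa)%:C^-1 *: tconj (E kappa)).
  rewrite PfZ Pf_conj Pf_gexpo tconjZ scalerA.
  rewrite (_ : conjc _ = (- sigma c kappa)%:C); last by apply/eqP; rewrite eq_complex/= oppr0 !eqxx.
  by rewrite mulVf ?scale1r// eq_complex/= negb_and oppr_eq0 s0.
by rewrite XE (functionalZ _ _ su) (functionalZ _ _ (dist_of_scalar v)) PE (Hv tt).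
Qed.

End flat_systems.

(** * Lacunary sums when the Diophantine condition fails *)

Section liouville.
Context {R : realType} {n : nat}.
Notation T := (torus_fun R (n + 1)).
Notation freq := {ffun 'I_(n + 1) -> int}.
Implicit Types (f g u v phi : T).
Variable al : 'I_n -> T.
Hypothesis alD : forall j, Dx (al j) = 0.
Hypothesis alR : forall j, tconj (al j) = al j.
Variables (A : T) (c : 'I_n -> R).
Hypothesis AD : Dx A = 0.
Hypothesis AR : tconj A = A.
Hypothesis alA : forall j, al j = dt j A + (c j)%:C *: (1 : T).
Notation E := (gexpo A).
Notation w := (weight (gfreq c)).
Notation X := (Xf al).

Let H : eigenfamily E (Yf al) (gfreq c) := gexpo_eigenfamily alD alR AD AR alA.

Variable kappa : nat -> freq.
Hypothesis kappaP : forall l,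
  [/\ 2 ^+ l <= w (kappa l), w (kappa l) ^+ l * sigma c (kappa l) <= 1 & sigma c (kappa l) != 0].

Let b l phi := cint (E (kappa l) * phi).

Lemma half_pow_weight l : (w (kappa l))^-1 <= 2^-1 ^+ l.
Proof.
have [h _ _] := kappaP l.
by rewrite exprVn lef_pV2 ?posrE ?exprn_gt0 ?(weight_gt0 (gfreq c)).
Qed.

(** Coefficients of a smooth function decay like the inverse weight, and the weight of [kappa l] is
    at least [2^l]; the pairing series thus converges geometrically with a constant continuous in
    [phi]. *)
Lemma resonance_geo : exists m (C : R), 0 <= C /\ forall phi, geo (C * nrm m phi) (b^~ phi).
Proof.
have [m [C [C0 HC]]] := coef_decay H; exists m, C; split => // phi l.
have h (z : R[i]) : normc z = 1 -> `|complex.Re (z * b l phi)| <= C * nrm m phi * 2^-1 ^+ l.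
  move=> z1; have E1 : complex.Re (z * b l phi) = rip (tconj phi) (z *: E (kappa l)).
    rewrite -Re_cint_conj -tconjM /b -cintZ /cint /= RI_conj; congr RI.
    by rewrite tscalerAl [LHS]mulrC.
  have := HC (tconj phi) (kappa l) z; rewrite nrm_conj z1 mulr1 -E1.
  have w0 := weight_gt0 (gfreq c) (kappa l).
  rewrite mulrC -ler_pdivlMr// => /le_trans; apply.
  by apply: ler_wpM2l; [rewrite mulr_ge0// nrm_ge0|exact: half_pow_weight].
split; first by rewrite -[b l phi]mul1r; apply: h; rewrite /= expr1n expr0n/= addr0 sqrtr1.
have -> : complex.Im (b l phi) = complex.Re (- 'i * b l phi).
  by case: (b l phi) => x y /=; ring.
by apply: h; rewrite /= oppr0 expr0n/= add0r sqrrN expr1n sqrtr1.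
Qed.

(* The kappa l need not be distinct: repetitions only increase the coefficients. *)
Definition resonance phi : R[i] := csum (b^~ phi).

Lemma resonance_scalar : scalar resonance.
Proof.
have [m [C [C0 HC]]] := resonance_geo.
move=> a f g; rewrite /resonance -(csum_lin a (HC f) (HC g)); congr csum.
by apply/funext => l; rewrite /b mulrDr -tscalerAr cintD cintZ.
Qed.

Lemma resonance_distribution : Defs.distribution resonance.
Proof.
have [m [C [C0 HC]]] := resonance_geo.
apply: (@bounded_distribution _ _ _ m (4 * C)); first exact: resonance_scalar.
move=> phi; have [h1 h2] := csum_bound (HC phi).
by rewrite (le_trans (normc_le _))// (le_trans (lerD h1 h2))//; lra.
Qed.

Let U m : T := \sum_(l < m) E (kappa l).

(** The coefficients of the image satisfy [omega_j^2 <= sigma <= w^-l], faster than any power of the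
    weight, so the series converges in every norm although the sum of the [E (kappa l)] does not. *)
Lemma X_resonance_cvg j : exists g, tcvg (fun m => X j (U m)) g.
Proof.
have XU m : X j (U m) = \sum_(l < m) ('i * (omega c j (kappa l))%:C) *: E (kappa l).
  rewrite /U (big_morph (X j) (XfD al j) (Xf0 al j)); apply: eq_bigr => l _.
  exact: X_gexpo.
have -> : (fun m => X j (U m)) =
    fun m => \sum_(l < m) ('i * (omega c j (kappa l))%:C) *: E (kappa l).
  by apply/funext => m; exact: XU.
apply: (@tcvg_geo _ _ (fun l => ('i * (omega c j (kappa l))%:C) *: E (kappa l))) => k; have [D D0 HD] := eig_nrm H k.
(* Under the square root, [k] powers of the weight are spent on the norm of order [k] and two more
   leave a factor [w^-1 <= 2^-l]. *)
exists k.+2, (D * ((n + 1).+1%:R ^+ k * Num.sqrt (@vol R (n + 1)))).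
split; first by rewrite !mulr_ge0 ?exprn_ge0 ?sqrtr_ge0.
move=> l kl; rewrite (le_trans (HD _))// -mulrA ler_wpM2l//.
have := gn_comb_le H k (s := [:: kappa l]) (fun=> 'i * (omega c j (kappa l))%:C) isT.
rewrite /comb big_seq1 => /le_trans; apply; rewrite -mulrA ler_wpM2l ?exprn_ge0//.
have [h1 h2 h3] := kappaP l; have w0 := weight_gt0 (gfreq c) (kappa l).
have w1 := weight_ge1 (gfreq c) (kappa l).
rewrite /wsum big_seq1 sqrtrM; last first.
  by apply: mulr_ge0; [exact: exprn_ge0 (ltW w0)|exact: sqr_ge0].
rewrite mulrC ler_wpM2l ?sqrtr_ge0// (le_trans _ (half_pow_weight l))//.
have wi : (w (kappa l))^-1 = Num.sqrt ((w (kappa l))^-1 ^+ 2).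
  by rewrite sqrtr_sqr ger0_norm// invr_ge0 ltW.
rewrite wi ler_wsqrtr// exprVn -div1r.
rewrite ler_pdivlMr ?exprn_gt0// (le_trans _ h2)//.
rewrite ComplexField.Normc.normcM normc_i mul1r normc_real real_normK ?num_real//.
have os : omega c j (kappa l) ^+ 2 <= sigma c (kappa l).
  by rewrite /sigma (bigD1 j)//= lerDl sumr_ge0// => i _; exact: sqr_ge0.
rewrite mulrAC -exprD; apply: ler_pM.
- by rewrite exprn_ge0// ltW.
- exact: sqr_ge0.
- by apply: ler_weXn2l => //; rewrite addn2.
- exact: os.
Qed.

Lemma resonance_X j g phi : tcvg (fun m => X j (U m)) g -> resonance (X j phi) = dist_of (- g) phi.
Proof.
move=> Ug; apply: csum_eq => e e0.
have N1 : 0 < 2 * n2 phi + 1 by rewrite ltr_wpDl// mulr_ge0// n2_ge0.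
have := Ug 0%N _ (divr_gt0 e0 N1); apply: filterS => m Hm.
have -> : \sum_(l < m) b l (X j phi) - dist_of (- g) phi = cint ((g - X j (U m)) * phi).
  rewrite dist_ofE mulrBl cintB mulNr cintN opprK addrC; congr (_ + _).
  rewrite /U (big_morph (X j) (XfD al j) (Xf0 al j)) mulr_suml cint_sum -sumrN.
  by apply: eq_bigr => l _; rewrite -dist_ofE (dist_of_Xf alD) opprK dist_ofE.
rewrite (le_trans (normc_cint_le _ _))// n2_distC mulrCA.
rewrite nrm0E ler_pdivlMr// in Hm; rewrite (le_trans _ Hm)// ler_wpM2l ?n2_ge0// lerDl//.
Qed.

(** Some [omega_j] is nonzero at [kappa l], so agreement on the images of the [X_j] forces equality
    of the coefficients there. That of the lacunary sum is at least the volume, all its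
    contributions being nonnegative, while that of the smooth [v] decays like [2^-l]. *)
Lemma resonance_not_smooth v : ~ (forall j phi, resonance (X j phi) = dist_of v (X j phi)).
Proof.
move=> Hv; have su := resonance_scalar.
have [m [C [C0 HC]]] := coef_decay H.
have uE l : resonance (tconj (E (kappa l))) = dist_of v (tconj (E (kappa l))).
  have [_ _ s0] := kappaP l.
  have [j oj] : exists j, omega c j (kappa l) != 0.
    apply/not_existsP => o0; move/negP: s0; apply; rewrite /sigma big1// => j _.
    by have /negP := o0 j; rewrite negbK => /eqP ->; rewrite expr0n.
  have := Hv j (tconj (E (kappa l))); rewrite (Xf_conj alR) (X_gexpo AD AR alA) tconjZ.
  rewrite (functionalZ _ _ su) (functionalZ _ _ (dist_of_scalar v)); apply: mulfI.
  by rewrite conjc_eq0 mulf_neq0// eq_complex/= negb_and ?oner_eq0 ?orbT ?oj.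
have rE x y : rip (E x) (E y) = (x == y)%:R * @vol R (n + 1).
  rewrite -[E x]scale1r -[E y]scale1r; have [->|xy] := eqVneq x y.
    by rewrite (rip_eigE H) rmorph1 mulr1.
  by rewrite (eig_orth H)// mul0r.
have low l : @vol R (n + 1) <= complex.Re (resonance (tconj (E (kappa l)))).
  have [m' [C' [C'0 HC']]] := resonance_geo.
  have hh := @le_sum_geo R (fun l' => complex.Re (b l' (tconj (E (kappa l))))) _ l _
    (fun l' => (HC' (tconj (E (kappa l))) l').1).
  rewrite /resonance /=; apply: le_trans (hh _); rewrite /b.
    by rewrite Re_cint_conj rE eqxx mul1r.
  by move=> l'; rewrite Re_cint_conj rE mulr_ge0// ltW// vol_gt0.
have up l : complex.Re (dist_of v (tconj (E (kappa l)))) <= C * nrm m v * 2^-1 ^+ l.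
  rewrite dist_ofE Re_cint_conj (le_trans (ler_norm _))//.
  have := HC v (kappa l) 1; rewrite scale1r.
  have -> : normc (1 : R[i]) = 1 by rewrite /= expr1n expr0n/= addr0 sqrtr1.
  rewrite mulr1 mulrC -ler_pdivlMr ?(weight_gt0 (gfreq c))// => /le_trans; apply.
  by apply: ler_wpM2l; [rewrite mulr_ge0// nrm_ge0|exact: half_pow_weight].
have [|l Hl] := @half_pow_small R (C * nrm m v) _ _ (@vol_gt0 R (n + 1)).
  by rewrite mulr_ge0// nrm_ge0.
by have := le_lt_trans (le_trans (low l) (eq_ind_r (fun z => complex.Re z <= _) (up l) (uE l))) Hl; rewrite ltxx.
Qed.

Lemma liouville_not_agh : ~ agh X.
Proof.
move=> aX; have /choice[g Hg] := X_resonance_cvg.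
have [|v Hv] := aX _ resonance_distribution.
  by move=> j; exists (- g j) => phi; exact: resonance_X.
exact: (@resonance_not_smooth v).
Qed.

Lemma liouville_not_closed : ~ (forall F : 'I_n -> T,
  (forall k (e : R), 0 < e -> exists u, forall j, nrm k (X j u - F j) <= e) -> exists u, forall j, X j u = F j).
Proof.
move=> cl; have /choice[g Hg] := X_resonance_cvg.
have [|v Hv] := cl g.
  move=> k e e0.
  have [M _ HM] : \forall m \near \oo, forall j, nrm k (X j (U m) - g j) <= e.
    by apply: filter_forall => j; exact: Hg.
  by exists (U M) => j; apply: HM => /=.
apply: (@resonance_not_smooth v) => j phi.
by rewrite (resonance_X _ (Hg j)) dist_ofE mulNr cintN -dist_ofE -Hv (dist_of_Xf alD) opprK.
Qed.

End liouville.

Section flat_equivalence.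
Context {R : realType} {n : nat}.
Notation T := (torus_fun R (n + 1)).
Variable al : 'I_n -> T.
Hypothesis alD : forall j, Dx (al j) = 0.
Hypothesis alR : forall j, tconj (al j) = al j.
Variables (A : T) (c : 'I_n -> R).
Hypothesis AD : Dx A = 0.
Hypothesis AR : tconj A = A.
Hypothesis alA : forall j, al j = dt j A + (c j)%:C *: (1 : T).

(** One cycle links the Diophantine condition, closed range of [P], hypoellipticity of [P] and
    hypoellipticity of the system; closed range of the system is tied to the Diophantine condition
    separately. *)
Theorem flat_equivalence :
  [/\ dioph c <-> (forall f, (forall k (e : R), 0 < e -> exists u, nrm k (Pf al u - f) <= e) ->
                     exists u, Pf al u = f),
      dioph c <-> agh (fun _ : unit => Pf al),
      dioph c <-> (forall F : 'I_n -> T,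
                     (forall k (e : R), 0 < e -> exists u, forall j, nrm k (Xf al j u - F j) <= e) ->
                     exists u, forall j, Xf al j u = F j) &
      dioph c <-> agh (Xf al)].
Proof.
have d1 : dioph c -> forall f, (forall k (e : R), 0 < e -> exists u, nrm k (Pf al u - f) <= e) ->
    exists u, Pf al u = f by exact: (dioph_Pf_closed alD alR AD AR alA).
have d12 := Pf_closed_agh alD alR AD AR alA.
have d24 := Pf_agh_Xf_agh alD alR AD AR alA.
have d4 : agh (Xf al) -> dioph c.
  move=> aX; apply: contrapT => /not_dioph[kappa Hk].
  exact: (liouville_not_agh alD alR AD AR alA Hk).
have d2 : dioph c -> agh (fun _ : unit => Pf al) by move=> dc; apply: d12; exact: d1.
split; split.
- exact: d1.
- by move=> cP; apply/d4/d24/d12.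
- exact: d2.
- by move=> aP; apply/d4/d24.
- exact: (dioph_Xf_closed alD alR AD AR alA).
- move=> cl; apply: contrapT => /not_dioph[kappa Hk].
  exact: (liouville_not_closed alD alR AD AR alA Hk).
- by move=> dc; apply/d24/d2.
- exact: d4.
Qed.

End flat_equivalence.

(** * Constant coefficients and the mean system *)

Section constant_systems.
Context {R : realType} {N : nat}.
Notation T := (torus_fun R N).
Implicit Types (v : 'rV[R]_N) (f u : T).

Lemma vf_act_constant v f : vf_act (constant_field v) f = \sum_k (v 0 k)%:C *: pd k f.
Proof.
rewrite vf_actE; apply: eq_bigr => k _; rewrite /constant_field.
by rewrite -tscalerAl mul1r.
Qed.

Lemma vf_act_constant_sum I (r : seq I) (x : I -> R) (V : I -> 'rV[R]_N) f :
  vf_act (constant_field (\sum_(i <- r) x i *: V i)) f =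
  \sum_(i <- r) (x i)%:C *: vf_act (constant_field (V i)) f.
Proof.
rewrite vf_act_constant; under [RHS]eq_bigr do rewrite vf_act_constant scaler_sumr.
rewrite exchange_big/=; apply: eq_bigr => k _; rewrite summxE rmorph_sum scaler_suml.
by apply: eq_bigr => i _; rewrite mxE scalerA -rmorphM.
Qed.

Lemma constant_field_div_free v k : pd k (constant_field v k) = 0.
Proof. by rewrite /constant_field pdZ pd1 scaler0. Qed.

(* The relations Q' = M Q = M M' Q' pass to limits, so solving for the Q' amounts to solving for the Q. *)
Lemma closed_range_span d d' (Q : 'I_d -> T -> T) (Q' : 'I_d' -> T -> T)
    (M : 'I_d' -> 'I_d -> R) (M' : 'I_d -> 'I_d' -> R) :
  (forall i u, Q' i u = \sum_j (M i j)%:C *: Q j u) ->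
  (forall j u, Q j u = \sum_i (M' j i)%:C *: Q' i u) ->
  (forall F : 'I_d -> T, (forall k (e : R), 0 < e -> exists u, forall j, nrm k (Q j u - F j) <= e) ->
    exists u, forall j, Q j u = F j) ->
  forall F : 'I_d' -> T, (forall k (e : R), 0 < e -> exists u, forall j, nrm k (Q' j u - F j) <= e) ->
    exists u, forall j, Q' j u = F j.
Proof.
move=> HM HM' cl F HF.
pose G j := \sum_i (M' j i)%:C *: F i.
have est p q (K : 'I_p -> 'I_q -> R) k (e : R) : 0 < e -> exists2 e' : R, 0 < e' & forall (f g : 'I_q -> T),
    (forall i, nrm k (f i - g i) <= e') ->
    forall j, nrm k (\sum_i (K j i)%:C *: f i - \sum_i (K j i)%:C *: g i) <= e.
  move=> e0; pose S := 1 + \sum_j \sum_i `|K j i|.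
  have S0 : 0 < S by rewrite ltr_pwDl// sumr_ge0// => j _; exact: sumr_ge0.
  exists (e / S); first exact: divr_gt0.
  move=> f g fg j; rewrite -sumrB (le_trans (nrm_sum _ _ _ _))//.
  apply: (@le_trans _ _ (\sum_i `|K j i| * (e / S))).
    apply: ler_sum => i _; rewrite -scalerBr nrmZ normc_real.
    by apply: ler_wpM2l => //; exact: fg.
  rewrite -mulr_suml mulrCA ler_piMr ?(ltW e0)// ler_pdivrMr// mul1r /S (bigD1 j)//= addrCA lerDl.
  by rewrite addr_ge0// sumr_ge0// => l _; exact: sumr_ge0.
have [|u Hu] := cl G.
  move=> k e e0; have [e' e'0 He] := est _ _ M' k e e0; have [u Hu] := HF k e' e'0.
  by exists u => j; rewrite HM'; exact: He.
exists u => i; rewrite HM.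
apply/eqP; rewrite -subr_eq0; apply/eqP/(@nrm_eq0 _ _ 0)/le_anti; rewrite nrm_ge0 andbT.
apply/ler_addgt0Pl => e e0; rewrite addr0.
have e2 : 0 < e / 2 by exact: divr_gt0.
have [e1 e10 H1] := est _ _ M 0%N _ e2; have [e1' e10' H1'] := est _ _ M' 0%N _ e10.
have [|v Hv] := HF 0%N (Num.min (e / 2) e1'); first by rewrite lt_min e2.
have -> : \sum_j (M i j)%:C *: Q j u - F i =
    (\sum_j (M i j)%:C *: Q j u - \sum_j (M i j)%:C *: Q j v) + (Q' i v - F i).
  by rewrite (HM i v) addrA subrK.
rewrite (le_trans (nrmD _ _ _))// (splitr e); apply: lerD.
  apply: H1 => j; rewrite Hu HM' nrm_distC; apply: H1' => i'.
  by rewrite (le_trans (Hv i'))// ge_min lexx orbT.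
by rewrite (le_trans (Hv i))// ge_min lexx.
Qed.

Lemma span_tuple_coord m (V : m.-tuple 'rV[R]_N) (B : seq 'rV[R]_N) v : v \in <<V>>%VS ->
  v = \sum_j coord V j v *: tnth V j.
Proof. by move=> /coord_span {1}->; apply: eq_bigr => j _; rewrite (tnth_nth 0). Qed.

(** Any basis of the span and the finite generating family express each other with constant
    coefficients, so [closed_range_span] applies both ways and the choice of basis is immaterial. *)
Lemma globally_solvable_constantP m (V : 'I_m -> 'rV[R]_N) (L : set 'rV[R]_N) :
  (forall v, L v <-> exists j, v = V j) ->
  globally_solvable_constant L <-> globally_solvable_family (fun j => vf_act (constant_field (V j))).
Proof.
move=> LV; pose t := [tuple V j | j < m].
have tV j : tnth t j = V j by rewrite tnth_mktuple.
have Vt j : V j \in <<t>>%VS by rewrite -tV memv_span// mem_tnth.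
have sp (U : {vspace 'rV[R]_N}) : is_span L U <-> U = <<t>>%VS.
  split=> [[LU minU]|->].
    apply/eqP; rewrite eqEsubv; apply/andP; split.
      by apply: minU => v /LV[j ->].
    by apply/span_subvP => v /tnthP[j ->]; rewrite tV; apply: LU; apply/LV; exists j.
  split; first by move=> v /LV[j ->].
  by move=> W LW; apply/span_subvP => v /tnthP[j ->]; rewrite tV; apply: LW; apply/LV; exists j.
have key d (B : d.-tuple 'rV[R]_N) : basis_of <<t>>%VS B ->
    (globally_solvable_family (fun i : 'I_d => vf_act (constant_field (tnth B i))) <->
     globally_solvable_family (fun j => vf_act (constant_field (V j)))).
  move=> bB; have sB := span_basis bB.
  have h1 i u : vf_act (constant_field (tnth B i)) u =
      \sum_j (coord t j (tnth B i))%:C *: vf_act (constant_field (V j)) u.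
    rewrite {1}(@span_tuple_coord _ t t (tnth B i)); last by rewrite -sB memv_span// mem_tnth.
    by rewrite vf_act_constant_sum; apply: eq_bigr => j _; rewrite tV.
  have h2 j u : vf_act (constant_field (V j)) u =
      \sum_i (coord B i (V j))%:C *: vf_act (constant_field (tnth B i)) u.
    rewrite {1}(@span_tuple_coord _ B B (V j)); last by rewrite sB.
    by rewrite vf_act_constant_sum.
  rewrite !globally_solvable_familyP; split.
    exact: (closed_range_span (Q := fun i => vf_act (constant_field (tnth B i)))
      (Q' := fun j => vf_act (constant_field (V j))) h2 h1).
  exact: (closed_range_span (Q := fun j => vf_act (constant_field (V j)))
    (Q' := fun i => vf_act (constant_field (tnth B i))) h1 h2).
split=> [[U [/sp -> [d [B [bB gB]]]]]|gV]; first by apply/(key _ _ bB).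
exists <<t>>%VS; split; first exact/sp.
by exists (\dim <<t>>%VS), (vbasis <<t>>%VS); split; [exact: vbasisP|apply/(key _ _ (vbasisP _))].
Qed.

End constant_systems.

Section flat_tube.
Context {R : realType} {n : nat}.
Notation T := (torus_fun R (n + 1)).
Variable a : 'I_n -> torus_fun R n.
Hypothesis ha : forall j t, a j t \is Num.real.
Notation al := (lifted a).
Variables (A : T) (c : 'I_n -> R).
Hypothesis AD : Dx A = 0.
Hypothesis AR : tconj A = A.
Hypothesis alA : forall j, al j = dt j A + (c j)%:C *: (1 : T).

(** Over a period the integral of [dt j A] vanishes, leaving the constant. The means therefore do
    not depend on [t], and [mean_system] reduces to [n] fields. *)
Lemma flat_mean j t : mean a j t = c j.
Proof.
pose x0 : 'rV[R]_(n + 1) := row_mx (\row_k (if k == j then 0 else t 0 k)) 0.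
pose y s : 'rV[R]_(n + 1) := x0 + s *: delta_mx 0 (lshift 1 j).
pose F s := complex.Re (A (y s)) + c j * s.
pose f s := complex.Re (pd (lshift 1 j) A (y s)) + c j.
have E s : complex.Re (a j (\row_k (if k == j then s else t 0 k))) = f s.
  have -> : a j (\row_k (if k == j then s else t 0 k)) = al j (y s).
    rewrite /lifted /=; congr (a j _); apply/rowP => k; rewrite mxE [RHS]mxE /y mxE row_mxEl !mxE eqxx/=.
    by rewrite (inj_eq (@lshift_inj _ _)); case: eqP => _; rewrite ?mulr1 ?add0r ?mulr0 ?addr0.
  by rewrite alA /dt tfunD tfunZ tfun1 mulr1 /f; case: (pd _ _ _).
have dF (s : R) : is_derive s 1 F (f s).
  have h1 : is_derive s (1 : R) (fun s => complex.Re (A (y s))) (complex.Re (pd (lshift 1 j) A (y s))).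
    rewrite -(congr1 (fun g => g (y s)) (Re_pd (lshift 1 j) A)).
    by apply: is_derive_line => z; exact: tRe_derivable.
  have h2 := is_deriveZ (c j) (is_derive_id s (1 : R)).
  have := is_deriveD h1 h2; rewrite [c j *: 1]mulr1; exact.
have cf : continuous f.
  move=> s; apply: cvgD; last exact: cvg_cst.
  apply: (continuous_comp (f := y) (g := fun z => complex.Re (pd (lshift 1 j) A z))).
    by apply: cvgD; [exact: cvg_cst|apply: cvgZr_tmp].
  exact: tRe_continuous.
rewrite /mean; under eq_Rintegral do rewrite E.
rewrite -/(circle_int f) (circle_FTC cf dF) /F mulr0 addr0 /y scale0r addr0 tperiodic.
by rewrite addrAC subrr add0r mulrCA mulVf ?mulr1// gt_eqF// twopi_gt0.
Qed.

Lemma flat_mean_system v : mean_system a v <-> exists j, v = row_mx (delta_mx 0 j) (c j)%:M.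
Proof.
split=> [[j [t ->]]|[j ->]]; first by exists j; rewrite flat_mean.
by exists j, 0; rewrite flat_mean.
Qed.

Let al0 j : T := (c j)%:C *: (1 : T).

Let al0D j : Dx (al0 j) = 0.
Proof. by rewrite DxZ /Dx pd1 scaler0. Qed.
Let al0R j : tconj (al0 j) = al0 j.
Proof. by rewrite tconjZ tconj1; congr (_ *: _); apply/eqP; rewrite eq_complex/= oppr0 !eqxx. Qed.
Let al0A j : al0 j = dt j (0 : T) + (c j)%:C *: (1 : T).
Proof. by rewrite /dt pd0 add0r. Qed.

Lemma vf_act_mean j f : vf_act (constant_field (row_mx (delta_mx 0 j) (c j)%:M)) f = Xf al0 j f.
Proof.
rewrite vf_act_constant sum_tube; congr (_ + _).
  rewrite (bigD1 j)//= big1 ?addr0 => [|i ij].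
    by rewrite row_mxEl mxE !eqxx scale1r.
  by rewrite row_mxEl mxE (negbTE ij) andbF scale0r.
by rewrite row_mxEr mxE eqxx /al0 -tscalerAl mul1r.
Qed.

Lemma flat_equivalence0 :
  (dioph c <-> globally_solvable_constant (mean_system a)) /\
  (dioph c <-> almost_globally_hypoelliptic [set vf_dist (constant_field v) | v in mean_system a]).
Proof.
have D0 : Dx (0 : T) = 0 by exact: pd0.
have [_ _ e3 e4] := flat_equivalence al0D al0R D0 (tconj0 (R := R) (N := n + 1)) al0A; split.
  rewrite (globally_solvable_constantP flat_mean_system) globally_solvable_familyP e3.
  have -> : Xf al0 = (fun j => vf_act (constant_field (row_mx (delta_mx 0 j) (c j)%:M))).
    by apply/funext => j; apply/funext => f; rewrite vf_act_mean.
  by [].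
rewrite e4; apply: iff_sym; apply: (@aghP _ _ _ _ _ (-1)); first by rewrite oppr_eq0 oner_eq0.
  move=> Q [v /flat_mean_system[j ->] <-]; exists j => u su phi.
  by rewrite vf_dist_div_free ?vf_act_mean ?mulN1r// => k; exact: constant_field_div_free.
move=> j; exists (vf_dist (constant_field (row_mx (delta_mx 0 j) (c j)%:M))).
  by exists (row_mx (delta_mx 0 j) (c j)%:M) => //; apply/flat_mean_system; exists j.
move=> u su phi.
by rewrite vf_dist_div_free ?vf_act_mean ?mulN1r// => k; exact: constant_field_div_free.
Qed.

(** Real combinations of the [X_j] with constant coefficients are stable under brackets, since the
    [X_j] commute when the curvature vanishes. *)
Lemma flat_lie_algebra (Z : vector_field R (n + 1)) : (forall j k, curv al j k = 0) ->
  lie_algebra (tube_system a) Z ->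
  exists r : 'I_n -> R, forall k, Z k = \sum_j (r j)%:C *: tube_field a j k.
Proof.
move=> flat; elim=> [_ [j _ <-]| |X Y _ [r Hr] _ [s Hs]|b X _ [r Hr]|X Y _ [r Hr] _ [s Hs]].
- exists (fun i => (i == j)%:R) => k; rewrite (bigD1 j)//= big1 => [|i ij].
    by rewrite eqxx scale1r addr0.
  by rewrite (negbTE ij) scale0r.
- by exists (fun=> 0) => k; rewrite big1// => j _; rewrite scale0r.
- exists (fun j => r j + s j) => k; rewrite fctE Hr Hs -big_split/=; apply: eq_bigr => j _.
  by rewrite rmorphD scalerDl.
- exists (fun j => b * r j) => k.
  have -> : (b%:C *: X) k = b%:C *: X k by [].
  by rewrite Hr scaler_sumr; apply: eq_bigr => j _; rewrite rmorphM scalerA.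
- exists (fun=> 0) => k; rewrite [RHS]big1 => [|j _]; last by rewrite scale0r.
  have act (q : 'I_n -> R) (W : vector_field R (n + 1)) f : (forall k, W k = \sum_j (q j)%:C *: tube_field a j k) ->
      vf_act W f = \sum_j (q j)%:C *: Xf al j f.
    move=> HW; rewrite vf_actE; under eq_bigr do rewrite HW mulr_suml.
    rewrite exchange_big/=; apply: eq_bigr => j _; rewrite -vf_act_tube vf_actE scaler_sumr.
    by apply: eq_bigr => i _; rewrite tscalerAl.
  have Xs j (q : 'I_n -> R) : Xf al j (\sum_i (q i)%:C *: tube_field a i k) =
      \sum_i (q i)%:C *: Xf al j (tube_field a i k).
    rewrite (big_morph (Xf al j) (XfD al j) (Xf0 al j)); apply: eq_bigr => i _.
    by rewrite XfZ.
  rewrite /lie_bracket (act _ _ _ Hr) (act _ _ _ Hs) Hs Hr; apply/eqP; rewrite subr_eq0; apply/eqP.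
  under eq_bigr do rewrite Xs scaler_sumr.
  under [RHS]eq_bigr do rewrite Xs scaler_sumr.
  rewrite exchange_big/=; apply: eq_bigr => i _; apply: eq_bigr => j _.
  rewrite !scalerA mulrC; congr (_ *: _); apply/eqP; rewrite -subr_eq0; apply/eqP.
  have := lie_bracket_tube a j i k; rewrite /lie_bracket !vf_act_tube => ->.
  by rewrite flat; case: fintype.split.
Qed.

Lemma flat_not_finite_type : (forall j k, curv al j k = 0) -> ~ exists t : 'rV[R]_n, finite_type a t.
Proof.
move=> flat [t /(_ 0) ft]; have [Z lZ HZ] := ft (delta_mx 0 ix).
have [r Hr] := flat_lie_algebra flat lZ.
(* The first [n] components of the combination are the coefficients themselves, and reaching the [x]
   direction forces them all to vanish. *)
have r0 i : r i = 0.
  have := HZ (lshift 1 i); rewrite Hr tfun_sum (bigD1 i)//= [X in _ + X]big1 ?addr0 => [|j ji]; last first.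
    have -> : tube_field a j (lshift 1 i) = 0 by rewrite tube_field_l eq_sym (negbTE ji).
    exact: mulr0.
  have -> : tube_field a i (lshift 1 i) = 1 by rewrite tube_field_l eqxx.
  move=> h; have {h} : (r i)%:C * (1 : R[i]) = (delta_mx 0 ix 0 (lshift 1 i) : R)%:C := h.
  by rewrite mulr1 mxE eqxx/= eq_lrshift => /(congr1 (@complex.Re R)).
have := HZ ix; rewrite Hr big1 => [|j _]; last by rewrite r0 scale0r.
by rewrite mxE !eqxx => /(congr1 (@complex.Re R))/= /eqP; rewrite eq_sym oner_eq0.
Qed.

End flat_tube.

(** * The equivalences, according to whether the fields commute *)

Theorem theorem1p5 (R : realType) (n : nat) (hn : (0 < n)%N)
    (a : 'I_n -> torus_fun R n)
    (ha : forall j t, a j t \is Num.real) :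
  [<-> globally_solvable (sum_squares_act (tube_field a));
       almost_globally_hypoelliptic [set sum_squares_dist (tube_field a)];
       globally_solvable_family (fun j => vf_act (tube_field a j));
       almost_globally_hypoelliptic [set vf_dist X | X in tube_system a];
       globally_solvable_constant (mean_system a) \/
         exists t : 'rV[R]_n, finite_type a t;
       almost_globally_hypoelliptic
           [set vf_dist (constant_field v) | v in mean_system a] \/
         exists t : 'rV[R]_n, finite_type a t ].
Proof.
have alD := lifted_Dx a; have alR := lifted_conj ha.
have [[j0 [k0 curv0]]|flat] := pselect (exists j k, curv (lifted a) j k != 0).
  have ft := curved_finite_type ha curv0.
  have h1 : globally_solvable (sum_squares_act (tube_field a)).
    by apply/globally_solvable_sum_squares; exact: (Pf_closed alD alR curv0).
  have h2 : almost_globally_hypoelliptic [set sum_squares_dist (tube_field a)].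
    by apply/agh_sum_squares; exact: (curved_agh_Pf ha curv0).
  have h3 : globally_solvable_family (fun j => vf_act (tube_field a j)).
    by apply/globally_solvable_tube; exact: (Xf_closed alD alR curv0).
  have h4 : almost_globally_hypoelliptic [set vf_dist X | X in tube_system a].
    by apply/agh_tube; exact: (curved_agh_Xf ha curv0).
  by tfae => // _; right.
have {}flat j k : curv (lifted a) j k = 0.
  by apply/eqP/negPn/negP => c0; apply: flat; exists j, k.
have [A [c [AD AR alA]]] := flat_gauge alD alR flat.
have nft := flat_not_finite_type flat.
have [e1 e2 e3 e4] := flat_equivalence alD alR AD AR alA.
have [e5 e6] := flat_equivalence0 alA.
have g1 := globally_solvable_sum_squares a; have g2 := agh_sum_squares a.
have g3 := globally_solvable_tube a; have g4 := agh_tube a.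
by tfae; tauto.
Qed.
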